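(* Let $\boldsymbol{f}\in\mathbf{Q}=L^2(\Omega)^2$. Let $(\boldsymbol{\sigma},\boldsymbol{u})\in\mathbb{H}_0\times\mathbf{Q}$ be the solution of $$a(\boldsymbol{\sigma},\boldsymbol{\tau})+b(\boldsymbol{\tau},\boldsymbol{u})+c(\boldsymbol{u},\boldsymbol{\tau})=0\quad\forall\boldsymbol{\tau}\in\mathbb{H}_0,\qquad b(\boldsymbol{\sigma},\boldsymbol{v})-d(\boldsymbol{v},\boldsymbol{u})=-\int_\Omega\boldsymbol{f}\cdot\boldsymbol{v}\quad\forall\boldsymbol{v}\in\mathbf{Q},$$ and let $(\boldsymbol{\sigma}_h,\boldsymbol{u}_h)\in\mathbb{H}_{0,h}\times\mathbf{Q}_h$ be the solution of $$a_h(\boldsymbol{\sigma}_h,\boldsymbol{\tau}_h)+b(\boldsymbol{\tau}_h,\boldsymbol{u}_h)+c_h(\boldsymbol{u}_h,\boldsymbol{\tau}_h)=0\quad\forall\boldsymbol{\tau}_h\in\mathbb{H}_{0,h},\qquad b(\boldsymbol{\sigma}_h,\boldsymbol{v}_h)-d(\boldsymbol{u}_h,\boldsymbol{v}_h)=-\int_\Omega\boldsymbol{f}\cdot\boldsymbol{v}_h\quad\forall\boldsymbol{v}_h\in\mathbf{Q}_h.$$ Assume that there exists $s\in[1,k+1]$ such that $$\|\boldsymbol{\sigma}\|_{s,\Omega}+\|\mathbf{div}\,\boldsymbol{\sigma}\|_{1+s,\Omega}+\|\boldsymbol{u}\|_{1+s,\Omega}\le C_\Omega\|\boldsymbol{f}\|_{0,\Omega},$$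 where the constant $C_\Omega>0$ depends on the domain and the physical parameters. If $p\in L^2_0(\Omega)$ and $p_h\in L^2_0(\Omega)$ are given by $$p=-\tfrac12\bigl(\mathrm{tr}(\boldsymbol{\sigma})+\mathrm{tr}(\boldsymbol{u}\otimes\boldsymbol{\beta})\bigr),\qquad p_h=-\tfrac12\bigl(\mathrm{tr}(\Pi_h\boldsymbol{\sigma}_h)+\mathrm{tr}(\boldsymbol{u}_h\otimes\boldsymbol{\beta})\bigr)\quad\text{in }\Omega,$$ then $$\|p-p_h\|_{0,\Omega}\le\mathbf{C}\,h^s\,\|\boldsymbol{f}\|_{0,\Omega},\qquad \mathbf{C}:=\max\left\{\frac{\sqrt2}{2},\|\boldsymbol{\beta}\|_{\infty,\Omega}\right\}\widehat{C}_{\nu,\beta,\kappa},$$ where $\widehat{C}_{\nu,\beta,\kappa}$ is the constant, independent of $h$, specified in the context.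
   Context: Let $\Omega\subset\mathbb{R}^2$ be a bounded polygonal (Lipschitz) domain, $\nu,\kappa>0$ constants and $\boldsymbol{\beta}\in W^{1,\infty}(\Omega)^2$. $\|\cdot\|_{0,D}$ is the $L^2(D)$ norm, $\|\cdot\|_{\infty,\Omega}$ the $L^\infty(\Omega)$ norm, $\|\cdot\|_{t,\Omega}$ the $H^t(\Omega)$ norm (scalars, vectors, tensors); $L^2_0(\Omega)$ is the space of $L^2(\Omega)$ functions with zero mean. For a tensor $\boldsymbol{\tau}$, $\boldsymbol{\tau}^{\mathtt{d}}:=\boldsymbol{\tau}-\frac12\mathrm{tr}(\boldsymbol{\tau})\mathbb{I}$, '':'' is the Frobenius product, $\mathbf{div}$ is the row-wise divergence. $\mathbb{H}=\mathbb{H}(\mathbf{div};\Omega)$ is the space of $2\times2$ tensor fields in $L^2$ with $\mathbf{div}\,\boldsymbol{\tau}\in L^2(\Omega)^2$, with norm $\|\boldsymbol{\tau}\|_{\mathbf{div},\Omega}^2=\|\boldsymbol{\tau}\|_{0,\Omega}^2+\|\mathbf{div}\,\boldsymbol{\tau}\|_{0,\Omega}^2$; $\mathbb{H}_0:=\{\boldsymbol{\tau}\in\mathbb{H}:\int_\Omega\mathrm{tr}(\boldsymbol{\tau})=0\}$; $|||(\boldsymbol{\tau},\boldsymbol{v})|||^2:=\|\boldsymbol{\tau}\|_{\mathbf{div},\Omega}^2+\|\boldsymbol{v}\|_{0,\Omega}^2$. Meshes: $\{\mathcal{T}_h\}_{h>0}$ is a family of decompositions of $\Omega$ into non-overlapping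 polygons $E$ (diameter $h_E$, $h=\max_E h_E$) for which there are constants $\hat c,\eta>0$ such that every edge $e\subset\partial E$ has length $h_e\ge \hat c\,h_E$ and every $E$ is star-shaped with respect to a ball of radius $\eta h_E$. Spaces: fix an integer $k\ge0$; $P_j$ denotes polynomials of degree $\le j$, with $P_{-1}=\{0\}$. For $E\in\mathcal{T}_h$, $\mathbf{W}_h^E$ is the set of $\boldsymbol{\tau}=(\tau_1,\tau_2)\in H(\mathrm{div};E)\cap H(\mathrm{rot};E)$ with $\boldsymbol{\tau}\cdot\boldsymbol{n}|_e\in P_k(e)$ for every edge $e\subset\partial E$, $\mathrm{div}\,\boldsymbol{\tau}\in P_k(E)$, $\mathrm{rot}\,\boldsymbol{\tau}:=\partial_{x_1}\tau_2-\partial_{x_2}\tau_1\in P_{k-1}(E)$. $\mathbb{H}_h^E$ is the set of tensor fields on $E$ both of whose rows lie in $\mathbf{W}_h^E$; $\mathbb{H}_h:=\{\boldsymbol{\tau}_h\in\mathbb{H}:\boldsymbol{\tau}_h|_E\in\mathbb{H}_h^E\ \forall E\in\mathcal{T}_h\}$; $\mathbb{H}_{0,h}:=\{\boldsymbol{\tau}_h\in\mathbb{H}_h:\int_\Omega\mathrm{tr}(\boldsymbol{\tau}_h)=0\}$; $\mathbf{Q}_h:=\{\boldsymbol{v}\in\mathbf{Q}:\boldsymbol{v}|_E\in P_k(E)^2\ \forall E\in\mathcal{T}_h\}$. Forms: $a(\boldsymbol{\rho},\boldsymbol{\tau})=\frac1\nu\int_\Omega\boldsymbol{\rho}^{\mathtt{d}}:\boldsymbol{\tau}^{\mathtt{d}}$,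 $b(\boldsymbol{\tau},\boldsymbol{v})=\int_\Omega\mathbf{div}\,\boldsymbol{\tau}\cdot\boldsymbol{v}$, $c(\boldsymbol{v},\boldsymbol{\tau})=\frac1\nu\int_\Omega(\boldsymbol{v}\otimes\boldsymbol{\beta})^{\mathtt{d}}:\boldsymbol{\tau}$, $d(\boldsymbol{v},\boldsymbol{w})=\int_\Omega\kappa\,\boldsymbol{v}\cdot\boldsymbol{w}$. $\Pi_h^E$ is the $L^2(E)^{2\times2}$-orthogonal projector onto $P_k(E)^{2\times2}$, and $(\Pi_h\boldsymbol{\tau})|_E:=\Pi_h^E(\boldsymbol{\tau}|_E)$. $S^E$ is a symmetric positive definite bilinear form with $\frac{c_0}{\nu}\|\boldsymbol{\tau}_h\|_{0,E}^2\le S^E(\boldsymbol{\tau}_h,\boldsymbol{\tau}_h)\le\frac{c_1}{\nu}\|\boldsymbol{\tau}_h\|_{0,E}^2$ for all $\boldsymbol{\tau}_h\in\mathbb{H}_h^E$, where $c_0,c_1>0$ are constants depending on the mesh assumptions. With $a^E(\boldsymbol{\sigma},\boldsymbol{\tau}):=\frac1\nu\int_E\boldsymbol{\sigma}^{\mathtt{d}}:\boldsymbol{\tau}^{\mathtt{d}}$, set $a_h(\boldsymbol{\sigma}_h,\boldsymbol{\tau}_h):=\sum_{E\in\mathcal{T}_h}\bigl[a^E(\Pi_h^E\boldsymbol{\sigma}_h,\Pi_h^E\boldsymbol{\tau}_h)+S^E(\boldsymbol{\sigma}_h-\Pi_h^E\boldsymbol{\sigma}_h,\boldsymbol{\tau}_h-\Pi_h^E\boldsymbol{\tau}_h)\bigr]$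 and $c_h(\boldsymbol{v}_h,\boldsymbol{\tau}_h):=\sum_{E\in\mathcal{T}_h}\frac1\nu\int_E(\boldsymbol{v}_h\otimes\boldsymbol{\beta})^{\mathtt{d}}:\Pi_h^E\boldsymbol{\tau}_h$. The constant $\widehat{C}_{\nu,\beta,\kappa}$: it is the positive constant, independent of $h$, of the a priori estimate $|||(\boldsymbol{\sigma}-\boldsymbol{\sigma}_h,\boldsymbol{u}-\boldsymbol{u}_h)|||\le\widehat{C}_{\nu,\beta,\kappa}\,h^s\|\boldsymbol{f}\|_{0,\Omega}$ for the velocity and pseudostress, given by $$\widehat{C}_{\nu,\beta,\kappa}:=C\,C_\Omega\max\left\{C_\nu,\ \max\{1,\kappa\},\ \frac{2+\sqrt2}{2\nu}\|\boldsymbol{\beta}\|_{W^{s,\infty}(\Omega)}\right\},\qquad C_\nu:=\frac3\nu\max\left\{\Bigl(\frac{\sqrt2+2}{2}\Bigr)^2,c_1\right\},$$ where $C>0$ is a generic constant, independent of $h$, associated with the approximation properties of the virtual element interpolant and of the $L^2$ projectors. *)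

(* Defs.v *)
From HB Require Import structures.
From mathcomp Require Import all_boot all_order all_algebra.
From mathcomp Require Import all_classical all_reals all_analysis.
Import numFieldNormedType.Exports.
Set Implicit Arguments.
Unset Strict Implicit.
Unset Printing Implicit Defensive.
Import Order.TTheory GRing.Theory Num.Theory.
Local Open Scope classical_set_scope.
Local Open Scope ring_scope.

(* Points of the plane are pairs R * R; the norm of this product type is the
   sup norm, hence the Euclidean norm enorm below.  Functions are total on the
   plane, and a space of functions on D constrains their values on D only.
   Norms take values in \bar R and are +oo outside the corresponding space. *)

Definition leb2 (R : realType) :
    {measure set (measurableTypeR R * measurableTypeR R) -> \bar R} :=
  (@lebesgue_measure R \x @lebesgue_measure R)%E.
Arguments leb2 R : clear implicits.

Section Geometry.
Variable R : realType.
Local Notation pt := (R * R)%type.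

Definition dotp (x y : pt) : R := x.1 * y.1 + x.2 * y.2.
Definition enorm (x : pt) : R := Num.sqrt (dotp x x).
Definition eball (c : pt) (r : R) : set pt := [set x | enorm (x - c) < r].
Definition seg (a b : pt) : set pt :=
  [set x | exists2 t : R, 0 <= t <= 1 & x = a + t *: (b - a)].
Definition diam (D : set pt) : R :=
  sup [set d | exists x y, [/\ D x, D y & d = enorm (x - y)]].

(* [boundary] is meant for open sets. *)
Definition boundary (D : set pt) : set pt := closure D `\` D.

(* Near each boundary point, in the orthonormal frame (rot d, d), the domain
   is the strict epigraph of a Lipschitz function. *)
Definition lipschitz_domain (D : set pt) : Prop :=
  forall x0, boundary D x0 ->
  exists (d : pt) (r L : R) (g : R -> R),
    [/\ enorm d = 1, 0 < r,
        forall a b, `|g a - g b| <= L * `|a - b| &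
        forall x, eball x0 r x -> D x <-> g (dotp (- d.2, d.1) x) < dotp d x].

Definition polygonal_domain (D : set pt) : Prop :=
  [/\ D !=set0, open D, connected D, bounded_set D &
      exists ab : seq (pt * pt),
        boundary D = \bigcup_(e in [set` ab]) seg e.1 e.2].

(* A polygon is an open set with the cyclic list of its vertices (angles equal
   to pi are allowed): the list is a simple closed polygonal curve and the set
   is the bounded region that it encloses. *)
Record polygon := Polygon { pdom : set pt ; pvert : seq pt }.

Definition vtx (E : polygon) (i : nat) : pt :=
  nth 0 (pvert E) (i %% size (pvert E)).
Definition edge (E : polygon) (i : nat) : set pt := seg (vtx E i) (vtx E i.+1).
Definition edge_length (E : polygon) (i : nat) : R :=
  enorm (vtx E i.+1 - vtx E i).
Definition edge_interior (E : polygon) (i : nat) : set pt :=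
  edge E i `\` [set vtx E i; vtx E i.+1].

Definition is_polygon (E : polygon) : Prop :=
  let n := size (pvert E) in
  [/\ [/\ pdom E !=set0, open (pdom E), connected (pdom E) &
          bounded_set (pdom E)],
      (2 < n)%N, uniq (pvert E),
      forall i j, (i < n)%N -> (j < n)%N -> i != j ->
        forall x, edge E i x -> edge E j x ->
          (j = (i.+1 %% n)%N /\ x = vtx E j) \/
          (i = (j.+1 %% n)%N /\ x = vtx E i) &
      boundary (pdom E) = \bigcup_(i in `I_n) edge E i].

Record mesh := Mesh { ncell : nat ; cell : 'I_ncell -> polygon }.

Definition is_mesh (D : set pt) (T : mesh) : Prop :=
  [/\ forall j : 'I_(ncell T), is_polygon (cell j),
      forall j : 'I_(ncell T), pdom (cell j) `<=` D,
      forall i j : 'I_(ncell T), i != j ->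
        pdom (cell i) `&` pdom (cell j) = set0 &
      closure D = \bigcup_(j in [set: 'I_(ncell T)]) closure (pdom (cell j))].

Definition mesh_size (T : mesh) : R :=
  \big[Num.max/0]_(j < ncell T) diam (pdom (cell j)).

Definition mesh_regular (chat eta : R) (T : mesh) : Prop :=
  forall j : 'I_(ncell T), let E := cell j in let hE := diam (pdom E) in
    (forall i, (i < size (pvert E))%N -> chat * hE <= edge_length E i) /\
    exists c, eball c (eta * hE) `<=` pdom E /\
      forall y x, eball c (eta * hE) y -> pdom E x -> seg y x `<=` pdom E.

End Geometry.
Arguments cell {R} m _.

Section FunctionSpaces.
Variable R : realType.
Local Notation pt := (R * R)%type.
Local Notation mu := (leb2 R).
Implicit Types (D : set pt) (p : \bar R) (phi f : pt -> R).

Definition axis (i : 'I_2) : pt := if i == 0 then (1, 0) else (0, 1).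
Definition partial (i : 'I_2) phi : pt -> R := fun x => 'D_(axis i) phi x.
Definition partials (l : seq 'I_2) phi : pt -> R := foldr partial phi l.
Definition smooth phi : Prop :=
  forall l x, {for x, continuous (partials l phi)} /\
    forall i, derivable (partials l phi) x (axis i).
Definition supp phi : set pt := closure [set x | phi x != 0].
Definition test_function D phi : Prop :=
  [/\ smooth phi, compact (supp phi) & supp phi `<=` D].
Definition multi_partial (a b : nat) phi : pt -> R :=
  partials (nseq a (0 : 'I_2) ++ nseq b (1 : 'I_2)) phi.

Definition inLp p D f : Prop := (f \_ D) \in Lfun mu p.
Definition normLp p D f : \bar R := 'N[mu]_p[EFin \o (f \_ D)]%E.

Section Fields.
Variables m n : nat.
Implicit Types u g : pt -> 'M[R]_(m, n).

Definition ddot (A B : 'M[R]_(m, n)) : R := \sum_i \sum_j A i j * B i j.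
Definition frob (A : 'M[R]_(m, n)) : R := Num.sqrt (ddot A A).
Definition inLpM p D u : Prop := forall i j, inLp p D (fun x => u x i j).
Definition normLpM p D u : \bar R := normLp p D (fun x => frob (u x)).

Definition weak_partial D (a b : nat) u g : Prop :=
  forall i j phi, test_function D phi ->
    \int[mu]_(x in D) (u x i j * multi_partial a b phi x) =
    (-1) ^+ (a + b) * \int[mu]_(x in D) (g x i j * phi x).

Definition weak_partials p D (r : nat) u (g : nat -> nat -> pt -> 'M[R]_(m, n))
    : Prop :=
  g 0 0 = u /\ forall a b, (a + b <= r)%N ->
    inLpM p D (g a b) /\ weak_partial D a b u (g a b).

(* The L^p(D x D) norm of |u x - u y| / |x - y| ^ w, as an iterated norm. *)
Definition frac_seminorm p (w : R) D u : \bar R :=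
  let quot x y := frob (u x - u y) / enorm (x - y) `^ w in
  'N[mu]_p[(fun x => 'N[mu]_p[EFin \o (quot x \_ D)]%E) \_ D]%E.

(* H^t(D) norm, t >= 0, with the Sobolev-Slobodeckij seminorm when t is not an
   integer.  The weak derivatives are unique almost everywhere, so that the
   infimum is over a single value, or over the empty set (+oo) outside
   H^t(D). *)
Definition normH D (t : R) u : \bar R :=
  let r := Num.truncn t in let theta := t - r%:R in
  ereal_inf [set N | exists2 g, weak_partials 2%:E D r u g &
    N = (((\sum_(a < r.+1) \sum_(b < r.+1 - a) normLpM 2%:E D (g a b) ^+ 2) +
          (if (theta == 0)%R then 0 else
             \sum_(a < r.+1) frac_seminorm 2%:E (1 + theta)%R D
                               (g a (r - a)%N) ^+ 2)) `^ 2^-1%R)%E].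

(* W^{t,oo}(D) norm, with the Hoelder seminorm when t is not an integer. *)
Definition normWinf D (t : R) u : \bar R :=
  let r := Num.truncn t in let theta := t - r%:R in
  ereal_inf [set N | exists2 g, weak_partials +oo%E D r u g &
    N = maxe (\big[maxe/0%E]_(a < r.+1) \big[maxe/0%E]_(b < r.+1 - a)
                normLpM +oo%E D (g a b))
             (if theta == 0 then 0%E else
                \big[maxe/0%E]_(a < r.+1)
                  frac_seminorm +oo%E theta D (g a (r - a)%N))].

End Fields.

Definition weak_div D (w : pt -> 'rV[R]_2) f : Prop :=
  forall phi, test_function D phi ->
    \int[mu]_(x in D) (f x * phi x) =
    - \int[mu]_(x in D) (\sum_i w x 0 i * partial i phi x).

Definition weak_rot D (w : pt -> 'rV[R]_2) f : Prop :=
  forall phi, test_function D phi ->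
    \int[mu]_(x in D) (f x * phi x) =
    \int[mu]_(x in D) (w x 0 0 * partial 1 phi x - w x 0 1 * partial 0 phi x).

(* The L^2(D) weak divergence, if there is one, and 0 otherwise. *)
Definition wdiv D (w : pt -> 'rV[R]_2) : pt -> R :=
  xget (fun=> 0) [set f | inLp 2%:E D f /\ weak_div D w f].

Definition inHdiv D (w : pt -> 'rV[R]_2) : Prop :=
  inLpM 2%:E D w /\ exists f, inLp 2%:E D f /\ weak_div D w f.

Definition inHrot D (w : pt -> 'rV[R]_2) : Prop :=
  inLpM 2%:E D w /\ exists f, inLp 2%:E D f /\ weak_rot D w f.

Definition trow (tau : pt -> 'M[R]_2) (i : 'I_2) : pt -> 'rV[R]_2 :=
  fun x => row i (tau x).

Definition bdiv D (tau : pt -> 'M[R]_2) : pt -> 'cV[R]_2 :=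
  fun x => \col_i wdiv D (trow tau i) x.

Definition inHHdiv D (tau : pt -> 'M[R]_2) : Prop :=
  forall i, inHdiv D (trow tau i).

Definition inHH0 D (tau : pt -> 'M[R]_2) : Prop :=
  inHHdiv D tau /\ \int[mu]_(x in D) \tr (tau x) = 0.

Definition inL20 D f : Prop :=
  inLp 2%:E D f /\ \int[mu]_(x in D) f x = 0.

Definition triple_norm D (tau : pt -> 'M[R]_2) (v : pt -> 'cV[R]_2) : \bar R :=
  ((normLpM 2%:E D tau ^+ 2 + normLpM 2%:E D (bdiv D tau) ^+ 2 +
    normLpM 2%:E D v ^+ 2) `^ 2^-1%R)%E.

(* Polynomials of total degree < d, so that P_{-1} = {0} is d = 0. *)
Definition poly_lt (d : nat) f : Prop :=
  exists c : nat -> nat -> R, forall x,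
    f x = \sum_(i < d) \sum_(j < d - i) c i j * x.1 ^+ i * x.2 ^+ j.

Definition poly_ltM (d m n : nat) (u : pt -> 'M[R]_(m, n)) : Prop :=
  forall i j, poly_lt d (fun x => u x i j).

End FunctionSpaces.

Section VirtualElements.
Variable R : realType.
Local Notation pt := (R * R)%type.
Local Notation mu := (leb2 R).
Local Notation tensor := (pt -> 'M[R]_2).
Local Notation vector := (pt -> 'cV[R]_2).
Variable k : nat.

(* w.n is in P_k(e) for the edge e = edge E i: the normal trace of w, which is
   defined by Green's formula, is tested against the smooth functions whose
   support meets the boundary inside the open edge only. *)
Definition normal_trace_poly (E : polygon R) (w : pt -> 'rV[R]_2) (i : nat) :
    Prop :=
  exists g : {poly R}, (size g <= k.+1)%N /\
  forall phi, test_function setT phi ->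
    supp phi `&` boundary (pdom E) `<=` edge_interior E i ->
    \int[mu]_(x in pdom E)
        (wdiv (pdom E) w x * phi x + \sum_j w x 0 j * partial j phi x) =
    edge_length E i * \int[@lebesgue_measure R]_(t in `[0, 1])
        (g.[t] * phi (vtx E i + t *: (vtx E i.+1 - vtx E i))).

Definition inWhE (E : polygon R) (w : pt -> 'rV[R]_2) : Prop :=
  [/\ inHdiv (pdom E) w, inHrot (pdom E) w,
      forall i, (i < size (pvert E))%N -> normal_trace_poly E w i,
      exists q, poly_lt k.+1 q /\ weak_div (pdom E) w q &
      exists q, poly_lt k q /\ weak_rot (pdom E) w q].

Definition inHHhE (E : polygon R) (tau : tensor) : Prop :=
  forall i, inWhE E (trow tau i).

Definition inHH0h (D : set pt) (T : mesh R) (tau : tensor) : Prop :=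
  inHH0 D tau /\ forall j, inHHhE (cell T j) tau.

Definition inQh (D : set pt) (T : mesh R) (v : vector) : Prop :=
  inLpM 2%:E D v /\
  forall j, exists q, poly_ltM k.+1 q /\
    {ae mu, forall x, pdom (cell T j) x -> v x = q x}.

Definition PiE (E : polygon R) (tau : tensor) : tensor :=
  xget (fun=> 0) [set q | poly_ltM k.+1 q /\
    forall r : tensor, poly_ltM k.+1 r ->
      \int[mu]_(x in pdom E) ddot (tau x - q x) (r x) = 0].

Definition Pih (T : mesh R) (tau : tensor) : tensor :=
  fun x => \sum_(j < ncell T | x \in pdom (cell T j)) PiE (cell T j) tau x.

Definition tdev (A : 'M[R]_2) : 'M[R]_2 := A - (2^-1 * \tr A)%:M.
Definition otimes (v w : 'cV[R]_2) : 'M[R]_2 := v *m w^T.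

Definition form_a (nu : R) (D : set pt) (rho tau : tensor) : R :=
  nu^-1 * \int[mu]_(x in D) ddot (tdev (rho x)) (tdev (tau x)).
Definition form_b (D : set pt) (tau : tensor) (v : vector) : R :=
  \int[mu]_(x in D) ddot (bdiv D tau x) (v x).
Definition form_c (nu : R) (beta : vector) (D : set pt) (v : vector)
    (tau : tensor) : R :=
  nu^-1 * \int[mu]_(x in D) ddot (tdev (otimes (v x) (beta x))) (tau x).
Definition form_d (kappa : R) (D : set pt) (v w : vector) : R :=
  \int[mu]_(x in D) (kappa * ddot (v x) (w x)).
Definition load (D : set pt) (f v : vector) : R :=
  \int[mu]_(x in D) ddot (f x) (v x).

Definition stabilization (nu c0 c1 : R) (E : polygon R)
    (S : tensor -> tensor -> R) : Prop :=
  [/\ forall tau rho, inHHhE E tau -> inHHhE E rho -> S tau rho = S rho tau,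
      forall (a : R) sigma tau rho,
        inHHhE E sigma -> inHHhE E tau -> inHHhE E rho ->
        S (fun x => a *: sigma x + tau x) rho = a * S sigma rho + S tau rho,
      forall tau, inHHhE E tau -> normLpM 2%:E (pdom E) tau != 0%E ->
        0 < S tau tau &
      forall tau, inHHhE E tau ->
        ((c0 / nu)%:E * normLpM 2%:E (pdom E) tau ^+ 2 <= (S tau tau)%:E /\
         (S tau tau)%:E <= (c1 / nu)%:E * normLpM 2%:E (pdom E) tau ^+ 2)%E].

Definition form_ah (nu : R) (T : mesh R)
    (S : 'I_(ncell T) -> tensor -> tensor -> R) (sigma tau : tensor) : R :=
  \sum_(j < ncell T) (let P := PiE (cell T j) in
    form_a nu (pdom (cell T j)) (P sigma) (P tau) +
    S j (fun x => sigma x - P sigma x) (fun x => tau x - P tau x)).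

Definition form_ch (nu : R) (beta : vector) (T : mesh R) (v : vector)
    (tau : tensor) : R :=
  \sum_(j < ncell T) form_c nu beta (pdom (cell T j)) v (PiE (cell T j) tau).

Definition continuous_solution (D : set pt) (nu kappa : R) (beta f : vector)
    (sigma : tensor) (u : vector) : Prop :=
  [/\ inHH0 D sigma, inLpM 2%:E D u,
      forall tau, inHH0 D tau ->
        form_a nu D sigma tau + form_b D tau u + form_c nu beta D u tau = 0 &
      forall v, inLpM 2%:E D v ->
        form_b D sigma v - form_d kappa D v u = - load D f v].

Definition discrete_solution (D : set pt) (nu kappa : R) (beta f : vector)
    (T : mesh R) (S : 'I_(ncell T) -> tensor -> tensor -> R)
    (sigmah : tensor) (uh : vector) : Prop :=
  [/\ inHH0h D T sigmah, inQh D T uh,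
      forall tauh, inHH0h D T tauh ->
        form_ah nu S sigmah tauh + form_b D tauh uh +
        form_ch nu beta T uh tauh = 0 &
      forall vh, inQh D T vh ->
        form_b D sigmah vh - form_d kappa D uh vh = - load D f vh].

End VirtualElements.

Section Constants.
Variable R : realType.

Definition C_nu (nu c1 : R) : R :=
  3 / nu * Num.max (((Num.sqrt 2 + 2) / 2) ^+ 2) c1.

(* C is the generic constant.  The value is +oo when beta is not in W^{s,oo},
   in which case an estimate with this constant is void. *)
Definition Chat (C C_Omega nu kappa c1 s : R) (D : set (R * R))
    (beta : R * R -> 'cV[R]_2) : \bar R :=
  ((C * C_Omega)%:E *
   maxe (Num.max (C_nu nu c1) (Num.max 1 kappa))%:E
        (((2 + Num.sqrt 2) / (2 * nu))%:E * normWinf D s beta))%E.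

Definition bold_C (C C_Omega nu kappa c1 s : R) (D : set (R * R))
    (beta : R * R -> 'cV[R]_2) : \bar R :=
  (maxe (Num.sqrt 2 / 2)%:E (normLpM +oo D beta) *
   Chat C C_Omega nu kappa c1 s D beta)%E.

End Constants.

(* Main.v *)
(* Pointwise, p - ph is controlled by sigma - Pi sigmah and u - uh.  On a cell E the
   projector is a contraction that fixes polynomials, so that for every q in P_k

     ||sigma - Pi sigmah|| <= 2 ||sigma - q|| + ||sigma - sigmah||.

   Hence the a priori estimate suffices, given a Bramble-Hilbert estimate for
   ||sigma - q|| on every cell whose constant depends on eta only.  This follows,
   by induction on the order, from a Poincare inequality on a domain E that is
   star-shaped with respect to a square.  For v on E let v_t(x) be the average of
   v over the square contracted towards x by the factor 1 - t: v_0 does not depend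
   on x, v_t tends to v in L^1(E) as t tends to 1, and d/dt v_t(x) is an average of
   (x - z) . grad v, so that Schur's test bounds v_t - v_0 in L^2(E).  When s is
   not an integer, the induction starts from the Sobolev-Slobodeckij seminorm: some
   value of the highest derivatives of sigma approximates them in the mean. *)

Require Import Defs.
From HB Require Import structures.
From mathcomp Require Import all_boot all_order all_algebra.
From mathcomp Require Import all_classical all_reals all_analysis.
From mathcomp Require Import measurable_realfun ess_sup_inf.
From mathcomp Require Import ring lra zify.
Import numFieldNormedType.Exports.
Set Implicit Arguments.
Unset Strict Implicit.
Unset Printing Implicit Defensive.
Import Order.TTheory GRing.Theory Num.Theory.
Local Open Scope classical_set_scope.
Local Open Scope ring_scope.

(** * Smooth functions of one real variable *)

(** The functions involved have weak derivatives only, and they are not approximated by smooth ones: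
    the flux of the averaging kernel is itself the test function. Hence a genuinely smooth
    mollifier, built from exp (-1/x), a kernel in product form, and squares in place of balls.
    Products of functions of one variable need one-variable calculus only. The Poincare inequality
    is proved for integrable v, whose averages converge in L^1 only. The L^2 bound is therefore
    proved for the truncations of |v - v_0|, where an L^1 error costs no more than a multiple of the
    truncation level; the resulting bound does not depend on that level, and monotone convergence
    concludes. The approximation error of sigma is bounded by C_Omega ||f|| alone, whereas the
    claimed constant contains the maxima of C-hat and of the final constant. These are at least 1
    and sqrt 2 / 2, so that the error is absorbed by enlarging the generic constant, which keeps the
    a priori estimate true. *)

Section Smooth1.
Variable R : realType.
Implicit Types f g : R -> R.

(** [derive1] has a value at every point, derivable or not; hence the separate requirement of
    derivability at each order. *)
Fixpoint Cn (n : nat) f : Prop :=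
  match n with
  | 0 => continuous f
  | n.+1 => (forall x, derivable f x 1) /\ Cn n (derive1 f)
  end.

Definition smooth1 f : Prop := forall n, Cn n f.

Lemma Cn_continuous n f : Cn n f -> continuous f.
Proof.
case: n => [//|n [df _]] x.
exact/differentiable_continuous/derivable1_diffP.
Qed.

Lemma CnW n f : Cn n.+1 f -> Cn n f.
Proof.
elim: n f => [|n IH] f [df Cf]; last by split => //; apply: IH.
by apply: (@Cn_continuous 1).
Qed.

Lemma is_derive_Cn n f f' : (forall x, is_derive (x : R) (1 : R) f (f' x)) ->
  Cn n f' -> Cn n.+1 f.
Proof.
move=> df Cf'; split; first by move=> x; apply: (@ex_derive _ _ _ _ _ _ _ (df x)).
suff -> : (derive1 f) = f' by [].
by apply/funext => x; rewrite derive1E; apply: derive_val.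
Qed.

Lemma smooth1_derivable f x : smooth1 f -> derivable f x 1.
Proof. by move=> /(_ 1) []. Qed.

Lemma smooth1_is_derive f x : smooth1 f -> is_derive (x : R) (1 : R) f ((derive1 f) x).
Proof. by move=> /smooth1_derivable => /(_ x) /derivableP; rewrite derive1E. Qed.

Lemma smooth1_derive f : smooth1 f -> smooth1 (derive1 f).
Proof. by move=> sf n; have [] := sf n.+1. Qed.

Lemma smooth1_derive1n f n : smooth1 f -> smooth1 (derive1n n f).
Proof.
move=> sf; elim: n => [|n IH]; rewrite ?derive1n0// derive1nS.
exact: smooth1_derive.
Qed.

Lemma smooth1_continuous f : smooth1 f -> continuous f.
Proof. by move=> /(_ 0). Qed.

Lemma smooth1P f f' : (forall x, is_derive (x : R) (1 : R) f (f' x)) -> smooth1 f' ->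
  smooth1 f.
Proof. by move=> df sf' n; apply: CnW; apply: is_derive_Cn (sf' n). Qed.

Lemma smooth1_cst (c : R) : smooth1 (cst c).
Proof.
move=> n; elim: n c => [c x|n IH c]; first exact: cvg_cst.
by apply: (@is_derive_Cn n (cst c) (cst 0)) => // x; apply: is_derive_cst.
Qed.

Lemma smooth1_id : smooth1 id.
Proof. by apply: (@smooth1P id (cst 1)); exact: smooth1_cst. Qed.

Lemma Cn_add n f g : Cn n f -> Cn n g -> Cn n (fun x => f x + g x).
Proof.
elim: n f g => [f g cf cg x|n IH f g Cf Cg]; first exact: cvgD (cf x) (cg x).
case: (Cf) => df Cf'; case: (Cg) => dg Cg'.
apply: (@is_derive_Cn _ _ (fun x => (derive1 f) x + (derive1 g) x)); last exact: IH.
move=> x; rewrite !derive1E.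
by apply: is_deriveD; apply: derivableP.
Qed.

Lemma Cn_mul n f g : Cn n f -> Cn n g -> Cn n (fun x => f x * g x).
Proof.
elim: n f g => [f g cf cg x|n IH f g Cf Cg]; first exact: cvgM (cf x) (cg x).
case: (Cf) => df Cf'; case: (Cg) => dg Cg'.
apply: (@is_derive_Cn n (fun x => f x * g x) (fun x => (derive1 f) x * g x + f x * (derive1 g) x)); last first.
  by apply: Cn_add; apply: IH => //; apply: CnW.
move=> x; rewrite !derive1E.
apply: (is_derive_eq (is_deriveM (derivableP (df x)) (derivableP (dg x)))).
rewrite /GRing.scale/= addrC; congr (_ + _).
by rewrite mulrC.
Qed.

Lemma smooth1_add f g : smooth1 f -> smooth1 g -> smooth1 (fun x => f x + g x).
Proof. by move=> sf sg n; apply: Cn_add. Qed.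

Lemma smooth1_mul f g : smooth1 f -> smooth1 g -> smooth1 (fun x => f x * g x).
Proof. by move=> sf sg n; apply: Cn_mul. Qed.

Lemma smooth1_scale (c : R) f : smooth1 f -> smooth1 (fun x => c * f x).
Proof. by move=> sf; apply: (smooth1_mul (@smooth1_cst c)). Qed.

Lemma smooth1_pow (n : nat) : smooth1 (fun x => x ^+ n).
Proof.
elim: n => [|n IH].
  by under eq_fun do rewrite expr0; apply: smooth1_cst.
by under eq_fun do rewrite exprS; apply: smooth1_mul smooth1_id IH.
Qed.

Lemma is_derive_affine f (a b x : R) (df : R) : is_derive (a * x + b) (1 : R) f df ->
  is_derive (x : R) (1 : R) (fun x => f (a * x + b)) (a * df).
Proof.
move=> dfx.
have dg : is_derive x (1 : R) (fun x : R => a * x + b) a.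
  have -> : (fun x : R => a * x + b) = (a *: id + cst b) by apply/funext.
  by apply: is_derive_eq; rewrite addr0 /GRing.scale /= mulr1.
by rewrite mulrC; apply: (@is_derive1_comp _ f (fun x : R => a * x + b)).
Qed.

Lemma smooth1_affine f (a b : R) : smooth1 f -> smooth1 (fun x => f (a * x + b)).
Proof.
move=> sf n; elim: n f sf => [|n IH] f sf.
  move=> x; apply: (@cvg_comp _ _ _ (fun x : R => a * x + b) f).
    by apply: cvgD; [apply: cvgM; [apply: cvg_cst|apply: cvg_id]|apply: cvg_cst].
  exact: smooth1_continuous.
apply: (@is_derive_Cn _ _ (fun x => a * (derive1 f) (a * x + b))).
  by move=> x; apply: is_derive_affine; apply: smooth1_is_derive.
apply: Cn_mul; last by apply: IH; apply: smooth1_derive.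
exact: smooth1_cst.
Qed.

Lemma derive1_zero_on (U : set R) f : open U -> (forall x, U x -> f x = 0) ->
  forall x, U x -> (derive1 f) x = 0.
Proof.
move=> oU fU x Ux; rewrite derive1E.
rewrite (@near_eq_derive _ _ _ f (cst 0)) ?derive_cst ?oner_neq0//.
near=> y; apply: fU; near: y; exact: open_nbhs_nbhs.
Unshelve. all: by end_near. Qed.

(** For p = 1 this is the classical flat function exp (-1/x). The polynomial factor makes the family
    stable under differentiation, so that one induction on the order, for all p at once, gives
    smoothness. *)
Definition flat (p : {poly R}) (x : R) : R :=
  if 0 < x then p.[x^-1] * expR (- x^-1) else 0.

(** [flat p x / x] is the difference quotient at 0. With y = 1/x >= 1, N the size of p and A the sum
    of the absolute values of its coefficients, |p(y)| <= A y^N and exp y >= y^(N+2) / (N+2)!. One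
    of the two spare powers of y absorbs the division by x, and the other leaves the factor x. *)
Lemma flat_bound (p : {poly R}) : exists2 C : R, 0 < C &
  forall x, 0 < x <= 1 -> `|flat p x / x| <= C * x.
Proof.
pose N := size p; pose A := \sum_(i < N) `|p`_i|.
exists ((1 + A) * N.+2`!%:R).
  by rewrite mulr_gt0 ?ltr0n ?fact_gt0// ltr_pwDl// sumr_ge0.
move=> x /andP[x0 x1]; rewrite /flat x0.
set y := x^-1.
have y1 : 1 <= y by rewrite invf_ge1.
have y0 : 0 < y by rewrite invr_gt0.
have xE : x = y^-1 by rewrite invrK.
rewrite expRN [in X in _ <= X]xE.
have Ey : y ^+ N.+2 / N.+2`!%:R <= expR y.
  by have := expR_ge1Dxn N.+1 (ltW y0); lra.
have py : `|p.[y]| <= A * y ^+ N.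
  rewrite horner_coef mulr_suml (le_trans (ler_norm_sum _ _ _))//.
  apply: ler_sum => i _; rewrite normrM ler_wpM2l// normrX gtr0_norm//.
  by rewrite ler_weXn2l// ltnW.
rewrite !normrM (gtr0_norm y0) normfV (gtr0_norm (expR_gt0 y)).
have F0 : 0 < N.+2`!%:R :> R by rewrite ltr0n fact_gt0.
have -> : (1 + A) * N.+2`!%:R / y = ((1 + A) * N.+2`!%:R * expR y / y) / expR y.
  by field; rewrite !gt_eqF ?expR_gt0.
rewrite mulrAC ler_wpM2r ?invr_ge0 ?expR_ge0//.
have -> : (1 + A) * N.+2`!%:R * expR y / y = (1 + A) / y * (N.+2`!%:R * expR y).
  by field; rewrite gt_eqF.
have A0 : 0 <= A by rewrite sumr_ge0.
apply: (@le_trans _ _ ((1 + A) / y * y ^+ N.+2)).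
  have -> : (1 + A) / y * y ^+ N.+2 = (1 + A) * y ^+ N * y.
    by rewrite !exprS; field; rewrite gt_eqF.
  rewrite ler_wpM2r ?(ltW y0)// (le_trans py)// ler_wpM2r ?exprn_ge0 ?(ltW y0)//.
  by rewrite lerDr.
rewrite ler_wpM2l ?mulr_ge0 ?addr_ge0 ?invr_ge0 ?(ltW y0) ?(ltW x0)//.
by move: Ey; rewrite ler_pdivrMr// mulrC.
Qed.

(** Differentiating p(1/x) exp (-1/x) leaves exp (-1/x) times this polynomial at 1/x. *)
Definition flat' (p : {poly R}) : {poly R} := 'X^2 * (p - p^`()).

Lemma flat_is_derive (p : {poly R}) x : is_derive (x : R) (1 : R) (flat p) (flat (flat' p) x).
Proof.
have [x0|x0|<-] := ltgtP 0 x.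
- have dV : is_derive x (1 : R) (fun y : R => y^-1) (- x ^- 2).
    have xn0 : (id : R -> R) x != 0 by rewrite gt_eqF.
    apply: (is_derive_eq (is_deriveV xn0 (is_derive_id x (1 : R)))).
    by rewrite /GRing.scale/= mulr1.
  have dE : is_derive x (1:R) (fun y : R => expR (- y^-1)) (x ^- 2 * expR (- x^-1)).
    rewrite mulrC.
    apply: (@is_derive1_comp _ expR (fun y : R => - y^-1)).
    rewrite -[x ^- 2]opprK; exact: is_deriveN.
  have dp : is_derive x (1:R) (fun y : R => p.[y^-1]) (p^`().[x^-1] * (- x ^- 2)).
    apply: (@is_derive1_comp _ (horner p) (fun y : R => y^-1)).
  have dM := is_deriveM dp dE.
  have : is_derive x (1:R) (fun y : R => p.[y^-1] * expR (- y^-1)) (flat (flat' p) x).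
    apply: is_derive_eq.
    rewrite /flat x0 /flat' hornerM hornerXn hornerD hornerN exprVn /GRing.scale/=.
    by ring.
  apply: near_eq_is_derive; near=> y; rewrite /flat ifT//; near: y.
  exact: lt_nbhsr.
- have : is_derive x (1:R) (cst (0 : R)) (flat (flat' p) x).
    by rewrite /flat ltNge (ltW x0)/=; apply: is_derive_cst.
  apply: near_eq_is_derive; near=> y; rewrite /flat ifF//.
  apply/negbTE; rewrite -leNgt ltW//; near: y; exact: lt_nbhsl.
- rewrite [flat (flat' p) 0]/flat ltxx.
  have [C C0 FC] := flat_bound p.
  have lim : (fun h : R => h^-1 *: (flat p (h *: 1 + 0) - flat p 0)) @ 0^' --> (0 : R).
    apply/cvgrPdist_le => e e0; near=> h.
    rewrite sub0r normrN /GRing.scale/= mulr1 addr0 [flat p 0]/flat ltxx subr0.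
    have [h0|h0] := ltP 0 h; last first.
      by rewrite /flat ltNge h0/= mulr0 normr0 ltW.
    rewrite mulrC (le_trans (FC _ _))//.
      rewrite h0/=; near: h; apply: nbhs_dnbhs; exact: lt_le_nbhsl ltr01.
    rewrite -ler_pdivlMl//; near: h; apply: nbhs_dnbhs.
    by apply: lt_le_nbhsl; rewrite mulr_gt0 ?invr_gt0.
  apply: DeriveDef; last by apply/cvg_lim.
  by apply/cvg_ex; exists 0.
Unshelve. all: by end_near. Qed.

Lemma smooth1_flat (p : {poly R}) : smooth1 (flat p).
Proof.
move=> n; elim: n p => [|n IH] p.
  move=> x; apply/differentiable_continuous/derivable1_diffP.
  exact: (@ex_derive _ _ _ _ _ _ _ (flat_is_derive p x)).
exact: is_derive_Cn (flat_is_derive p) (IH _).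
Qed.

Definition bumpf (x : R) : R := flat 1 (x + 1) * flat 1 (- x + 1).

Lemma flat1_ge0 x : 0 <= flat 1 x.
Proof. by rewrite /flat; case: ifP => // _; rewrite hornerE mul1r expR_ge0. Qed.

Lemma smooth1_bumpf : smooth1 bumpf.
Proof.
apply: smooth1_mul.
  have -> : (fun x : R => flat 1 (x + 1)) = (fun x => flat 1 (1 * x + 1)).
    by apply/funext => x; rewrite mul1r.
  exact/smooth1_affine/smooth1_flat.
have -> : (fun x : R => flat 1 (- x + 1)) = (fun x => flat 1 ((-1) * x + 1)).
  by apply/funext => x; rewrite mulN1r.
exact/smooth1_affine/smooth1_flat.
Qed.

Lemma bumpf_ge0 x : 0 <= bumpf x.
Proof. by rewrite mulr_ge0 ?flat1_ge0. Qed.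

Lemma bumpf_gt0 x : `|x| < 1 -> 0 < bumpf x.
Proof.
rewrite ltr_norml => /andP[x0 x1]; rewrite /bumpf /flat !hornerE.
have -> : 0 < x + 1 by lra.
have -> : 0 < - x + 1 by lra.
by rewrite mulr_gt0 ?expR_gt0.
Qed.

Lemma bumpf_eq0 x : 1 <= `|x| -> bumpf x = 0.
Proof.
rewrite ler_normr /bumpf /flat => /orP[x1|x1].
  by rewrite [X in _ * X]ifF ?mulr0//; apply/negbTE; rewrite -leNgt; lra.
by rewrite ifF ?mul0r//; apply/negbTE; rewrite -leNgt; lra.
Qed.

End Smooth1.

(** * Lebesgue measure in the plane and the null sets of a mesh *)

Section Plane.
Variable R : realType.
Local Notation pt := (R * R)%type.
Local Notation mpt := (measurableTypeR R * measurableTypeR R)%type.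
Local Notation mu := (leb2 R).
Local Notation leb := (@lebesgue_measure R).

Definition box (c : pt) (d : R) : set pt :=
  [set z | c.1 - d < z.1 < c.1 + d /\ c.2 - d < z.2 < c.2 + d].

(** The sigma-algebra of the plane is the product one, so that an open set has to be exhibited as a
    countable union of rectangles; squares with rational centre and half-side suffice. *)
Lemma open_measurable2 (D : set pt) : open D -> measurable (D : set mpt).
Proof.
move=> oD.
pose I := (rat * rat * rat)%type.
pose B (i : I) : set pt := box (ratr i.1.1, ratr i.1.2) (ratr i.2).
pose P := [set i : I | B i `<=` D].
have -> : D = \bigcup_(i in P) B i.
  apply/seteqP; split; last by move=> x [i Pi] /Pi.
  move=> x Dx; have /nbhs_ballP[e /= e0 xe] := open_nbhs_nbhs (conj oD Dx).
  have [q /andP[q0 qe]] : exists q : rat, (0 : R) < ratr q < e / 2.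
    have /rat_in_itvoo[q] : (0 : R) < e / 2 by rewrite divr_gt0.
    by rewrite in_itv/=; exists q.
  have near_rat (y : R) : exists p : rat, `|y - ratr p| < ratr q.
    have /rat_in_itvoo[p] : y - ratr q < y + ratr q by rewrite ltrD2l gtrN.
    rewrite in_itv/= => /andP[p1 p2]; exists p.
    by rewrite ltr_norml; apply/andP; split; lra.
  have [p1 /ltr_normlP [? ?]] := near_rat x.1; have [p2 /ltr_normlP [? ?]] := near_rat x.2.
  exists ((p1, p2), q); last by rewrite /B /box/=; split; apply/andP; split; lra.
  move=> z [/= /andP[? ?] /andP[? ?]]; apply: xe; split => /=;
    by rewrite /ball/= ltr_norml; apply/andP; split; lra.
rewrite bigcup_mkcond; apply: countable_bigcupT_measurable => [|i].
  exact: countableP.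
case: ifP => // _.
have -> : B i = `](ratr i.1.1 - ratr i.2), (ratr i.1.1 + ratr i.2)[%classic `*`
   `](ratr i.1.2 - ratr i.2), (ratr i.1.2 + ratr i.2)[%classic.
  by apply/seteqP; split => z; rewrite /B /box /= !in_itv/=.
by apply: measurableX; exact: measurable_itv.
Qed.

(** Writing 1/y as y times the power -1 of y^2 reduces the inverse to the power function, which is
    measurable on the whole line; at y = 0 both sides vanish. *)
Lemma measurable_funV d (T : measurableType d) (D : set T) (f : T -> R) :
  measurable_fun D f -> measurable_fun D (fun x => (f x)^-1).
Proof.
move=> mf.
have -> : (fun x => (f x)^-1) = (fun x => f x * (f x ^+ 2) `^ (-1)).
  apply/funext => x; rewrite powR_inv1 ?sqr_ge0//.
  have [->|fx0] := eqVneq (f x) 0; first by rewrite invr0 mul0r.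
  by field.
apply: measurable_funM => //.
apply: (@measurable_comp _ _ _ _ _ _ setT (fun x : R => x `^ (-1))) => //.
exact: measurable_funX.
Qed.

Lemma leb2X (A B : set R) : measurable A -> measurable B ->
  mu (A `*` B) = (leb A * leb B)%E.
Proof. by move=> mA mB; apply: product_measure1E. Qed.

Lemma boxE (c : pt) (d : R) :
  box c d = `]c.1 - d, c.1 + d[%classic `*` `]c.2 - d, c.2 + d[%classic.
Proof. by apply/seteqP; split => z; rewrite /box /= !in_itv/=. Qed.

Lemma measurable_box c d : measurable (box c d : set mpt).
Proof. by rewrite boxE; apply: measurableX; exact: measurable_itv. Qed.

Lemma leb2_box c d : 0 < d -> mu (box c d) = ((2 * d) ^+ 2)%:E.
Proof.
move=> d0; rewrite boxE leb2X; [|exact: measurable_itv..].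
rewrite !lebesgue_measure_itv/= !lte_fin !ifT; [|lra..].
by rewrite -!EFinB -EFinM; congr EFin; ring.
Qed.

Lemma bounded_sub_box (D : set pt) : bounded_set D ->
  exists2 M : R, 0 < M & D `<=` box (0, 0)%R M.
Proof.
move=> [M [_ DM]]; exists (`|M| + 2); first by rewrite ltr_wpDl.
move=> x Dx; have := DM (`|M| + 1); rewrite ltr_pwDr// ?ler_norm//.
  move=> /(_ isT x Dx) /=; rewrite prod_normE ge_max => /andP[].
  rewrite !ler_norml => /andP[? ?] /andP[? ?].
  by rewrite /box/=; split; apply/andP; split; lra.
Qed.

Lemma leb2_bounded_lty (D : set pt) : measurable (D : set mpt) -> bounded_set D ->
  (mu D < +oo)%E.
Proof.
move=> mD /bounded_sub_box[M M0 DM].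
have /le_lt_trans -> // : (mu D <= mu (box (0, 0)%R M))%E.
  by apply: le_measure => //; rewrite inE//; exact: measurable_box.
by rewrite leb2_box// ltry.
Qed.

(** A line that is not vertical meets each vertical line in one point. Segments, and then the
    boundaries of polygons, are null as a consequence, which is why the open cells cover the domain
    up to a null set. *)
Lemma leb2_line (a b c : R) : (a, b) != 0 ->
  mu.-negligible [set x : mpt | a * x.1 + b * x.2 = c].
Proof.
move=> ab0.
have mL : measurable [set x : mpt | a * x.1 + b * x.2 = c].
  rewrite -[X in measurable X]setTI.
  suff mf : measurable_fun setT (fun x : mpt => a * x.1 + b * x.2).
    by apply: (mf measurableT [set c]).
  apply: measurable_funD; apply: measurable_funM => //.
  apply/negligibleP => //.
have [b0|b0] := eqVneq b 0.
  have a0 : a != 0 by apply: contraNneq ab0 => ->; rewrite b0.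
  have -> : [set x : mpt | a * x.1 + b * x.2 = c] = [set c / a] `*` setT.
    apply/seteqP; split => [x /= <-|x /= [-> _]].
      by rewrite b0 mul0r addr0 mulrAC divff// mul1r.
    by rewrite b0 mul0r addr0 mulrCA divff// mulr1.
  apply: (eq_trans (leb2X (measurable_set1 _) measurableT)).
  by rewrite lebesgue_measure_set1 mul0e.
apply: integral0_eq => x _ /=.
have -> : xsection [set x : mpt | a * x.1 + b * x.2 = c] x = [set (c - a * x) / b].
  apply/seteqP; split => [y /set_mem /= <-|y ->].
    by rewrite addrAC subrr add0r mulrAC divff// mul1r.
  by apply/mem_set => /=; rewrite mulrCA divff// mulr1 addrC subrK.
exact: lebesgue_measure_set1.
Qed.

Lemma leb2_seg (a b : pt) : mu.-negligible (seg a b : set mpt).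
Proof.
have [->|ab] := eqVneq a b.
  apply: (@negligibleS _ mpt R mu [set x : mpt | 1 * x.1 + 0 * x.2 = b.1] _).
    move=> x [t _ ->] /=; ring.
  by apply: leb2_line; rewrite xpair_eqE oner_eq0.
apply: (@negligibleS _ mpt R mu [set x : mpt | (b.2 - a.2) * x.1 + (a.1 - b.1) * x.2
   = (b.2 - a.2) * a.1 + (a.1 - b.1) * a.2] _).
  by move=> x [t _ ->] /=; rewrite /GRing.scale/=; ring.
apply: leb2_line; apply: contra ab; rewrite !xpair_eqE !subr_eq0 => /andP[/eqP h /eqP h'].
by rewrite [a]surjective_pairing [b]surjective_pairing h h' eqxx.
Qed.

Lemma boundary_negligible (E : polygon R) : is_polygon E ->
  mu.-negligible (boundary (pdom E) : set mpt).
Proof.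
move=> [_ _ _ _ ->]; rewrite bigcup_mkord.
apply: big_ind => [|A B|i _]; [exact: negligible_set0|exact: negligibleU|].
exact: leb2_seg.
Qed.

Lemma mesh_cover (D : set pt) (T : mesh R) : is_mesh D T ->
  {ae mu, forall x, D x -> exists j, pdom (cell T j) x}.
Proof.
move=> [Tp _ _ DT].
apply: (@negligibleS _ mpt R mu
  (\big[setU/set0]_(j < ncell T) boundary (pdom (cell T j))) _); last first.
  apply: big_ind => [|A B|i _]; [exact: negligible_set0|exact: negligibleU|].
  exact: boundary_negligible.
move=> x /= /not_implyP[Dx nx].
have : closure D x by exact: subset_closure.
rewrite DT => -[j _ xj].
rewrite -bigcup_seq; exists j; first by rewrite /= mem_index_enum.
by split => // xE; apply: nx; exists j.
Qed.

Lemma EFin_Rint d (T : measurableType d) (m : {measure set T -> \bar R})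
  (D : set T) (f : T -> R) : measurable D -> m.-integrable D (EFin \o f) ->
  ((\int[m]_(x in D) f x)%:E = \int[m]_(x in D) (f x)%:E)%E.
Proof. by move=> mD fi; rewrite /Rintegral fineK//; apply: integrable_fin_num. Qed.

Lemma ge0_integralZ_EFin d (T : measurableType d) (m : {measure set T -> \bar R})
  (D : set T) (c : R) (f : T -> R) : measurable D -> measurable_fun D f ->
  (forall x, D x -> 0 <= f x) -> 0 <= c ->
  (\int[m]_(x in D) (c * f x)%:E = c%:E * \int[m]_(x in D) (f x)%:E)%E.
Proof.
move=> mD mf f0 c0; under eq_integral do rewrite EFinM.
by rewrite ge0_integralZl//; exact/measurable_EFinP.
Qed.

Lemma ge0_integralD_EFin d (T : measurableType d) (m : {measure set T -> \bar R})
  (D : set T) (f g : T -> R) : measurable D -> measurable_fun D f ->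
  measurable_fun D g -> (forall x, D x -> 0 <= f x) -> (forall x, D x -> 0 <= g x) ->
  (\int[m]_(x in D) (f x + g x)%:E =
   \int[m]_(x in D) (f x)%:E + \int[m]_(x in D) (g x)%:E)%E.
Proof.
move=> mD mf mg f0 g0; under eq_integral do rewrite EFinD.
by rewrite ge0_integralD//; exact/measurable_EFinP.
Qed.

Lemma ge0_le_integral_EFin d (T : measurableType d) (m : {measure set T -> \bar R})
  (D : set T) (f g : T -> R) : measurable D -> measurable_fun D f ->
  measurable_fun D g -> (forall x, D x -> 0 <= f x) -> (forall x, D x -> f x <= g x) ->
  (\int[m]_(x in D) (f x)%:E <= \int[m]_(x in D) (g x)%:E)%E.
Proof.
by move=> mD mf mg f0 fg; apply: ge0_le_integral => //; exact/measurable_EFinP.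
Qed.

End Plane.

(** * The contracting kernel *)

Section Kernel1.
Variable R : realType.
Local Notation leb := (@lebesgue_measure R).

Lemma is_derive_comp1 (f g : R -> R) (x df dg : R) :
  is_derive (g x) (1 : R) f df -> is_derive x (1 : R) g dg ->
  is_derive x (1 : R) (fun y => f (g y)) (df * dg).
Proof. by move=> hf hg; apply: (@is_derive1_comp _ f g). Qed.

Lemma continuous_FTC2_cc (f F : R -> R) (a b : R) : a < b ->
  (forall x, a <= x <= b -> is_derive x (1 : R) F (f x)) ->
  (forall x, a <= x <= b -> {for x, continuous f}) ->
  (\int[leb]_(x in `[a, b]) (f x)%:E = (F b - F a)%:E)%E.
Proof.
move=> ab dF cf; rewrite EFinB; apply: continuous_FTC2 => //.
- apply: continuous_in_subspaceT => x; rewrite inE/= in_itv/=; exact: cf.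
- have cF x : a <= x <= b -> {for x, continuous F}.
    move=> /dF [dFx _]; exact/differentiable_continuous/derivable1_diffP.
  split.
  + by move=> x; rewrite in_itv/= => /andP[ax xb]; have [|] := dF x; rewrite ?ltW.
  + by apply: cvg_at_right_filter; apply: cF; rewrite lexx ltW.
  + by apply: cvg_at_left_filter; apply: cF; rewrite lexx ltW.
- move=> x; rewrite in_itv/= => /andP[ax xb]; rewrite derive1E.
  by apply: derive_val; apply: dF; rewrite !ltW.
Qed.

Lemma bumpf_integrable (a b : R) : leb.-integrable `[a, b] (EFin \o @bumpf R).
Proof.
apply: continuous_compact_integrable; first exact: segment_compact.
exact/continuous_subspaceT/smooth1_continuous/smooth1_bumpf.
Qed.

(** On [-1/2, 1/2] the bump is continuous and positive, and this interval has length 1: the minimum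
    of the bump there is a lower bound of the integral. *)
Lemma bumpfZ_gt0 : (0 < \int[leb]_(x in `[-1, 1]) bumpf x)%R.
Proof.
have [m mI mmin] := @EVT_min R (@bumpf R) (- 2^-1) 2^-1 ltac:(lra)
  (continuous_subspaceT (smooth1_continuous (@smooth1_bumpf R))).
have m0 : 0 < bumpf m.
  by apply: bumpf_gt0; move: mI; rewrite in_itv/= -ler_norml; lra.
apply: (lt_le_trans m0).
have -> : bumpf m = \int[leb]_(x in `[- 2^-1, 2^-1]) bumpf m.
  rewrite Rintegral_cst//= lebesgue_measure_itv/= lte_fin ifT; last lra.
  by rewrite -EFinB/=; lra.
have mb (D : set R) : measurable_fun D (fun x => (bumpf x)%:E).
  apply/measurable_EFinP; apply: measurable_funTS; apply: continuous_measurable_fun.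
  exact/smooth1_continuous/smooth1_bumpf.
rewrite -lee_fin !EFin_Rint//; last 2 first.
- exact: bumpf_integrable.
- apply: (@continuous_compact_integrable _ (fun=> bumpf m)); first exact: segment_compact.
  by apply: continuous_subspaceT => y; apply: cvg_cst.
apply: (@le_trans _ _ (\int[leb]_(x in `[(- 2^-1)%R, 2^-1%R]) (bumpf x)%:E)%E).
  apply: ge0_le_integral => //.
  - by move=> x _; rewrite lee_fin ltW.
  - exact: mb.
apply: ge0_subset_integral => //.
- exact: mb.
- by move=> x _; rewrite lee_fin bumpf_ge0.
- by move=> x /=; rewrite !in_itv/= => /andP[? ?]; apply/andP; split; lra.
Qed.

Definition bumpZ := (\int[leb]_(x in `[-1, 1]) (@bumpf R x))%R.
Definition moll (x : R) := bumpZ^-1 * bumpf x.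

Lemma smooth1_moll : smooth1 moll.
Proof. exact/smooth1_scale/smooth1_bumpf. Qed.

Lemma moll_ge0 x : 0 <= moll x.
Proof. by rewrite mulr_ge0 ?bumpf_ge0// invr_ge0 ltW// bumpfZ_gt0. Qed.

Lemma moll_eq0 x : 1 <= `|x| -> moll x = 0.
Proof. by move=> x1; rewrite /moll bumpf_eq0 ?mulr0. Qed.

Lemma dmoll_eq0 x : 1 < `|x| -> derive1 moll x = 0.
Proof.
apply: (@derive1_zero_on _ [set x | 1 < `|x|]).
  apply: (@open_comp R R Num.norm [set x | 1 < x]); last exact: open_gt.
  by move=> y _; apply: norm_continuous.
by move=> y /= y1; rewrite moll_eq0// ltW.
Qed.

Lemma continuous_bounded_support (f : R -> R) : continuous f ->
  (forall x, 1 < `|x| -> f x = 0) -> exists2 B, 0 < B & forall x, `|f x| <= B.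
Proof.
move=> cf f0.
have [x _ xmax] := @EVT_max R (fun x => `|f x|) (-1) 1 ltac:(lra)
  (@continuous_subspaceT _ _ _ _ (fun x => continuous_comp (cf x) (@norm_continuous _ _ _))).
exists (`|f x| + 1); first by rewrite ltr_wpDl.
move=> y; have [/f0 ->|y1] := ltP 1 `|y|.
  by rewrite normr0 addr_ge0.
apply: le_trans (xmax y _) _; last by rewrite lerDl.
by rewrite in_itv/= -ler_norml.
Qed.

Lemma moll_bounded : exists2 B, 0 < B & forall x,
  `|moll x| <= B /\ `|derive1 moll x| <= B.
Proof.
have [B B0 hB] := continuous_bounded_support (smooth1_continuous smooth1_moll)
  (fun x h => moll_eq0 (ltW h)).
have [C C0 hC] := continuous_bounded_support
  (smooth1_continuous (smooth1_derive smooth1_moll)) dmoll_eq0.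
exists (B + C); first exact: addr_gt0.
move=> x; split.
  by apply: le_trans (hB x) _; rewrite lerDl ltW.
by apply: le_trans (hC x) _; rewrite lerDr ltW.
Qed.

Variables (c d : R).
Hypothesis d0 : 0 < d.
Implicit Types t x w : R.

(* [ker t x] is the density of t x + (1 - t) z when z is distributed in
   [c - d, c + d] with the density of a mollifier.  With z = (w - t x) / (1 - t),
   [flx] is (x - z) ker and solves the continuity equation
   d/dt ker = - d/dw flx; [dflx] is d/dw flx. *)
Definition karg (t x w : R) := (w - t * x) / ((1 - t) * d) - c / d.
Definition ker (t x w : R) := moll (karg t x w) / ((1 - t) * d).
Definition flx (t x w : R) := (x - c - d * karg t x w) * ker t x w.
Definition dflx (t x w : R) :=
  (- d * moll (karg t x w) + (x - c - d * karg t x w) * derive1 moll (karg t x w))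
    / ((1 - t) * d) ^+ 2.

Lemma karg_affine t x w :
  karg t x w = ((1 - t) * d)^-1 * w + (- (t * x) / ((1 - t) * d) - c / d).
Proof. rewrite /karg; ring. Qed.

Lemma smooth1_karg t x (f : R -> R) : smooth1 f -> smooth1 (fun w => f (karg t x w)).
Proof.
by move=> sf; under eq_fun do rewrite karg_affine; apply: smooth1_affine.
Qed.

Lemma ker_smooth t x : smooth1 (ker t x).
Proof.
rewrite /ker; under eq_fun do rewrite mulrC.
by apply: smooth1_scale; apply: smooth1_karg; exact: smooth1_moll.
Qed.

Lemma flx_smooth t x : smooth1 (flx t x).
Proof.
apply: smooth1_mul (@ker_smooth t x).
rewrite (_ : (fun w => _) = (fun w => cst (x - c) w + (- d) * karg t x w)); last first.
  by apply/funext => w; rewrite mulNr.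
apply: smooth1_add (@smooth1_cst _ _) _; apply: smooth1_scale.
exact: (@smooth1_karg t x id (@smooth1_id R)).
Qed.

Lemma is_derive_karg_w t x w :
  is_derive w (1 : R) (karg t x) ((1 - t) * d)^-1.
Proof.
rewrite (_ : karg t x = (fun w => id (((1 - t) * d)^-1 * w + (- (t * x) / ((1 - t) * d) - c / d)))).
  rewrite -[X in is_derive _ _ _ X]mulr1; apply: is_derive_affine; exact: is_derive_id.
by apply/funext => y; rewrite karg_affine.
Qed.

Lemma is_derive_lin (a b y : R) : is_derive y (1 : R) (fun y => a * y + b) a.
Proof.
have -> : (fun x : R => a * x + b) = (a *: id + cst b) by apply/funext.
by apply: is_derive_eq; rewrite addr0 /GRing.scale /= mulr1.
Qed.

Lemma inv1m_is_derive t : t < 1 ->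
  is_derive t (1 : R) (fun t => (1 - t)^-1) ((1 - t) ^- 2).
Proof.
move=> t1; have s0 : 1 - t != 0 by rewrite gt_eqF// subr_gt0.
have d1 : is_derive t (1 : R) (fun t : R => 1 - t) (-1).
  rewrite (_ : (fun t => _) = (fun t => -1 * t + 1)); first exact: is_derive_lin.
  by apply/funext => y; rewrite mulN1r addrC.
apply: (is_derive_eq (is_deriveV (f := fun t : R => 1 - t) s0 d1)).
by rewrite /GRing.scale/= mulrN1 opprK.
Qed.

(** For fixed x and w, [karg] depends on t through 1 / (1 - t) alone, and in an affine way; this
    makes its t-derivative elementary. *)
Lemma kargE t x w : t < 1 ->
  karg t x w = (w - x) / d * (1 - t)^-1 + (x / d - c / d).
Proof.
move=> t1; rewrite /karg; field.
by rewrite gt_eqF//= gt_eqF// subr_gt0.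
Qed.

Lemma is_derive_karg_t t x w : t < 1 ->
  is_derive t (1 : R) (fun t => karg t x w) ((c + d * karg t x w - x) / ((1 - t) * d)).
Proof.
move=> t1.
have s0 : 1 - t != 0 by rewrite gt_eqF// subr_gt0.
have dd : d != 0 by rewrite gt_eqF.
have : is_derive t (1 : R) (fun t => (w - x) / d * (1 - t)^-1 + (x / d - c / d))
   ((c + d * karg t x w - x) / ((1 - t) * d)).
  apply: (is_derive_eq (is_derive_comp1 (f := fun y => (w - x) / d * y + (x / d - c / d))
     (is_derive_lin _ _ _) (inv1m_is_derive t1))).
  by rewrite kargE//; field; rewrite s0 dd.
apply: near_eq_is_derive; near=> y; rewrite kargE//.
near: y; exact: lt_nbhsl.
Unshelve. all: by end_near. Qed.

Lemma continuous_karg_t t x w : t < 1 -> {for t, continuous (fun t => karg t x w)}.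
Proof.
move=> t1; apply/differentiable_continuous/derivable1_diffP.
exact: (@ex_derive _ _ _ _ _ _ _ (is_derive_karg_t x w t1)).
Qed.

Lemma inv_is_derive t : t < 1 ->
  is_derive t (1 : R) (fun t => ((1 - t) * d)^-1) ((1 - t) ^- 2 / d).
Proof.
move=> t1; rewrite (_ : (fun t => _) = (fun t => d^-1 * (1 - t)^-1 + 0)); last first.
  by apply/funext => y; rewrite invfM mulrC addr0.
apply: (is_derive_eq (is_derive_comp1 (f := fun y => d^-1 * y + 0)
     (is_derive_lin _ _ _) (inv1m_is_derive t1))).
by rewrite mulrC.
Qed.

Lemma continuous_inv_t t : t < 1 -> {for t, continuous (fun t => ((1 - t) * d)^-1)}.
Proof.
move=> t1; apply/differentiable_continuous/derivable1_diffP.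
exact: (@ex_derive _ _ _ _ _ _ _ (inv_is_derive t1)).
Qed.

Lemma ker_is_derive_t t x w : t < 1 ->
  is_derive t (1 : R) (fun t => ker t x w) (- dflx t x w).
Proof.
move=> t1.
have d1 : is_derive t (1 : R) (fun t => moll (karg t x w))
    (derive1 moll (karg t x w) * ((c + d * karg t x w - x) / ((1 - t) * d))).
  apply: (is_derive_comp1 (f := moll)); last exact: is_derive_karg_t.
  exact/smooth1_is_derive/smooth1_moll.
apply: (is_derive_eq (is_deriveM d1 (inv_is_derive t1))).
rewrite /GRing.scale/= /dflx; field.
by rewrite !gt_eqF ?subr_gt0.
Qed.

Lemma flx_derive1 t x w : t < 1 -> derive1 (flx t x) w = dflx t x w.
Proof.
move=> t1; rewrite derive1E; apply: derive_val.
have d1 : is_derive w (1 : R) (ker t x) (((1 - t) * d)^-1 * (derive1 moll (karg t x w) * ((1 - t) * d)^-1)).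
  rewrite (_ : ker t x = (fun w => ((1 - t) * d)^-1 * moll (karg t x w) + 0)); last first.
    by apply/funext => y; rewrite addr0 mulrC.
  apply: (@is_derive_comp1 (fun y => ((1 - t) * d)^-1 * y + 0) (fun w => moll (karg t x w))).
    exact: is_derive_lin.
  apply: (@is_derive_comp1 moll (karg t x)); last exact: is_derive_karg_w.
  exact/smooth1_is_derive/smooth1_moll.
have d2 : is_derive w (1 : R) (fun w => x - c - d * karg t x w) (- d * ((1 - t) * d)^-1).
  rewrite (_ : (fun w => _) = (fun w => - d * karg t x w + (x - c))); last first.
    by apply/funext => y; rewrite addrC mulNr.
  apply: (is_derive_comp1 (f := fun y => - d * y + (x - c))) (is_derive_karg_w t x w).
  exact: is_derive_lin.
apply: (is_derive_eq (is_deriveM d2 d1)).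
rewrite /GRing.scale/= /dflx /ker; field.
by rewrite !gt_eqF ?subr_gt0.
Qed.

Lemma continuous_moll_karg t x w (f : R -> R) : t < 1 -> continuous f ->
  {for t, continuous (fun t => f (karg t x w))}.
Proof.
move=> t1 cf; apply: (@continuous_comp _ _ _ (fun t => karg t x w) f).
  exact: continuous_karg_t.
exact: cf.
Qed.

Lemma ker_continuous_t t x w : t < 1 -> {for t, continuous (fun t => ker t x w)}.
Proof.
move=> t1; apply: cvgM; last exact: continuous_inv_t.
apply: continuous_moll_karg => //; exact/smooth1_continuous/smooth1_moll.
Qed.

Lemma dflx_continuous_t t x w : t < 1 -> {for t, continuous (fun t => dflx t x w)}.
Proof.
move=> t1; rewrite /dflx.
rewrite (_ : (fun t => _) = (fun t =>
  (- d * moll (karg t x w) + (x - c - d * karg t x w) * derive1 moll (karg t x w))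
    * (((1 - t) * d)^-1 * ((1 - t) * d)^-1))); last first.
  by apply/funext => y; rewrite -exprVn expr2.
apply: cvgM; last by apply: cvgM; exact: continuous_inv_t.
apply: cvgD.
  apply: cvgM; first exact: cvg_cst.
  apply: continuous_moll_karg => //; exact/smooth1_continuous/smooth1_moll.
apply: cvgM.
  apply: cvgB; first exact: cvg_cst.
  by apply: cvgM; [exact: cvg_cst|exact: continuous_karg_t].
apply: continuous_moll_karg => //; exact/smooth1_continuous/smooth1_derive/smooth1_moll.
Qed.

Lemma karg_dist t x w : t < 1 ->
  w - (t * x + (1 - t) * c) = (1 - t) * d * karg t x w.
Proof. by move=> t1; rewrite /karg; field; rewrite !gt_eqF ?subr_gt0. Qed.

(** The kernel thus lives, as a function of w, in the interval of radius (1 - t) d around t x + (1 -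
    t) c, the image of [c - d, c + d] under z -> t x + (1 - t) z. *)
Lemma karg_ge1 t x w : t < 1 ->
  ((1 - t) * d <= `|w - (t * x + (1 - t) * c)|) = (1 <= `|karg t x w|).
Proof.
move=> t1; rewrite karg_dist// normrM.
have sd : 0 < (1 - t) * d by rewrite mulr_gt0// subr_gt0.
by rewrite (gtr0_norm sd) ler_pMr.
Qed.

Lemma ker_eq0 t x w : t < 1 -> (1 - t) * d <= `|w - (t * x + (1 - t) * c)| ->
  ker t x w = 0.
Proof. by move=> t1; rewrite karg_ge1// => h; rewrite /ker moll_eq0// mul0r. Qed.

Lemma flx_eq0 t x w : t < 1 -> (1 - t) * d <= `|w - (t * x + (1 - t) * c)| ->
  flx t x w = 0.
Proof. by move=> t1 h; rewrite /flx ker_eq0// mulr0. Qed.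

Lemma ker_ge0 t x w : t < 1 -> 0 <= ker t x w.
Proof. by move=> t1; rewrite mulr_ge0 ?moll_ge0// invr_ge0 mulr_ge0 ?subr_ge0// ltW. Qed.

Lemma ker_le (B : R) t x w : (forall y, `|moll y| <= B) -> t < 1 ->
  ker t x w <= B / ((1 - t) * d).
Proof.
move=> hB t1; rewrite ler_wpM2r ?invr_ge0 ?mulr_ge0 ?subr_ge0 ?(ltW t1) ?(ltW d0)//.
exact: le_trans (ler_norm _) (hB _).
Qed.

(** The point z that the contraction sends to w is c + d [karg]. Where the kernel does not vanish, z
    is within d of c, so that |x - z| <= h + d. *)
Lemma flx_le (h : R) t x w : t < 1 -> `|x - c| <= h -> `|flx t x w| <= (h + d) * ker t x w.
Proof.
move=> t1 xh; rewrite /flx normrM [X in _ * X]ger0_norm ?ker_ge0//.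
have [a1|a1] := lerP 1 `|karg t x w|.
  by rewrite ker_eq0 ?mulr0 ?karg_ge1.
rewrite ler_wpM2r ?ker_ge0// (le_trans (ler_normB _ _))// lerD//.
by rewrite normrM (gtr0_norm d0) ler_piMr// ltW.
Qed.

(** The bound explodes as t tends to 1, but it only serves to make integrals finite for t <= T < 1;
    no constant of the final estimate comes from it. *)
Lemma dflx_le (B h : R) t x w : (forall y, `|moll y| <= B /\ `|derive1 moll y| <= B) ->
  t < 1 -> `|x - c| <= h -> `|dflx t x w| <= (d + (h + d)) * B / ((1 - t) * d) ^+ 2.
Proof.
move=> hB t1 xh.
have sd : 0 < ((1 - t) * d) ^+ 2 by rewrite exprn_gt0// mulr_gt0// subr_gt0.
rewrite /dflx normrM normfV (gtr0_norm sd) ler_wpM2r ?invr_ge0 ?(ltW sd)//.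
have B0 : 0 <= B by apply: le_trans (normr_ge0 _) (hB 0).1.
apply: le_trans (ler_normD _ _) _; rewrite [leRHS]mulrDl; apply: lerD.
  by rewrite normrM normrN (gtr0_norm d0) ler_wpM2l ?(ltW d0)// (hB _).1.
have h0 : 0 <= h by apply: le_trans (normr_ge0 _) xh.
have [a1|a1] := ltrP 1 `|karg t x w|.
  by rewrite dmoll_eq0// mulr0 normr0 mulr_ge0// addr_ge0// ltW.
rewrite normrM ler_pM// ?(hB _).2// (le_trans (ler_normB _ _))// lerD//.
by rewrite normrM (gtr0_norm d0) ler_piMr// ltW.
Qed.

(** [karg] is increasing and affine in w with slope 1 / ((1 - t) d), so that the change of variables
    leaves the integral of the mollifier. The points [w0] and [w1] are those where [karg] equals -1
    and 1. *)
Lemma ker_integral t x : t < 1 -> (\int[leb]_w (ker t x w)%:E = 1)%E.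
Proof.
move=> t1.
have sd : 0 < (1 - t) * d by rewrite mulr_gt0// subr_gt0.
have dd : d != 0 by rewrite gt_eqF.
have s0 : 1 - t != 0 by rewrite gt_eqF// subr_gt0.
pose w0 := (-1 + c / d) * ((1 - t) * d) + t * x.
pose w1 := (1 + c / d) * ((1 - t) * d) + t * x.
have K0 : karg t x w0 = -1 by rewrite /karg /w0; field; rewrite dd s0.
have K1 : karg t x w1 = 1 by rewrite /karg /w1; field; rewrite dd s0.
have w01 : w0 <= w1 by rewrite /w0 /w1 lerD2r ler_wpM2r ?(ltW sd)// lerD2r; lra.
have dk : derive1 (karg t x) = cst ((1 - t) * d)^-1.
  apply/funext => y; rewrite derive1E; apply: derive_val; exact: is_derive_karg_w.
have ck : continuous (karg t x).
  move=> y; apply/differentiable_continuous/derivable1_diffP.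
  exact: (@ex_derive _ _ _ _ _ _ _ (is_derive_karg_w t x y)).
transitivity (\int[leb]_(w in `[w0, w1]) (ker t x w)%:E)%E.
  rewrite [RHS]integral_mkcond; apply: eq_integral => w _.
  rewrite patchE; case: ifPn => //; rewrite notin_setE/= in_itv/= => wn.
  rewrite ker_eq0// karg_ge1// ler_normr.
  move: wn => /negP; rewrite negb_and -!ltNge => /orP[wn|wn]; apply/orP.
    right; rewrite lerNr -K0 !karg_affine lerD2r ler_wpM2l ?invr_ge0 ?(ltW sd)//.
    exact: ltW.
  left; rewrite -K1 !karg_affine lerD2r ler_wpM2l ?invr_ge0 ?(ltW sd)//.
  exact: ltW.
transitivity (\int[leb]_(w in `[w0, w1]) (((moll \o karg t x) * derive1 (karg t x)) w)%:E)%E.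
  by apply: eq_integral => w _; rewrite dk.
rewrite -integration_by_substitution_increasing//; first last.
- exact/continuous_subspaceT/smooth1_continuous/smooth1_moll.
- split.
  + move=> y _; exact: (@ex_derive _ _ _ _ _ _ _ (is_derive_karg_w t x y)).
  + by apply: cvg_at_right_filter; apply: ck.
  + by apply: cvg_at_left_filter; apply: ck.
- by rewrite dk; apply: is_cvg_cst.
- by rewrite dk; apply: is_cvg_cst.
- by rewrite dk => y _; apply: cvg_cst.
- by move=> a b _ _ ab; rewrite !karg_affine ltrD2r ltr_pM2l ?invr_gt0.
rewrite K0 K1.
rewrite -EFin_Rint//; last first.
  apply: continuous_compact_integrable; first exact: segment_compact.
  exact/continuous_subspaceT/smooth1_continuous/smooth1_moll.
rewrite RintegralZl//; last exact: bumpf_integrable.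
by rewrite mulVf// gt_eqF// bumpfZ_gt0.
Qed.

Lemma measurable_moll : measurable_fun setT moll.
Proof.
apply: continuous_measurable_fun; exact/smooth1_continuous/smooth1_moll.
Qed.

Lemma measurable_dmoll : measurable_fun setT (derive1 moll).
Proof.
apply: continuous_measurable_fun.
exact/smooth1_continuous/smooth1_derive/smooth1_moll.
Qed.

Section measurable_ker.
Context dd (T : measurableType dd) (D : set T) (ft fx fw : T -> R).
Hypotheses (mt : measurable_fun D ft) (mx : measurable_fun D fx)
  (mw : measurable_fun D fw).

Lemma measurable_karg : measurable_fun D (fun p => karg (ft p) (fx p) (fw p)).
Proof.
apply: measurable_funB => //; apply: measurable_funM.
  by apply: measurable_funB => //; apply: measurable_funM.
apply: measurable_funV; apply: measurable_funM => //.
exact: measurable_funB.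
Qed.

Lemma measurable_ker : measurable_fun D (fun p => ker (ft p) (fx p) (fw p)).
Proof.
apply: measurable_funM.
  by apply: (measurableT_comp measurable_moll); exact: measurable_karg.
apply: measurable_funV; apply: measurable_funM => //.
exact: measurable_funB.
Qed.

Lemma measurable_flx : measurable_fun D (fun p => flx (ft p) (fx p) (fw p)).
Proof.
apply: measurable_funM; last exact: measurable_ker.
apply: measurable_funB; first exact: measurable_funB.
by apply: measurable_funM => //; exact: measurable_karg.
Qed.

Lemma measurable_dflx : measurable_fun D (fun p => dflx (ft p) (fx p) (fw p)).
Proof.
apply: measurable_funM; last first.
  apply: measurable_funV; apply: measurable_funX; apply: measurable_funM => //.
  exact: measurable_funB.
apply: measurable_funD.
  apply: measurable_funM => //.
  by apply: (measurableT_comp measurable_moll); exact: measurable_karg.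
apply: measurable_funM.
  apply: measurable_funB; first exact: measurable_funB.
  by apply: measurable_funM => //; exact: measurable_karg.
by apply: (measurableT_comp measurable_dmoll); exact: measurable_karg.
Qed.
End measurable_ker.

End Kernel1.

(** * Schur's test *)

Section SigmaFiniteProduct.
Local Open Scope ereal_scope.
Context d1 d2 (T1 : measurableType d1) (T2 : measurableType d2) (R : realType).
Variables (m1 : {sigma_finite_measure set T1 -> \bar R})
  (m2 : {sigma_finite_measure set T2 -> \bar R}).

(* In the library the sigma-finite instance of m1 \x m2 is shadowed by the one
   for subprobabilities. *)
Definition prodm : set (T1 * T2) -> \bar R := (m1 \x m2).

HB.instance Definition _ := Measure.copy prodm (m1 \x m2).

Lemma prodm_sigma_finite : sigma_finite setT prodm.
Proof.
have /sigma_finiteP[F [FT ndF Ffin]] := sigma_finiteT m1.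
have /sigma_finiteP[G [GT ndG Gfin]] := sigma_finiteT m2.
exists (fun n => F n `*` G n).
  apply/seteqP; split => // -[x y] _.
  have [i _ Fi] : (\bigcup_n F n) x by rewrite -FT.
  have [j _ Gj] : (\bigcup_n G n) y by rewrite -GT.
  exists (i + j)%N => //; split => /=.
    by move: Fi; apply/subsetPset/ndF; rewrite leq_addr.
  by move: Gj; apply/subsetPset/ndG; rewrite leq_addl.
move=> n; have [mF Fn] := Ffin n; have [mG Gn] := Gfin n.
split; first exact: measurableX.
rewrite /prodm product_measure1E//.
by rewrite lte_mul_pinfty// ge0_fin_numE.
Qed.

HB.instance Definition _ := Measure_isSigmaFinite.Build _ _ _ prodm prodm_sigma_finite.

End SigmaFiniteProduct.

(** The measure [leb2] again, now carrying the sigma-finite structure that Tonelli's theorem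
    requires when the plane is a factor of a product. *)
Definition leb2s (R : realType) :
    {sigma_finite_measure set (measurableTypeR R * measurableTypeR R)%type -> \bar R} :=
  prodm (@lebesgue_measure R) (@lebesgue_measure R).
Arguments leb2s R : clear implicits.

Section Schur.
Local Open Scope ereal_scope.
Context d1 d2 (X : measurableType d1) (Y : measurableType d2) (R : realType).
Variables (mX : {sigma_finite_measure set X -> \bar R})
  (mY : {sigma_finite_measure set Y -> \bar R}).

(** Jensen's inequality for a density of mass at most 1. Let S be the average of |G| and A that of
    G^2. Young's inequality |G| <= l/2 + G^2 / (2 l), integrated against K, gives S <= l/2 + A / (2
    l) for every l > 0. The value l = 1 shows that S is finite when A is, and then l = S gives S^2
    <= A. *)
Lemma sqr_average_le (K G : Y -> R) : measurable_fun setT K -> measurable_fun setT G ->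
  (forall y, 0 <= K y)%R -> \int[mY]_y (K y)%:E <= 1 ->
  (\int[mY]_y (`|G y| * K y)%:E) ^+ 2 <= \int[mY]_y (G y ^+ 2 * K y)%:E.
Proof.
move=> mK mG K0 K1.
have m2 : measurable_fun setT (fun y => G y ^+ 2 * K y)%R.
  by apply: measurable_funM => //; apply: measurable_funX.
have m1 : measurable_fun setT (fun y => `|G y| * K y)%R.
  by apply: measurable_funM => //; apply: measurableT_comp.
have A0 : 0 <= \int[mY]_y (G y ^+ 2 * K y)%:E.
  by apply: integral_ge0 => y _; rewrite lee_fin mulr_ge0 ?sqr_ge0.
have S0 : 0 <= \int[mY]_y (`|G y| * K y)%:E.
  by apply: integral_ge0 => y _; rewrite lee_fin mulr_ge0.
have key (l : R) : (0 < l)%R -> \int[mY]_y (`|G y| * K y)%:E <=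
    (l / 2)%:E + (2 * l)^-1%:E * \int[mY]_y (G y ^+ 2 * K y)%:E.
  move=> l0; have l2 : (0 <= (2 * l)^-1)%R by rewrite invr_ge0 mulr_ge0 ?ltW.
  apply: (@le_trans _ _ (\int[mY]_y (l / 2 * K y + (2 * l)^-1 * (G y ^+ 2 * K y))%:E)).
    apply: ge0_le_integral_EFin => //.
    - by apply: measurable_funD; apply: measurable_funM.
    - by move=> y _; rewrite mulr_ge0.
    - move=> y _; rewrite mulrA -mulrDl ler_wpM2r//.
      rewrite -normr_id -[(G y ^+ 2)%R]real_normK ?num_real//.
      set g := `|G y|%R.
      have -> : (l / 2 + (2 * l)^-1 * g ^+ 2 = (l ^+ 2 + g ^+ 2) / (2 * l))%R.
        by field; rewrite gt_eqF.
      rewrite ler_pdivlMr ?mulr_gt0// ger0_norm ?normr_ge0//.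
      have := sqr_ge0 (l - g); rewrite sqrrB; nra.
  rewrite ge0_integralD_EFin//; last 4 first.
  - by apply: measurable_funM.
  - by apply: measurable_funM.
  - by move=> y _; rewrite mulr_ge0// divr_ge0// ltW.
  - by move=> y _; rewrite mulr_ge0// mulr_ge0 ?sqr_ge0.
  rewrite !ge0_integralZ_EFin//; last 2 first.
  - by move=> y _; rewrite mulr_ge0 ?sqr_ge0.
  - by rewrite divr_ge0// ltW.
  rewrite leeD2r// -[leRHS]mule1 lee_pmul2l//.
  by rewrite lte_fin divr_gt0.
move: A0 S0 key.
case: (\int[mY]_y (G y ^+ 2 * K y)%:E) => [a| |] //; last by move=> *; rewrite leey.
case: (\int[mY]_y (`|G y| * K y)%:E) => [s| |] // a0 s0 key; last first.
  by have := key 1%R ltr01; rewrite -EFinM -EFinD leye_eq.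
rewrite -EFin_expe lee_fin; move: s0; rewrite lee_fin le_eqVlt => /predU1P[<-|s0].
  by rewrite expr0n.
have := key s s0; rewrite -EFinM -EFinD lee_fin => h.
have : (s * (2 * s) <= (s / 2 + (2 * s)^-1 * a) * (2 * s))%R by rewrite ler_pM2r ?mulr_gt0.
have -> : ((s / 2 + (2 * s)^-1 * a) * (2 * s) = s ^+ 2 + a)%R by field; rewrite gt_eqF.
by rewrite expr2; nra.
Qed.

Variables (K : X -> Y -> R) (M : R).
Hypothesis mK : measurable_fun setT (fun p : X * Y => K p.1 p.2).
Hypothesis K0 : forall x y, (0 <= K x y)%R.
Hypothesis M0 : (0 <= M)%R.
Hypothesis KM : forall y, \int[mX]_x (K x y)%:E <= M%:E.

Let mK1 x : measurable_fun setT (K x).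
Proof. by apply: (measurableT_comp mK (pair1_measurable x)). Qed.

Let mK2 y : measurable_fun setT (K ^~ y).
Proof. by apply: (measurableT_comp mK (pair2_measurable y)). Qed.

Let mvK (v : Y -> R) : measurable_fun setT v ->
  measurable_fun setT (fun p : X * Y => (`|v p.2| * K p.1 p.2)%:E).
Proof.
move=> mv; apply/measurable_EFinP; apply: measurable_funM => //.
by apply: measurableT_comp => //; exact: (measurableT_comp mv measurable_snd).
Qed.

Let vK0 (v : Y -> R) (p : X * Y) : 0 <= (`|v p.2| * K p.1 p.2)%:E.
Proof. by rewrite lee_fin mulr_ge0. Qed.

Lemma schur1 (v : Y -> R) : measurable_fun setT v ->
  \int[mX]_x \int[mY]_y (`|v y| * K x y)%:E <= M%:E * \int[mY]_y `|v y|%:E.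
Proof.
move=> mv.
have mv' : measurable_fun setT (fun y => `|v y|%:E).
  by apply/measurable_EFinP; apply: measurableT_comp.
rewrite (@fubini_tonelli _ _ X Y R mX mY (fun p => (`|v p.2| * K p.1 p.2)%:E))//; last exact: mvK.
rewrite -ge0_integralZl//.
apply: ge0_le_integral => //.
- by move=> y _; apply: integral_ge0 => x _; rewrite lee_fin mulr_ge0.
- by apply: (@measurable_fun_fubini_tonelli_G _ _ X Y R mX (fun p => (`|v p.2| * K p.1 p.2)%:E)) => //; exact: mvK.
- by apply: emeasurable_funM.
- move=> y _ /=; rewrite ge0_integralZ_EFin//.
  by rewrite muleC lee_wpmul2r.
Qed.

(** Row masses at most 1 allow Jensen's inequality at each x; what remains is an average of G^2, to
    which [schur1] applies with the column masses. *)
Lemma schur2 (G : Y -> R) : measurable_fun setT G ->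
  (forall x, \int[mY]_y (K x y)%:E <= 1) ->
  \int[mX]_x (\int[mY]_y (`|G y| * K x y)%:E) ^+ 2 <= M%:E * \int[mY]_y (G y ^+ 2)%:E.
Proof.
move=> mG K1.
have mI : measurable_fun setT (fun x => \int[mY]_y (`|G y| * K x y)%:E).
  by apply: (@measurable_fun_fubini_tonelli_F _ _ X Y R mY (fun p => (`|G p.2| * K p.1 p.2)%:E)) => //; exact: mvK.
have mG2 : measurable_fun setT (fun y => G y ^+ 2)%R by apply: measurable_funX.
have := schur1 mG2.
under [X in _ <= _ * X -> _]eq_integral do rewrite ger0_norm ?sqr_ge0//.
apply: le_trans; apply: ge0_le_integral => //.
- by move=> x _; apply: expe_ge0; apply: integral_ge0 => y _; exact: (vK0 G (x, y)).
- exact: (emeasurable_funM mI mI).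
- apply: (@measurable_fun_fubini_tonelli_F _ _ X Y R mY (fun p => (`|G p.2 ^+ 2| * K p.1 p.2)%:E)).
    exact: (mvK mG2).
  exact: (vK0 (fun y => G y ^+ 2)%R).
- move=> x _; under [leRHS]eq_integral do rewrite ger0_norm ?sqr_ge0//.
  exact: sqr_average_le.
Qed.

End Schur.

(** * The contracting kernel on a plane cell *)

Section Kernel2.
Variable R : realType.
Local Notation pt := (R * R)%type.
Local Notation mpt := (measurableTypeR R * measurableTypeR R)%type.
Local Notation mu := (leb2 R).
Local Notation leb := (@lebesgue_measure R).

Variables (E : set mpt) (c : pt) (d h : R).
Hypothesis mE : measurable E.
Hypothesis d0 : 0 < d.
Hypothesis hE : forall x y : pt, E x -> E y -> `|x.1 - y.1| <= h /\ `|x.2 - y.2| <= h.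
Hypothesis starE : forall (t : R) (x z : pt), 0 <= t < 1 -> E x ->
  `|z.1 - c.1| <= d -> `|z.2 - c.2| <= d ->
  E (t * x.1 + (1 - t) * z.1, t * x.2 + (1 - t) * z.2).

Definition plane_kernel (t : R) (x w : pt) : R := ker c.1 d t x.1 w.1 * ker c.2 d t x.2 w.2.
(** Extension by zero lets both variables run over the whole plane, as in Schur's test. For x in E
    and 0 <= t < 1 the indicator in w changes nothing, since star-shapedness keeps the support
    inside E. *)
Definition cell_kernel (t : R) (x w : mpt) : R := \1_E x * (\1_E w * plane_kernel t x w).

Lemma plane_kernel_0 x y w : plane_kernel 0 x w = plane_kernel 0 y w.
Proof. by rewrite /plane_kernel /ker /karg !mul0r. Qed.

Lemma plane_kernel_ge0 t x w : 0 <= plane_kernel t x w.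
Proof.
rewrite /plane_kernel /ker mulrACA; apply: mulr_ge0; last by rewrite -expr2 sqr_ge0.
by apply: mulr_ge0; exact: moll_ge0.
Qed.

Lemma cell_kernel_ge0 t x w : 0 <= cell_kernel t x w.
Proof. by rewrite /cell_kernel !indicE; do 2!apply: mulr_ge0 => //; exact: plane_kernel_ge0. Qed.

Lemma cell_kernel_le t x w : cell_kernel t x w <= plane_kernel t x w.
Proof.
rewrite /cell_kernel !indicE; case: (_ \in _); case: (_ \in _);
  by rewrite ?mul1r ?mul0r ?mulr0 ?plane_kernel_ge0.
Qed.

(** Star-shapedness is applied to z = (w - t x) / (1 - t), the point that the contraction towards x
    sends to w. *)
Lemma star_box t (x w : pt) : 0 <= t < 1 -> E x ->
  `|w.1 - (t * x.1 + (1 - t) * c.1)| <= (1 - t) * d ->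
  `|w.2 - (t * x.2 + (1 - t) * c.2)| <= (1 - t) * d -> E w.
Proof.
move=> /andP[t0 t1] Ex w1 w2; have s0 : 0 < 1 - t by rewrite subr_gt0.
pose z : pt := ((w.1 - t * x.1) / (1 - t), (w.2 - t * x.2) / (1 - t)).
have zc (a b e : R) : `|a - (t * b + (1 - t) * e)| <= (1 - t) * d ->
   `|(a - t * b) / (1 - t) - e| <= d.
  move=> H; have -> : (a - t * b) / (1 - t) - e = (a - (t * b + (1 - t) * e)) / (1 - t).
    by field; rewrite gt_eqF.
  by rewrite normrM normfV (gtr0_norm s0) ler_pdivrMr// [leRHS]mulrC.
have := starE (t := t) (x := x) (z := z); rewrite t0 t1 => /(_ isT Ex (zc _ _ _ w1) (zc _ _ _ w2)).
rewrite /z /=; congr E.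
by rewrite [w]surjective_pairing; congr pair; field; rewrite gt_eqF.
Qed.

Lemma plane_kernel_supp t x w : 0 <= t < 1 -> E x -> plane_kernel t x w != 0 ->
  [/\ E w, `|w.1 - (t * x.1 + (1 - t) * c.1)| < (1 - t) * d &
      `|w.2 - (t * x.2 + (1 - t) * c.2)| < (1 - t) * d].
Proof.
move=> t01; move/andP: (t01) => [t0 t1] Ex; rewrite mulf_eq0 negb_or => /andP[k1 k2].
have w1 : `|w.1 - (t * x.1 + (1 - t) * c.1)| < (1 - t) * d.
  by rewrite ltNge; apply: contra k1 => h1; apply/eqP/ker_eq0.
have w2 : `|w.2 - (t * x.2 + (1 - t) * c.2)| < (1 - t) * d.
  by rewrite ltNge; apply: contra k2 => h2; apply/eqP/ker_eq0.
by split=> //; apply: (star_box t01 Ex); exact: ltW.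
Qed.

Lemma center_in : E !=set0 -> E c.
Proof.
move=> [x Ex]; have := starE (t := 0) (x := x) (z := c); rewrite lexx ltr01 => /(_ isT Ex).
rewrite !subrr normr0 => /(_ (ltW d0) (ltW d0)).
by rewrite !mul0r !add0r subr0 !mul1r -surjective_pairing.
Qed.

Lemma d_le_h : E !=set0 -> d <= h.
Proof.
move=> E0; have Ec := center_in E0; have := starE (t := 0) (x := c) (z := (c.1 + d, c.2)).
rewrite lexx ltr01 => /(_ isT Ec) /=; rewrite !subrr normr0 addrAC subrr add0r (gtr0_norm d0).
move=> /(_ (lexx _) (ltW d0)); rewrite !mul0r !add0r subr0 !mul1r => Ez.
by have [] := hE Ez Ec; rewrite /= addrAC subrr add0r (gtr0_norm d0).
Qed.

Lemma cell_kernel_supp t x w : 0 <= t < 1 -> cell_kernel t x w != 0 ->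
  [/\ E x, E w, `|w.1 - (t * x.1 + (1 - t) * c.1)| < (1 - t) * d &
      `|w.2 - (t * x.2 + (1 - t) * c.2)| < (1 - t) * d].
Proof.
move=> t01; rewrite /cell_kernel mulf_eq0 negb_or mulf_eq0 negb_or => /and3P[Ex Ew K].
have {}Ex : E x.
  by move: Ex; rewrite indicE; case: (boolP (x \in E)) => [/set_mem//|]; rewrite eqxx.
by have [] := plane_kernel_supp t01 Ex K.
Qed.

(** Here w - x = (1 - t) (z - x), where z is within d of c and c within h of x in each coordinate:
    the kernel concentrates at x as t tends to 1. *)
Lemma cell_kernel_near t x w : 0 <= t < 1 -> cell_kernel t x w != 0 ->
  `|w.1 - x.1| <= (1 - t) * (h + d) /\ `|w.2 - x.2| <= (1 - t) * (h + d).
Proof.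
move=> t01 /(cell_kernel_supp t01) [Ex _ h1 h2].
have [c1 c2] := hE (center_in (ex_intro _ x Ex)) Ex.
move/andP: t01 => [t0 t1].
have s0 : 0 < 1 - t by rewrite subr_gt0.
have H (a b e : R) : `|a - (t * b + (1 - t) * e)| < (1 - t) * d -> `|e - b| <= h ->
   `|a - b| <= (1 - t) * (h + d).
  move=> H1 H2; have -> : a - b = (a - (t * b + (1 - t) * e)) + (1 - t) * (e - b) by ring.
  apply: le_trans (ler_normD _ _) _; rewrite [leRHS]mulrDr [leRHS]addrC.
  apply: lerD; first exact: ltW.
  by rewrite normrM (gtr0_norm s0) ler_pM2l.
by split; [apply: H h1 c1|apply: H h2 c2].
Qed.

Section measurable_K.
Context dd (T : measurableType dd) (D : set T) (ft : T -> R) (fx fw : T -> mpt).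
Hypotheses (mt : measurable_fun D ft) (mx : measurable_fun D fx)
  (mw : measurable_fun D fw).

Lemma measurable_plane_kernel : measurable_fun D (fun p => plane_kernel (ft p) (fx p) (fw p)).
Proof.
apply: measurable_funM; apply: measurable_ker => //.
- by apply: (measurableT_comp measurable_fst).
- by apply: (measurableT_comp measurable_fst).
- by apply: (measurableT_comp measurable_snd).
- by apply: (measurableT_comp measurable_snd).
Qed.

Lemma measurable_cell_kernel : measurable_fun D (fun p => cell_kernel (ft p) (fx p) (fw p)).
Proof.
have mi : measurable_fun setT (\1_E : mpt -> R) by exact: measurable_indic.
apply: measurable_funM; first exact: (measurableT_comp mi).
by apply: measurable_funM; [exact: (measurableT_comp mi)|exact: measurable_plane_kernel].
Qed.
End measurable_K.

Lemma plane_kernel_integral t x : t < 1 -> (\int[mu]_w (plane_kernel t x w)%:E = 1)%E.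
Proof.
move=> t1.
have mk (a : R) e : measurable_fun setT (ker e d t a).
  by apply: measurable_ker.
rewrite /leb2 (@fubini_tonelli1 _ _ _ _ R leb leb (fun w => (plane_kernel t x w)%:E)); last 2 first.
- by apply/measurable_EFinP; apply: measurable_plane_kernel.
- by move=> w; rewrite lee_fin plane_kernel_ge0.
rewrite /fubini_F /plane_kernel /=.
under eq_integral => a _.
  rewrite ge0_integralZ_EFin//; last 3 first.
  - exact: mk.
  - by move=> b _; apply: ker_ge0.
  - exact: ker_ge0.
  rewrite ker_integral// mule1; over.
exact: ker_integral.
Qed.

Lemma cell_kernel_integral t x : 0 <= t < 1 -> E x -> (\int[mu]_w (cell_kernel t x w)%:E = 1)%E.
Proof.
move=> t01 Ex; move/andP: (t01) => [_ t1]; rewrite -(plane_kernel_integral x t1); apply: eq_integral => w _; congr EFin.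
rewrite /cell_kernel indicE mem_set// mul1r indicE.
have [->|] := eqVneq (plane_kernel t x w) 0; first by rewrite mulr0.
by move=> /(plane_kernel_supp t01 Ex) [Ew _ _]; rewrite mem_set// mul1r.
Qed.

Lemma cell_kernel_integral_le1 t x : 0 <= t < 1 -> (\int[mu]_w (cell_kernel t x w)%:E <= 1)%E.
Proof.
move=> t01; have [Ex|Ex] := pselect (E x); first by rewrite cell_kernel_integral.
rewrite integral0_eq ?lee01// => w _; rewrite /cell_kernel indicE memNset// mul0r//.
Qed.

(* An upper bound, uniform in t, for the integral over x of the kernel.  By
   homogeneity it depends on h / d only.  For t <= 1/2 the kernel is bounded and
   x ranges over E; for t >= 1/2, x is confined to a square of side 2 (1 - t) d / t. *)
Definition kernel_mass (B : R) := 64 * B ^+ 2 * (1 + (h / d) ^+ 2).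

Lemma box_integral_le (f : mpt -> R) (C r : R) (a : pt) : measurable_fun setT f ->
  0 < r -> 0 <= C -> (forall x, 0 <= f x <= C) -> (forall x, ~ box a r x -> f x = 0) ->
  (\int[mu]_x (f x)%:E <= (C * (2 * r) ^+ 2)%:E)%E.
Proof.
move=> mf r0 C0 f0 fb.
have mb := @measurable_box R a r.
apply: (@le_trans _ _ (\int[mu]_x (C * \1_(box a r) x)%:E)%E).
  apply: ge0_le_integral_EFin => //.
  - by apply: measurable_funM => //; exact: measurable_indic.
  - by move=> x _; case/andP: (f0 x).
  - move=> x _; rewrite indicE; case: (boolP (x \in _)) => [_|/negP xn].
      by rewrite mulr1; case/andP: (f0 x).
    by rewrite mulr0 fb// => xb; apply: xn; apply/mem_set.
rewrite ge0_integralZ_EFin//.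
rewrite integral_indic// setIT EFinM lee_wpmul2l ?lee_fin//.
by have := leb2_box a r0 => ->.
Qed.

Lemma cell_kernel_integral2 B t w : (forall y, `|moll y| <= B) -> 0 <= t < 1 ->
  (\int[mu]_x (cell_kernel t x w)%:E <= (kernel_mass B)%:E)%E.
Proof.
move=> hB t01; move/andP: (t01) => [t0 t1].
have s0 : 0 < 1 - t by rewrite subr_gt0.
have B0 : 0 <= B by apply: le_trans (normr_ge0 _) (hB 0).
have [[x0 Ex0]|nE] := pselect (E !=set0); last first.
  rewrite integral0_eq.
    by rewrite lee_fin !mulr_ge0 ?addr_ge0 ?sqr_ge0.
  move=> x _; rewrite /cell_kernel indicE memNset ?mul0r// => Ex; apply: nE; by exists x.
have Ec := center_in (ex_intro _ x0 Ex0); have dh := d_le_h (ex_intro _ x0 Ex0).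
have h0 : 0 < h by exact: lt_le_trans dh.
have K2B x : plane_kernel t x w <= (B / ((1 - t) * d)) ^+ 2.
  by rewrite expr2 ler_pM ?ker_ge0 ?ker_le.
have mKE : measurable_fun setT (fun x : mpt => cell_kernel t x w) by apply: measurable_cell_kernel.
have B1 x : 0 <= cell_kernel t x w <= (B / ((1 - t) * d)) ^+ 2.
  by rewrite cell_kernel_ge0 (le_trans (cell_kernel_le _ _ _)).
have [t2|t2] := leP t 2^-1.
  apply: le_trans (box_integral_le (r := 2 * h) (a := c) mKE _ (sqr_ge0 _) B1 _) _.
  - by rewrite mulr_gt0.
  - move=> x xb; apply/eqP; apply: contrapT => /negP /(cell_kernel_supp t01) [Ex _ _ _].
    apply: xb; have [] := hE Ex Ec; rewrite !ler_norml /box/= => /andP[? ?] /andP[? ?].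
    by split; apply/andP; split; lra.
  rewrite lee_fin /kernel_mass.
  (* As 1 - t >= 1/2, the factor 16 / (1 - t)^2 is at most 64, the constant in [kernel_mass]. *)
  have -> : (B / ((1 - t) * d)) ^+ 2 * (2 * (2 * h)) ^+ 2 = B ^+ 2 * (h / d) ^+ 2 * (16 / (1 - t) ^+ 2).
    by field; rewrite !gt_eqF.
  have -> : 64 * B ^+ 2 * (1 + (h / d) ^+ 2) = B ^+ 2 * (h / d) ^+ 2 * 64 + 64 * B ^+ 2 by ring.
  apply: ler_wpDr; first by rewrite mulr_ge0 ?sqr_ge0.
  apply: ler_wpM2l; first by apply: mulr_ge0; exact: sqr_ge0.
  rewrite ler_pdivrMr ?exprn_gt0//; nra.
have t0' : 0 < t by lra.
apply: le_trans (box_integral_le (r := (1 - t) * d / t) (a := ((w.1 - (1 - t) * c.1) / t, (w.2 - (1 - t) * c.2) / t)) mKE _ (sqr_ge0 _) B1 _) _.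
- by rewrite divr_gt0// mulr_gt0.
- move=> x xb; apply/eqP; apply: contrapT => /negP /(cell_kernel_supp t01) [_ _ h1 h2].
  apply: xb; have H (a b e : R) : `|a - (t * b + (1 - t) * e)| < (1 - t) * d ->
     (a - (1 - t) * e) / t - (1 - t) * d / t < b < (a - (1 - t) * e) / t + (1 - t) * d / t.
    rewrite ltr_norml -mulrBl -mulrDl ltr_pdivrMr// ltr_pdivlMr// => /andP[? ?].
    apply/andP; split; lra.
  by split; apply: H.
rewrite lee_fin /kernel_mass.
(* The height of the kernel and the area that x can occupy scale inversely, so that (1 - t) d
   cancels and the bound survives as t tends to 1; here 4 / t^2 <= 16. *)
have -> : (B / ((1 - t) * d)) ^+ 2 * (2 * ((1 - t) * d / t)) ^+ 2 = B ^+ 2 * (4 / t ^+ 2).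
  by field; rewrite !gt_eqF.
have -> : 64 * B ^+ 2 * (1 + (h / d) ^+ 2) = B ^+ 2 * 64 + 64 * B ^+ 2 * (h / d) ^+ 2 by ring.
apply: ler_wpDr; first by apply: mulr_ge0; [apply: mulr_ge0 => //|]; exact: sqr_ge0.
apply: ler_wpM2l; first exact: sqr_ge0.
rewrite ler_pdivrMr ?exprn_gt0//; nra.
Qed.

End Kernel2.

(** * Convergence of the averages *)

Section Modulus.
Variable R : realType.
Local Notation pt := (R * R)%type.
Local Notation mpt := (measurableTypeR R * measurableTypeR R)%type.
Local Notation mu := (leb2 R).
Local Notation leb := (@lebesgue_measure R).

(** Quadrants are stable under intersection and generate the measurable sets, while their boundaries
    lie on two lines, so that the effect of the kernel on their indicators can be computed. *)
Definition quadrant (a b : R) : set mpt := [set x | x.1 < a /\ x.2 < b].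

Definition quadrants : set (set mpt) := [set A | exists a b, A = quadrant a b].

Lemma quadrantE a b : quadrant a b = `]-oo, a[%classic `*` `]-oo, b[%classic.
Proof. by apply/seteqP; split => z; rewrite /quadrant /= !in_itv/=. Qed.

Lemma measurable_quadrant a b : measurable (quadrant a b).
Proof. by rewrite quadrantE; apply: measurableX; exact: measurable_itv. Qed.

Lemma quadrants_setI : setI_closed quadrants.
Proof.
move=> _ _ [a [b ->]] [a' [b' ->]]; exists (Num.min a a'), (Num.min b b').
apply/seteqP; split => x; rewrite /quadrant/= !lt_min; first by move=> [[-> ->] [-> ->]].
by move=> [/andP[-> ->] /andP[-> ->]].
Qed.

(** A half-plane x.1 < a or x.2 < a is a countable union of quadrants, so that both projections are
    measurable for the sigma-algebra generated by the quadrants; hence it contains all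
    rectangles. *)
Lemma measurable_quadrants (A : set mpt) : measurable A -> <<s quadrants >> A.
Proof.
have bigq (a : R) (f : R -> nat -> set mpt) :
    (forall n, quadrants (f a n)) -> <<s quadrants >> (\bigcup_n f a n).
  move=> qf; have [_ _ H] := smallest_sigma_algebra setT quadrants.
  by apply: H => n; apply: sub_sigma_algebra.
have sub (A1 : set (measurableTypeR R)) : measurable A1 ->
    <<s quadrants >> (fst @^-1` A1 : set mpt) /\ <<s quadrants >> (snd @^-1` A1 : set mpt).
  move=> mA1.
  pose T := g_sigma_algebraType quadrants.
  have m1 : measurable_fun setT (fst : T -> measurableTypeR R).
    apply: (measurability _ (RGenInftyO.measurableE R)) => _ [_ [a ->]] <-.
    rewrite setTI (_ : fst @^-1` _ = \bigcup_n quadrant a n%:R).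
      by apply: (bigq a (fun a n => quadrant a n%:R)) => n; exists a, n%:R.
    apply/seteqP; split => [x|x [n _ []] /= xa xb]; rewrite /= in_itv//= => xa.
    exists (Num.truncn x.2).+1 => //; split=> //.
    exact: truncnS_gt.
  have m2 : measurable_fun setT (snd : T -> measurableTypeR R).
    apply: (measurability _ (RGenInftyO.measurableE R)) => _ [_ [a ->]] <-.
    rewrite setTI (_ : snd @^-1` _ = \bigcup_n quadrant n%:R a).
      by apply: (bigq a (fun a n => quadrant n%:R a)) => n; exists n%:R, a.
    apply/seteqP; split => [x|x [n _ []] /= xa xb]; rewrite /= in_itv//= => xa.
    exists (Num.truncn x.1).+1 => //; split=> //.
    exact: truncnS_gt.
  split.
    by have := m1 measurableT A1 mA1; rewrite setTI.
  by have := m2 measurableT A1 mA1; rewrite setTI.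
rewrite measurable_prod_measurableType => mA.
apply: (@smallest_sub _ _ _ _ _ _ A mA); first exact: smallest_sigma_algebra.
move=> _ [B mB] [C mC] <-.
have -> : B `*` C = fst @^-1` B `&` snd @^-1` C by [].
have sI : forall U V : set mpt, <<s quadrants >> U -> <<s quadrants >> V -> <<s quadrants >> (U `&` V).
  move=> U V sU sV; exact: (@measurableI _ (g_sigma_algebraType quadrants)).
by apply: sI; [have [] := sub _ mB|have [] := sub _ mC].
Qed.

Variables (E : set mpt) (c : pt) (d h B : R).
Hypothesis mE : measurable E.
Hypothesis d0 : 0 < d.
Hypothesis hE : forall x y : pt, E x -> E y -> `|x.1 - y.1| <= h /\ `|x.2 - y.2| <= h.
Hypothesis starE : forall (t : R) (x z : pt), 0 <= t < 1 -> E x ->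
  `|z.1 - c.1| <= d -> `|z.2 - c.2| <= d ->
  E (t * x.1 + (1 - t) * z.1, t * x.2 + (1 - t) * z.2).
Hypothesis E0 : E !=set0.
Hypothesis hB : forall y : R, `|moll y| <= B.

Local Notation KE := (cell_kernel E c d).
Local Notation M := (kernel_mass d h B).

Let h0 : 0 < h.
Proof. exact: lt_le_trans (d_le_h d0 hE starE E0). Qed.

Let M0 : 0 <= M.
Proof.
rewrite /kernel_mass; apply: mulr_ge0; first by rewrite mulr_ge0 ?sqr_ge0.
by rewrite addr_ge0 ?sqr_ge0.
Qed.

(** An L^1 modulus of continuity of v at the scale 1 - t, weighted by the kernel. It dominates the
    L^1(E) distance from v to its averages v_t. *)
Definition modu (t : R) (v : mpt -> R) : \bar R :=
  (\int[mu]_x \int[mu]_w (`|v w - v x| * KE t x w)%:E)%E.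

Let mKE t : measurable_fun setT (fun p : mpt * mpt => KE t p.1 p.2).
Proof. by apply: measurable_cell_kernel. Qed.

Let mf (v : mpt -> R) t : measurable_fun setT v ->
  measurable_fun setT (fun p : mpt * mpt => `|v p.2 - v p.1| * KE t p.1 p.2).
Proof.
move=> mv; apply: measurable_funM; last exact: mKE.
apply: measurableT_comp => //; apply: measurable_funB.
  exact: (measurableT_comp mv measurable_snd).
exact: (measurableT_comp mv measurable_fst).
Qed.

Let mf1 (f : mpt * mpt -> R) x : measurable_fun setT f ->
  measurable_fun setT (fun w => f (x, w)).
Proof. by move=> mf'; apply: (measurableT_comp mf' (pair1_measurable x)). Qed.

Let mfI (f : mpt * mpt -> R) : measurable_fun setT f -> (forall p, 0 <= f p) ->
  measurable_fun setT (fun x => \int[mu]_w (f (x, w))%:E)%E.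
Proof.
move=> mf' f0.
apply: (@measurable_fun_fubini_tonelli_F _ _ mpt mpt R (leb2s R) (fun p => (f p)%:E)).
  exact/measurable_EFinP.
by move=> p; rewrite lee_fin.
Qed.

Lemma modu_add t (v w : mpt -> R) : measurable_fun setT v -> measurable_fun setT w ->
  (modu t (fun x => v x + w x)%R <= modu t v + modu t w)%E.
Proof.
move=> mv mw; rewrite /modu -ge0_integralD//; last 4 first.
- by move=> x _; apply: integral_ge0 => y _; rewrite lee_fin mulr_ge0// cell_kernel_ge0.
- by apply: (mfI (mf t mv)) => p; rewrite mulr_ge0// cell_kernel_ge0.
- by move=> x _; apply: integral_ge0 => y _; rewrite lee_fin mulr_ge0// cell_kernel_ge0.
- by apply: (mfI (mf t mw)) => p; rewrite mulr_ge0// cell_kernel_ge0.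
have mvw := measurable_funD mv mw.
apply: ge0_le_integral => //.
- by move=> x _; apply: integral_ge0 => y _; rewrite lee_fin mulr_ge0// cell_kernel_ge0.
- by apply: (mfI (mf t mvw)) => p; rewrite mulr_ge0// cell_kernel_ge0.
- apply: emeasurable_funD.
    by apply: (mfI (mf t mv)) => p; rewrite mulr_ge0// cell_kernel_ge0.
  by apply: (mfI (mf t mw)) => p; rewrite mulr_ge0// cell_kernel_ge0.
move=> x _; rewrite -ge0_integralD_EFin//; last 4 first.
- exact: (mf1 x (mf t mv)).
- exact: (mf1 x (mf t mw)).
- by move=> y _; rewrite mulr_ge0// cell_kernel_ge0.
- by move=> y _; rewrite mulr_ge0// cell_kernel_ge0.
apply: ge0_le_integral_EFin => //.
- exact: (mf1 x (mf t mvw)).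
- by apply: measurable_funD; [exact: (mf1 x (mf t mv))|exact: (mf1 x (mf t mw))].
- by move=> y _; rewrite mulr_ge0// cell_kernel_ge0.
- move=> y _; rewrite -mulrDl ler_wpM2r ?cell_kernel_ge0//.
  by rewrite (_ : _ - _ = (v y - v x) + (w y - w x)) ?ler_normD//; ring.
Qed.

Lemma modu_scale t (v : mpt -> R) (a : R) : measurable_fun setT v ->
  (modu t (fun x => a * v x)%R = `|a|%:E * modu t v)%E.
Proof.
move=> mv; rewrite /modu -ge0_integralZl//; last 2 first.
- by apply: (mfI (mf t mv)) => p; rewrite mulr_ge0// cell_kernel_ge0.
- by move=> x _; apply: integral_ge0 => y _; rewrite lee_fin mulr_ge0// cell_kernel_ge0.
apply: eq_integral => x _; rewrite -ge0_integralZ_EFin//; last 2 first.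
- exact: (mf1 x (mf t mv)).
- by move=> y _; rewrite mulr_ge0// cell_kernel_ge0.
by apply: eq_integral => y _; rewrite [in RHS]mulrA -normrM mulrBr.
Qed.

(** In |v w - v x| <= |v w| + |v x| the first term costs the column mass M, by [schur1], and the
    second one the row mass 1. Being uniform in t, the bound makes [approximable] stable under
    limits in L^1(E). *)
Lemma modu_le t (v : mpt -> R) : 0 <= t < 1 -> measurable_fun setT v ->
  (modu t v <= (M + 1)%:E * \int[mu]_(x in E) `|v x|%:E)%E.
Proof.
move=> t01 mv.
have mi : measurable_fun setT (\1_E : mpt -> R) by exact: measurable_indic.
have mv1 : measurable_fun setT (fun x => v x * \1_E x) by exact: measurable_funM.
have mn : measurable_fun setT (fun x => `|v x * \1_E x|) by apply: measurableT_comp.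
have K0 x w : 0 <= KE t x w by exact: cell_kernel_ge0.
have -> : (\int[mu]_(x in E) `|v x|%:E = \int[mu]_x `|v x * \1_E x|%:E)%E.
  rewrite [LHS]integral_mkcond; apply: eq_integral => x _.
  by rewrite patchE indicE; case: ifP; rewrite ?mulr1 ?mulr0 ?normr0.
have S1 := @schur1 _ _ mpt mpt R (leb2s R) (leb2s R) (KE t) M (mKE t) K0 M0
  (fun y => cell_kernel_integral2 mE d0 hE starE y hB t01) _ mv1.
rewrite EFinD ge0_muleDl ?lee_fin// mul1e.
apply: (@le_trans _ _ (\int[mu]_x (\int[mu]_w (`|v w * \1_E w| * KE t x w)%:E + `|v x * \1_E x|%:E))%E).
  apply: ge0_le_integral => //.
  - by move=> x _; apply: integral_ge0 => y _; rewrite lee_fin mulr_ge0.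
  - by apply: (mfI (mf t mv)) => p; rewrite mulr_ge0.
  - apply: emeasurable_funD; last exact/measurable_EFinP.
    apply: (mfI (f := fun p => `|v p.2 * \1_E p.2| * KE t p.1 p.2)).
      by apply: measurable_funM; [exact: (measurableT_comp mn measurable_snd)|exact: mKE].
    by move=> p; rewrite mulr_ge0.
  - move=> x _.
    apply: (@le_trans _ _ (\int[mu]_w (`|v w * \1_E w| * KE t x w + `|v x * \1_E x| * KE t x w)%:E)%E).
      apply: ge0_le_integral_EFin => //.
      + exact: (mf1 x (mf t mv)).
      + by apply: measurable_funD; apply: measurable_funM => //; apply: (mf1 x (mKE t)).
      + by move=> y _; rewrite mulr_ge0.
      + move=> y _; have [->|] := eqVneq (KE t x y) 0; first by rewrite !mulr0 addr0.
        move=> /(cell_kernel_supp d0 starE t01) [Ex Ey _ _].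
        by rewrite !indicE !mem_set// !mulr1 -mulrDl ler_wpM2r// ler_normB.
    rewrite ge0_integralD_EFin//; last 4 first.
    + by apply: measurable_funM => //; apply: (mf1 x (mKE t)).
    + by apply: measurable_funM => //; apply: (mf1 x (mKE t)).
    + by move=> y _; rewrite mulr_ge0.
    + by move=> y _; rewrite mulr_ge0.
    rewrite leeD2l// ge0_integralZ_EFin//; last exact: (mf1 x (mKE t)).
    rewrite -[leRHS]mule1 lee_wpmul2l ?lee_fin//.
    exact: cell_kernel_integral_le1.
rewrite ge0_integralD//; last 3 first.
- by move=> x _; apply: integral_ge0 => y _; rewrite lee_fin mulr_ge0.
- apply: (mfI (f := fun p => `|v p.2 * \1_E p.2| * KE t p.1 p.2)).
    by apply: measurable_funM; [exact: (measurableT_comp mn measurable_snd)|exact: mKE].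
  by move=> p; rewrite mulr_ge0.
- exact/measurable_EFinP.
by rewrite leeD2r.
Qed.

Definition approximable (v : mpt -> R) : Prop := forall e : R, 0 < e ->
  exists2 del : R, 0 < del & forall t, 0 <= t < 1 -> 1 - del < t ->
    (modu t v <= e%:E)%E.

Lemma approx_add (v w : mpt -> R) : measurable_fun setT v -> measurable_fun setT w ->
  approximable v -> approximable w -> approximable (fun x => v x + w x).
Proof.
move=> mv mw av aw e e0.
have [d1 d10 h1] := av (e / 2) (divr_gt0 e0 (ltr0n _ 2)).
have [d2 d20 h2] := aw (e / 2) (divr_gt0 e0 (ltr0n _ 2)).
exists (Num.min d1 d2); first by rewrite lt_min d10.
move=> t t01 td; apply: (le_trans (modu_add t mv mw)).
rewrite [in leRHS](splitr e) EFinD; apply: leeD.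
  by apply: h1 => //; apply: le_lt_trans td; rewrite lerD2l lerN2 ge_min lexx.
by apply: h2 => //; apply: le_lt_trans td; rewrite lerD2l lerN2 ge_min lexx orbT.
Qed.

Lemma approx_scale (v : mpt -> R) (a : R) : measurable_fun setT v ->
  approximable v -> approximable (fun x => a * v x).
Proof.
move=> mv av e e0.
have a1 : 0 < `|a| + 1 by rewrite ltr_wpDl.
have [d1 d10 h1] := av (e / (`|a| + 1)) (divr_gt0 e0 a1).
exists d1 => // t t01 td; rewrite modu_scale//.
apply: (@le_trans _ _ (`|a|%:E * (e / (`|a| + 1))%:E)%E).
  by rewrite lee_wpmul2l ?lee_fin//; apply: h1.
rewrite -EFinM lee_fin mulrA ler_pdivrMr// mulrC ler_pM2l// lerDl//.
Qed.

Lemma approx_sum n (f : 'I_n -> mpt -> R) :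
  (forall i, measurable_fun setT (f i)) -> (forall i, approximable (f i)) ->
  approximable (fun x => \sum_(i < n) f i x).
Proof.
elim: n f => [|n IH] f mf' af.
  move=> e e0; exists 1 => // t _ _; rewrite /modu integral0_eq ?lee_fin ?ltW// => x _.
  by apply: integral0_eq => w _; rewrite !big_ord0 subrr normr0 mul0r.
under eq_fun do rewrite big_ord_recr/=.
apply: approx_add => //; last by apply: IH.
exact: measurable_sum.
Qed.

Lemma approx_close (v : mpt -> R) : measurable_fun setT v ->
  (forall e : R, 0 < e -> exists2 s : mpt -> R, measurable_fun setT s /\ approximable s &
     (\int[mu]_(x in E) `|v x - s x|%:E <= e%:E)%E) -> approximable v.
Proof.
move=> mv H e e0.
have M1 : 0 < M + 1 by rewrite ltr_wpDl.
have [s [ms as_] vs] := H (e / 2 / (M + 1)) (divr_gt0 (divr_gt0 e0 (ltr0n _ 2)) M1).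
have [d1 d10 h1] := as_ (e / 2) (divr_gt0 e0 (ltr0n _ 2)).
exists d1 => // t t01 td.
have -> : v = (fun x => s x + (v x - s x)) by apply/funext => x; ring.
have mvs := measurable_funB mv ms.
apply: (le_trans (modu_add t ms mvs)).
rewrite [in leRHS](splitr e) EFinD; apply: leeD; first exact: h1.
apply: (le_trans (modu_le t01 mvs)).
apply: (@le_trans _ _ ((M + 1)%:E * (e / 2 / (M + 1))%:E)%E).
  by apply: lee_wpmul2l => //; rewrite lee_fin ltW.
by rewrite -EFinM lee_fin mulrC divfK// gt_eqF.
Qed.

Lemma approx_indicC (A : set mpt) : approximable \1_A -> approximable \1_(~` A).
Proof.
move=> aA e e0; have [d1 d10 h1] := aA e e0; exists d1; first by [].
move=> t t01 td; suff -> : modu t \1_(~` A) = modu t \1_A by exact: h1.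
apply: eq_integral => x _; apply: eq_integral => w _.
rewrite !indicE !in_setC; case: (w \in A); case: (x \in A) => //=;
  by rewrite ?subrr ?subr0 ?sub0r ?normrN.
Qed.

Lemma E_sub_box : E `<=` box c (2 * h).
Proof.
move=> x Ex; have [] := hE Ex (center_in d0 starE E0).
rewrite !ler_norml /box/= => /andP[? ?] /andP[? ?].
by move: h0 => ?; split; apply/andP; split; lra.
Qed.

Lemma muE_lty : (mu E < +oo)%E.
Proof.
apply: (@le_lt_trans _ _ (mu (box c (2 * h)))).
  apply: le_measure; rewrite ?inE//; last exact: E_sub_box.
  exact: measurable_box.
by rewrite leb2_box ?ltry// mulr_gt0.
Qed.

(** On E, the L^1 distance between the indicators of A and of F n is the measure of the part of E in
    A but not in F n. It decreases to 0 because E has finite measure. *)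
Lemma approx_indic_incr (A : set mpt) (F : nat -> set mpt) :
  measurable A -> (forall n, measurable (F n)) -> A = \bigcup_n F n ->
  {homo F : n m / (n <= m)%N >-> (n <= m)%O} ->
  (forall n, approximable \1_(F n)) -> approximable \1_A.
Proof.
move=> mA mF AF ndF aF; apply: approx_close; first exact: measurable_indic.
move=> e e0; pose G n := E `&` (A `\` F n).
have mG n : measurable (G n) by apply: measurableI => //; apply: measurableD.
have G0 : \bigcap_n G n = set0.
  apply/seteqP; split => // x Gx; have [_ [Ax _]] := Gx 0 I.
  by move: Ax; rewrite AF => -[n _ Fx]; have [_ [_]] := Gx n I.
have : (mu \o G) @ \oo --> mu (\bigcap_n G n).
  apply: nonincreasing_cvg_mu => //.
  - apply: le_lt_trans muE_lty; apply: le_measure; rewrite ?inE//.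
    exact: subIsetl.
  - by rewrite G0.
  - apply/nonincreasing_seqP => n; apply/subsetPset; apply: setIS; apply: setDS.
    by apply/subsetPset; apply: ndF.
rewrite G0 measure0 => /fine_cvgP[_ /cvgrPdist_le /(_ _ e0)] [N _ HN].
exists (\1_(F N)); first by split => //; exact: measurable_indic.
have := HN N (leqnn _); rewrite sub0r normrN /= => HG.
have Gfin : mu (G N) \is a fin_num.
  rewrite ge0_fin_numE//; apply: le_lt_trans muE_lty; apply: le_measure; rewrite ?inE//.
  exact: subIsetl.
apply: (@le_trans _ _ (mu (G N))); last first.
  rewrite -(fineK Gfin) lee_fin; apply: le_trans HG; exact: ler_norm.
have -> : mu (G N) = (\int[mu]_x (\1_(G N) x)%:E)%E by rewrite integral_indic// setIT.
rewrite [leLHS]integral_mkcond.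
apply: ge0_le_integral => //.
- by move=> x _; rewrite patchE; case: ifP.
- apply/(measurable_restrictT _ mE); apply/measurable_EFinP; apply: measurableT_comp => //.
  apply: measurable_funTS; apply: measurable_funB; exact: measurable_indic.
- by apply/measurable_EFinP; exact: measurable_indic.
move=> x _; rewrite patchE; case: ifPn => [/set_mem Ex|_]; last by rewrite lee_fin.
rewrite lee_fin !indicE.
have [Ax|nAx] := pselect (A x).
  have [Fx|nFx] := pselect (F N x).
    by rewrite (mem_set Ax) (mem_set Fx) subrr normr0.
  by rewrite (mem_set Ax) (memNset nFx) subr0 normr1 (@mem_set _ (G N)).
have nFx : ~ F N x by move=> Fx; apply: nAx; rewrite AF; exists N.
by rewrite (memNset nAx) (memNset nFx) subrr normr0.
Qed.

(** The kernel joins x only to points within r = (1 - t) (h + d) of it in each coordinate. The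
    indicator can therefore change only if x is in one of two strips of half-width 2 r around the
    lines that bound the quadrant. Cut to the square of side 4 h around E, the strips have total
    area 2 (4 r) (4 h) = (1 - t) C. *)
Lemma approx_quadrant a b : approximable \1_(quadrant a b).
Proof.
move=> e e0; pose C := 2 * (4 * (h + d) * (4 * h)).
have hd : 0 < h + d by rewrite addr_gt0.
have C0 : 0 < C by rewrite !mulr_gt0.
exists (e / C); first exact: divr_gt0.
move=> t t01 td; move/andP: (t01) => [t0 t1].
have s0 : 0 < 1 - t by rewrite subr_gt0.
pose r := (1 - t) * (h + d); have r0 : 0 < r by rewrite mulr_gt0.
pose S1 : set mpt := `]a - 2 * r, a + 2 * r[%classic `*` `]c.2 - 2 * h, c.2 + 2 * h[%classic.
pose S2 : set mpt := `]c.1 - 2 * h, c.1 + 2 * h[%classic `*` `]b - 2 * r, b + 2 * r[%classic.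
have mS1 : measurable S1 by apply: measurableX; exact: measurable_itv.
have mS2 : measurable S2 by apply: measurableX; exact: measurable_itv.
have mq : measurable_fun setT (\1_(quadrant a b) : mpt -> R).
  by apply: measurable_indic; exact: measurable_quadrant.
apply: (@le_trans _ _ (\int[mu]_x (\1_S1 x + \1_S2 x)%:E)%E).
  apply: ge0_le_integral => //.
  - by move=> x _; apply: integral_ge0 => y _; rewrite lee_fin mulr_ge0// cell_kernel_ge0.
  - by apply: (mfI (mf t mq)) => p; rewrite mulr_ge0// cell_kernel_ge0.
  - by apply/measurable_EFinP; apply: measurable_funD; apply: measurable_indic.
  - move=> x _.
    have [|nS] := pselect (S1 x \/ S2 x).
      move=> S12; apply: (@le_trans _ _ (\int[mu]_w (KE t x w)%:E)%E).
        apply: ge0_le_integral_EFin => //.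
        + exact: (mf1 x (mf t mq)).
        + exact: (mf1 x (mKE t)).
        + by move=> y _; rewrite mulr_ge0// cell_kernel_ge0.
        + move=> y _; rewrite ler_piMl ?cell_kernel_ge0// !indicE.
          by case: (_ \in _); case: (_ \in _); rewrite /= ?subrr ?sub0r ?subr0 ?normrN ?normr1 ?normr0.
      apply: (le_trans (cell_kernel_integral_le1 (c := c) d0 starE x t01)).
      rewrite lee_fin !indicE; case: S12 => Sx; rewrite (mem_set Sx).
        by rewrite lerDl.
      by rewrite lerDr.
    rewrite integral0_eq; first by rewrite lee_fin addr_ge0// indicE.
    move=> w _; have [->|K0] := eqVneq (KE t x w) 0; first by rewrite mulr0.
    have [Ex _ _ _] := cell_kernel_supp d0 starE t01 K0.
    have [n1 n2] := cell_kernel_near d0 hE starE t01 K0.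
    rewrite (_ : \1_(quadrant a b) w = \1_(quadrant a b) x); first by rewrite subrr normr0 mul0r.
    have [] := E_sub_box Ex; move=> /andP[b1 b2] /andP[b3 b4].
    move: n1 n2; rewrite -/r !ler_norml => /andP[? ?] /andP[? ?].
    have xa : x.1 <= a - 2 * r \/ a + 2 * r <= x.1.
      have [|x1] := leP x.1 (a - 2 * r); first by left.
      have [|x2] := leP (a + 2 * r) x.1; first by right.
      by exfalso; apply: nS; left; split => /=; rewrite in_itv/=; apply/andP; split.
    have xb : x.2 <= b - 2 * r \/ b + 2 * r <= x.2.
      have [|x1] := leP x.2 (b - 2 * r); first by left.
      have [|x2] := leP (b + 2 * r) x.2; first by right.
      by exfalso; apply: nS; right; split => /=; rewrite in_itv/=; apply/andP; split.
    rewrite !indicE; congr (_%:R); congr nat_of_bool.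
    apply/idP/idP => /set_mem [? ?]; apply/mem_set; rewrite /quadrant/=.
      by split; [case: xa|case: xb] => ?; lra.
    by split; [case: xa|case: xb] => ?; lra.
rewrite ge0_integralD_EFin; [|by []|exact: measurable_indic|exact: measurable_indic|by []|by []].
rewrite !integral_indic// !setIT.
rewrite [X in (X + _)%E](leb2X (measurable_itv _) (measurable_itv _)).
rewrite [X in (_ + X)%E](leb2X (measurable_itv _) (measurable_itv _)).
move: h0 => h0'.
rewrite !lebesgue_measure_itv/= !lte_fin !ifT; [|lra..].
rewrite -!EFinB -!EFinM -EFinD lee_fin.
have : (1 - t) * C <= e by rewrite -ler_pdivlMr//; lra.
apply: le_trans; rewrite /C /r; lra.
Qed.

(** Dynkin's argument, starting from the quadrants. A countable disjoint union is the increasing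
    limit of finite unions, and disjointness makes the indicators of the latter sums of
    indicators. *)
Lemma approx_indic (A : set mpt) : measurable A -> approximable \1_A.
Proof.
move=> mA.
pose H : set (set mpt) := [set A | measurable A /\ approximable \1_A].
suff : <<s quadrants >> `<=` H by move=> /(_ _ (measurable_quadrants mA)) [].
apply: lambda_system_subset => //; first exact: quadrants_setI.
- apply/dynkin_lambda_system; split.
  + split => //; move=> e e0; exists 1 => // t _ _; rewrite /modu integral0_eq ?lee_fin ?ltW// => x _.
    by apply: integral0_eq => w _; rewrite !indicT subrr normr0 mul0r.
  + by move=> X [mX aX]; split; [exact: measurableC|exact: approx_indicC].
  + move=> F tF HF; have mF n := (HF n).1.
    split; first exact: bigcupT_measurable.
    apply: (@approx_indic_incr _ (fun n => \big[setU/set0]_(i < n) F i)).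
    * exact: bigcupT_measurable.
    * by move=> n; exact: bigsetU_measurable.
    * rewrite eqEsubset; split => x [n _ xn].
        by exists n.+1 => //; rewrite -bigcup_mkord; exists n => /=.
      by move: xn; rewrite -bigcup_mkord => -[m _ ?]; exists m.
    * by move=> n m nm; apply/subsetPset; apply: subset_bigsetU.
    * elim => [|n IH].
        rewrite big_ord0 indic0 => e e0; exists 1 => // t _ _.
        rewrite /modu integral0_eq ?lee_fin ?ltW// => x _.
        by apply: integral0_eq => w _; rewrite subrr normr0 mul0r.
      rewrite big_ord_recr/= (_ : \1_ _ = (fun x => \1_(\big[setU/set0]_(i < n) F i) x + \1_(F n) x)).
        apply: approx_add; [|exact: measurable_indic|exact: IH|exact: (HF n).2].
        by apply: measurable_indic; exact: bigsetU_measurable.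
      apply/funext => x; rewrite !indicE in_setU.
      have [Fx|] := boolP (x \in F n); last by rewrite orbF addr0.
      rewrite orbT memNset ?add0r// -bigcup_mkord => -[m /= mn Fm].
      have mn' : m = n by apply: (tF m n) => //; exists x; split => //; exact: set_mem.
      by move: mn; rewrite mn' ltnn.
- move=> _ [a [b ->]]; split; first exact: measurable_quadrant.
  exact: approx_quadrant.
Qed.

End Modulus.

(** * The Poincare inequality *)

Opaque moll ker flx dflx.

Section WeakGradient.
Variable R : realType.
Local Notation pt := (R * R)%type.
Local Notation mpt := (measurableTypeR R * measurableTypeR R)%type.
Local Notation mu := (leb2 R).
Local Notation leb := (@lebesgue_measure R).

(** The support of the product of f1 and f2 lies in a closed square contained in E. Both functions
    vanish at distance r too, so that the fundamental theorem of calculus leaves no boundary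
    term. *)
Definition boxed (E : set pt) (f1 f2 : R -> R) : Prop :=
  exists (a : pt) (r : R), [/\ 0 < r,
    forall z : pt, `|z.1 - a.1| <= r -> `|z.2 - a.2| <= r -> E z,
    forall y, r <= `|y - a.1| -> f1 y = 0 & forall y, r <= `|y - a.2| -> f2 y = 0].

(* Testing against products only makes the symmetry of iterated partial
   derivatives of test functions unnecessary. *)
Definition wgrad (E : set mpt) (v g0 g1 : mpt -> R) : Prop :=
  forall f1 f2 : R -> R, smooth1 f1 -> smooth1 f2 -> boxed E f1 f2 ->
    (\int[mu]_(x in E) (v x * (derive1 f1 x.1 * f2 x.2)) =
      - \int[mu]_(x in E) (g0 x * (f1 x.1 * f2 x.2))) /\
    (\int[mu]_(x in E) (v x * (f1 x.1 * derive1 f2 x.2)) =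
      - \int[mu]_(x in E) (g1 x * (f1 x.1 * f2 x.2))).

Lemma integrableM_bounded (E : set mpt) (v f : mpt -> R) (C : R) : measurable E ->
  mu.-integrable E (EFin \o v) -> measurable_fun E f ->
  (forall x, E x -> `|f x| <= C) -> mu.-integrable E (fun x => (v x * f x)%:E).
Proof.
move=> mE iv mf fC.
have mv := measurable_int _ iv; move/measurable_EFinP in mv.
have iC : mu.-integrable E (fun x => C%:E * (EFin \o v) x)%E by exact: integrableZl.
apply: (le_integrable mE _ _ iC).
  by apply/measurable_EFinP; apply: measurable_funM.
move=> x Ex /=; rewrite lee_fin !normrM [leRHS]mulrC ler_wpM2l//.
by apply: le_trans (fC x Ex) (ler_norm C).
Qed.

Variables (E : set mpt) (c : pt) (d h B : R).
Hypothesis mE : measurable E.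
Hypothesis d0 : 0 < d.
Hypothesis hE : forall x y : pt, E x -> E y -> `|x.1 - y.1| <= h /\ `|x.2 - y.2| <= h.
Hypothesis starE : forall (t : R) (x z : pt), 0 <= t < 1 -> E x ->
  `|z.1 - c.1| <= d -> `|z.2 - c.2| <= d ->
  E (t * x.1 + (1 - t) * z.1, t * x.2 + (1 - t) * z.2).
Hypothesis E0 : E !=set0.
Hypothesis hB : forall y : R, `|moll y| <= B /\ `|derive1 (@moll R) y| <= B.

Local Notation KE := (cell_kernel E c d).
Local Notation M := (kernel_mass d h B).
Local Notation K2 := (plane_kernel c d).

Variables v g0 g1 : mpt -> R.
Hypotheses (mv : measurable_fun setT v) (mg0 : measurable_fun setT g0)
  (mg1 : measurable_fun setT g1).
Hypotheses (iv : mu.-integrable E (EFin \o v)) (ig0 : mu.-integrable E (EFin \o g0))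
  (ig1 : mu.-integrable E (EFin \o g1)).
Hypothesis wg : wgrad E v g0 g1.

Let hB1 (y : R) : `|moll y| <= B. Proof. by have [] := hB y. Qed.

Let B0 : 0 <= B. Proof. exact: le_trans (normr_ge0 _) (hB1 0). Qed.

Let h0 : 0 < h.
Proof. exact: lt_le_trans (d_le_h d0 hE starE E0). Qed.

Lemma ker_bound (T t a x w : R) : T < 1 -> t <= T ->
  `|ker a d t x w| <= B / ((1 - T) * d).
Proof.
move=> T1 tT; have t1 : t < 1 by exact: le_lt_trans T1.
rewrite ger0_norm ?ker_ge0//; apply: (le_trans (ker_le _ _ _ _ hB1 _)) => //.
rewrite ler_wpM2l// lef_pV2 ?posrE ?mulr_gt0 ?subr_gt0// ler_wpM2r ?(ltW d0)//; lra.
Qed.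

Lemma dflx_bound (T t a x w : R) : T < 1 -> t <= T -> `|x - a| <= h ->
  `|dflx a d t x w| <= (d + (h + d)) * B / ((1 - T) * d) ^+ 2.
Proof.
move=> T1 tT xa; have t1 : t < 1 by exact: le_lt_trans T1.
apply: (le_trans (dflx_le _ _ hB t1 xa)) => //.
apply: ler_wpM2l.
  by apply: mulr_ge0 => //; rewrite !addr_ge0 ?ltW.
rewrite lef_pV2 ?posrE ?exprn_gt0 ?mulr_gt0 ?subr_gt0//.
rewrite lerXn2r ?nnegrE ?mulr_ge0 ?subr_ge0 ?(ltW t1) ?(ltW T1) ?(ltW d0)//.
by rewrite ler_wpM2r ?(ltW d0)//; lra.
Qed.

Lemma flx_bound (t a x w : R) : t < 1 -> `|x - a| <= h ->
  `|flx a d t x w| <= (h + d) * (B / ((1 - t) * d)).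
Proof.
move=> t1 xa; apply: (le_trans (flx_le d0 w t1 xa)).
apply: ler_wpM2l; first by rewrite addr_ge0// ltW.
by apply: le_trans (ler_norm _) _; apply: ker_bound.
Qed.

(** The s-derivative of [plane_kernel], by the product rule and the continuity equation in each
    coordinate: it is minus the divergence in w of a flux whose components are products of [flx] and
    [ker]. *)
Definition dtK (x : pt) (s : R) (w : mpt) : R :=
  - (dflx c.1 d s x.1 w.1 * ker c.2 d s x.2 w.2 +
     ker c.1 d s x.1 w.1 * dflx c.2 d s x.2 w.2).

Lemma plane_kernel_FTC (x w : pt) T : 0 < T < 1 ->
  (\int[leb]_(s in `[0%R, T]) (dtK x s w)%:E = (K2 T x w - K2 0 x w)%:E)%E.
Proof.
move=> /andP[T0 T1].
apply: (@continuous_FTC2_cc _ (fun s => dtK x s w) (fun s => K2 s x w)) => //.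
  move=> s /andP[_ sT]; have s1 : s < 1 by exact: le_lt_trans T1.
  have D := is_deriveM (ker_is_derive_t c.1 d0 x.1 w.1 s1) (ker_is_derive_t c.2 d0 x.2 w.2 s1).
  apply: (is_derive_eq D).
  rewrite /dtK /GRing.scale/=.
  move: (ker _ _ _ _ _) (ker _ _ _ _ _) (dflx _ _ _ _ _) (dflx _ _ _ _ _) => k k' l l'.
  by ring.
move=> s /andP[_ sT]; have s1 : s < 1 by exact: le_lt_trans T1.
apply: cvgN; apply: cvgD; apply: cvgM; try exact: dflx_continuous_t; exact: ker_continuous_t.
Qed.

Variable x : mpt.
Hypothesis Ex : E x.
Let xc1 : `|x.1 - c.1| <= h. Proof. by have [] := hE Ex (center_in d0 starE E0). Qed.
Let xc2 : `|x.2 - c.2| <= h. Proof. by have [] := hE Ex (center_in d0 starE E0). Qed.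

Let Hg (w : mpt) : R := (h + d) * (`|g0 w| + `|g1 w|).

Lemma measurable_dtK dd (U : measurableType dd) (D : set U) (fs : U -> R) (fw : U -> mpt) :
  measurable_fun D fs -> measurable_fun D fw ->
  measurable_fun D (fun p => dtK x (fs p) (fw p)).
Proof.
move=> ms mw.
have mw1 : measurable_fun D (fun p => (fw p).1) by apply: (measurableT_comp measurable_fst).
have mw2 : measurable_fun D (fun p => (fw p).2) by apply: (measurableT_comp measurable_snd).
apply: measurableT_comp => //; apply: measurable_funD; apply: measurable_funM.
- exact: measurable_dflx.
- exact: measurable_ker.
- exact: measurable_ker.
- exact: measurable_dflx.
Qed.

(** The components of the flux, [flx] times [ker] and [ker] times [flx], are supported in the square
    of half-side (1 - s) d around s x + (1 - s) c, which lies in E by [star_box]. Used as test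
    functions, they move the divergence onto v; then |flx| <= (h + d) ker brings the kernel back. *)
Lemma dtK_integral s : 0 <= s < 1 ->
  (`| \int[mu]_(w in E) (v w * dtK x s w)%:E | <= \int[mu]_w (Hg w * KE s x w)%:E)%E.
Proof.
move=> s01; move/andP: (s01) => [s0 s1].
pose k1 := ker c.1 d s x.1; pose k2 := ker c.2 d s x.2.
pose f1 := flx c.1 d s x.1; pose f2 := flx c.2 d s x.2.
have sk1 : smooth1 k1 by exact: ker_smooth.
have sk2 : smooth1 k2 by exact: ker_smooth.
have sf1 : smooth1 f1 by exact: flx_smooth.
have sf2 : smooth1 f2 by exact: flx_smooth.
have sd0 : 0 < (1 - s) * d by rewrite mulr_gt0// subr_gt0.
pose a : pt := (s * x.1 + (1 - s) * c.1, s * x.2 + (1 - s) * c.2).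
have aE (z : pt) : `|z.1 - a.1| <= (1 - s) * d -> `|z.2 - a.2| <= (1 - s) * d -> E z.
  exact: (star_box starE s01 Ex).
have b1 : boxed E f1 k2.
  exists a, ((1 - s) * d); split => // y hy; first exact: flx_eq0.
  exact: ker_eq0.
have b2 : boxed E k1 f2.
  exists a, ((1 - s) * d); split => // y hy; first exact: ker_eq0.
  exact: flx_eq0.
have [W1 _] := wg sf1 sk2 b1.
have [_ W2] := wg sk1 sf2 b2.
have mk1 : measurable_fun E (fun w : mpt => k1 w.1).
  by apply: measurable_ker => //; exact: measurable_funTS measurable_fst.
have mk2 : measurable_fun E (fun w : mpt => k2 w.2).
  by apply: measurable_ker => //; exact: measurable_funTS measurable_snd.
have mf1 : measurable_fun E (fun w : mpt => f1 w.1).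
  by apply: measurable_flx => //; exact: measurable_funTS measurable_fst.
have mf2 : measurable_fun E (fun w : mpt => f2 w.2).
  by apply: measurable_flx => //; exact: measurable_funTS measurable_snd.
have mdf1 : measurable_fun E (fun w : mpt => dflx c.1 d s x.1 w.1).
  by apply: measurable_dflx => //; exact: measurable_funTS measurable_fst.
have mdf2 : measurable_fun E (fun w : mpt => dflx c.2 d s x.2 w.2).
  by apply: measurable_dflx => //; exact: measurable_funTS measurable_snd.
pose Ck := B / ((1 - s) * d); pose Cd := (d + (h + d)) * B / ((1 - s) * d) ^+ 2.
pose Cf := (h + d) * Ck.
have kb a' x' w : `|ker a' d s x' w| <= Ck by exact: ker_bound.
have bnd (p q Cp Cq : R) : `|p| <= Cp -> `|q| <= Cq -> `|p * q| <= Cp * Cq.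
  by move=> ? ?; rewrite normrM ler_pM.
have iW1 : mu.-integrable E (fun w => (v w * (dflx c.1 d s x.1 w.1 * k2 w.2))%:E).
  apply: (integrableM_bounded mE iv (measurable_funM mdf1 mk2) (C := Cd * Ck)) => w _.
  by apply: bnd (kb _ _ _); apply: dflx_bound.
have iW2 : mu.-integrable E (fun w => (v w * (k1 w.1 * dflx c.2 d s x.2 w.2))%:E).
  apply: (integrableM_bounded mE iv (measurable_funM mk1 mdf2) (C := Ck * Cd)) => w _.
  by apply: bnd (kb _ _ _) _; apply: dflx_bound.
have iG1 : mu.-integrable E (fun w => (g0 w * (f1 w.1 * k2 w.2))%:E).
  apply: (integrableM_bounded mE ig0 (measurable_funM mf1 mk2) (C := Cf * Ck)) => w _.
  by apply: bnd (kb _ _ _); apply: flx_bound.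
have iG2 : mu.-integrable E (fun w => (g1 w * (k1 w.1 * f2 w.2))%:E).
  apply: (integrableM_bounded mE ig1 (measurable_funM mk1 mf2) (C := Ck * Cf)) => w _.
  by apply: bnd (kb _ _ _) _; apply: flx_bound.
have iD : mu.-integrable E (fun w => (v w * (dflx c.1 d s x.1 w.1 * k2 w.2) +
    v w * (k1 w.1 * dflx c.2 d s x.2 w.2))%:E).
  by under eq_fun do rewrite EFinD; exact: integrableD.
have -> : (\int[mu]_(w in E) (v w * dtK x s w)%:E =
    \int[mu]_(w in E) (g0 w * (f1 w.1 * k2 w.2) + g1 w * (k1 w.1 * f2 w.2))%:E)%E.
  under eq_integral => w _.
    rewrite (_ : v w * dtK x s w = -1 * (v w * (dflx c.1 d s x.1 w.1 * k2 w.2) +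
      v w * (k1 w.1 * dflx c.2 d s x.2 w.2))); last first.
      rewrite /dtK -/(k1 _) -/(k2 _).
      move: (v w) (k1 _) (k2 _) (dflx _ _ _ _ _) (dflx _ _ _ _ _) => p q r l l'.
      by ring.
    over.
  rewrite -EFin_Rint//; last exact: (integrableZl mE (-1) iD).
  rewrite -EFin_Rint//; last exact: (integrableD mE iG1 iG2).
  congr EFin; rewrite RintegralZl// !RintegralD//.
  move: W1 W2; under eq_Rintegral do rewrite flx_derive1//.
  move=> ->; under eq_Rintegral do rewrite flx_derive1//.
  by move=> ->; rewrite -opprD mulN1r opprK.
apply: (le_trans (le_abse_integral _ _ _)) => //.
  apply/measurable_EFinP; apply: measurable_funD; apply: measurable_funM;
    by [exact: measurable_funTS|exact: measurable_funM].
rewrite [leLHS]integral_mkcond.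
apply: ge0_le_integral => //.
- by move=> w _; rewrite patchE; case: ifP.
- apply/(measurable_restrictT _ mE); apply/measurable_EFinP; apply: measurableT_comp => //.
  apply: measurable_funD; apply: measurable_funM;
    by [exact: measurable_funTS|exact: measurable_funM].
- apply/measurable_EFinP; apply: measurable_funM; last exact: measurable_cell_kernel.
  by apply: measurable_funM => //; apply: measurable_funD; apply: measurableT_comp.
move=> w _; rewrite patchE; case: ifPn => [/set_mem Ew|_]; last first.
  rewrite lee_fin; apply: mulr_ge0; last exact: cell_kernel_ge0.
  by apply: mulr_ge0; apply: addr_ge0; rewrite ?normr_ge0 ?ltW.
rewrite /= lee_fin /Hg /KE !indicE !mem_set// !mul1r /plane_kernel -/k1 -/k2.
apply: (le_trans (ler_normD _ _)).
rewrite [(h + d) * _]mulrDr mulrDl.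
have hd : 0 <= h + d by rewrite addr_ge0 ?ltW.
have k10 : 0 <= k1 w.1 by exact: ker_ge0.
have k20 : 0 <= k2 w.2 by exact: ker_ge0.
have aux1 (g f p q H : R) : 0 <= q -> `|f| <= H * p -> `|g * (f * q)| <= H * `|g| * (p * q).
  move=> q0 fp; rewrite !normrM (ger0_norm q0).
  have -> : H * `|g| * (p * q) = `|g| * (H * p * q) by ring.
  by rewrite ler_wpM2l// ler_wpM2r.
have aux2 (g f p q H : R) : 0 <= p -> `|f| <= H * q -> `|g * (p * f)| <= H * `|g| * (p * q).
  by move=> p0 fq; rewrite [p * f]mulrC [p * q]mulrC; apply: aux1.
apply: lerD.
  by apply: aux1 => //; exact: flx_le.
by apply: aux2 => //; exact: flx_le.
Qed.

End WeakGradient.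

Section Poincare.
Import HBSimple.
Variable R : realType.
Local Notation pt := (R * R)%type.
Local Notation mpt := (measurableTypeR R * measurableTypeR R)%type.
Local Notation mu := (leb2 R).
Local Notation leb := (@lebesgue_measure R).
Local Notation mY := (prodm leb (leb2s R)).

(** Simple functions are dense in L^1(E), and they are finite linear combinations of indicators. *)
Lemma approx_L1 (E : set mpt) (c : pt) (d h B : R) : measurable E -> 0 < d ->
  (forall x y : pt, E x -> E y -> `|x.1 - y.1| <= h /\ `|x.2 - y.2| <= h) ->
  (forall (t : R) (x z : pt), 0 <= t < 1 -> E x ->
    `|z.1 - c.1| <= d -> `|z.2 - c.2| <= d ->
    E (t * x.1 + (1 - t) * z.1, t * x.2 + (1 - t) * z.2)) ->
  E !=set0 -> (forall y : R, `|moll y| <= B) ->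
  forall v : mpt -> R, measurable_fun setT v -> mu.-integrable E (EFin \o v) ->
  approximable E c d v.
Proof.
move=> mE d0 hE starE E0 hB v mv iv.
have [g [ig gv gv1]] := approximation_sfun_integrable mE iv.
apply: (approx_close mE d0 hE starE hB) => // e e0.
move: gv1 => /fine_cvgP[gfin /cvgrPdist_le /(_ _ e0) gle].
have [N _ /(_ N (leqnn N)) [Nfin Nle]] := filterI gfin gle.
exists (g N : mpt -> R).
  have mgN : measurable_fun setT ((g N : mpt -> R)) by exact: (measurable_funPT (g N)).
  split; first exact: mgN.
  have gE := fimfunEord (g N).
  have [n [a [A [mA gA]]]] : exists n (a : 'I_n -> R) (A : 'I_n -> set mpt),
      (forall i, measurable (A i)) /\ forall x, g N x = \sum_(i < n) a i * \1_(A i) x.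
    eexists; eexists; eexists; split; last exact: gE.
    by move=> i; rewrite -[X in measurable X]setTI; apply: mgN.
  have -> : (g N : mpt -> R) = fun x => \sum_(i < n) a i * \1_(A i) x by exact/funext.
  apply: (approx_sum mE) => i.
    by apply: measurable_funM => //; exact: measurable_indic.
  apply: (approx_scale mE); first exact: measurable_indic.
  exact: (approx_indic mE d0 hE starE E0 hB).
move: Nle; rewrite sub0r normrN /= => Nle.
rewrite -(fineK Nfin) lee_fin; apply: le_trans Nle; exact: ler_norm.
Qed.

Variables (E : set mpt) (c : pt) (d h B : R).
Hypothesis mE : measurable E.
Hypothesis d0 : 0 < d.
Hypothesis hE : forall x y : pt, E x -> E y -> `|x.1 - y.1| <= h /\ `|x.2 - y.2| <= h.
Hypothesis starE : forall (t : R) (x z : pt), 0 <= t < 1 -> E x ->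
  `|z.1 - c.1| <= d -> `|z.2 - c.2| <= d ->
  E (t * x.1 + (1 - t) * z.1, t * x.2 + (1 - t) * z.2).
Hypothesis E0 : E !=set0.
Hypothesis hB : forall y : R, `|moll y| <= B /\ `|derive1 (@moll R) y| <= B.

Local Notation KE := (cell_kernel E c d).
Local Notation M := (kernel_mass d h B).
Local Notation K2 := (plane_kernel c d).

Variables v g0 g1 : mpt -> R.
Hypotheses (mv : measurable_fun setT v) (mg0 : measurable_fun setT g0)
  (mg1 : measurable_fun setT g1).
Hypotheses (iv : mu.-integrable E (EFin \o v)) (ig0 : mu.-integrable E (EFin \o g0))
  (ig1 : mu.-integrable E (EFin \o g1)).
Hypothesis wg : wgrad E v g0 g1.

Let hB1 (y : R) : `|moll y| <= B. Proof. by have [] := hB y. Qed.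

Let B0 : 0 <= B. Proof. exact: le_trans (normr_ge0 _) (hB1 0). Qed.

Let h0 : 0 < h.
Proof. exact: lt_le_trans (d_le_h d0 hE starE E0). Qed.

Definition grad_bound (w : mpt) : R := (h + d) * (`|g0 w| + `|g1 w|).
(** Time is made part of the source variable p = (s, w), so that the integral over s of the averages
    is a single kernel operator, to which Schur's test applies. The row masses are at most T < 1;
    the column masses, taken at fixed (s, w), are those of [cell_kernel]. *)
Definition slab_kernel (T : R) (x : mpt) (p : measurableTypeR R * mpt) : R :=
  \1_`[0, T] p.1 * KE p.1 x p.2.
(** With [plane_kernel] instead of [cell_kernel], [avg 0] is constant on the whole plane. *)
Definition avg (t : R) (x : mpt) : R := \int[mu]_(w in E) (v w * K2 t x w).

Lemma normM_le (p q Cp Cq : R) : `|p| <= Cp -> `|q| <= Cq -> `|p * q| <= Cp * Cq.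
Proof. by move=> ? ?; rewrite normrM ler_pM. Qed.

Lemma grad_bound_ge0 w : 0 <= grad_bound w.
Proof. by apply: mulr_ge0; apply: addr_ge0; rewrite ?normr_ge0 ?ltW. Qed.

Lemma measurable_grad_bound : measurable_fun setT grad_bound.
Proof. by apply: measurable_funM => //; apply: measurable_funD; apply: measurableT_comp. Qed.

Lemma slab_kernel_ge0 T x p : 0 <= slab_kernel T x p.
Proof. by apply: mulr_ge0; rewrite ?cell_kernel_ge0// indicE. Qed.

Lemma measurable_slab_kernel T : measurable_fun setT
  (fun q : mpt * (measurableTypeR R * mpt) => slab_kernel T q.1 q.2).
Proof.
have mi : measurable_fun setT (\1_`[0%R, T] : measurableTypeR R -> R) by exact: measurable_indic.
apply: measurable_funM.
  apply: (measurableT_comp mi); exact: (measurableT_comp measurable_fst measurable_snd).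
apply: measurable_cell_kernel => //.
- exact: (measurableT_comp measurable_fst measurable_snd).
- exact: (measurableT_comp measurable_snd measurable_snd).
Qed.

Lemma integrable_avg t x : t < 1 -> mu.-integrable E (fun w => (v w * K2 t x w)%:E).
Proof.
move=> t1.
have mK : measurable_fun E (fun w => K2 t x w).
  by apply: measurable_plane_kernel => //; exact: measurable_id.
apply: (integrableM_bounded mE iv mK (C := (B / ((1 - t) * d)) * (B / ((1 - t) * d)))) => w _.
by apply: normM_le; exact: (ker_bound d0 hB).
Qed.

(* Integrate the continuity equation in t and move d/dw onto v. *)
Lemma avg_diff T x : 0 < T < 1 -> E x ->
  (`|avg T x - avg 0 x|%:E <= \int[mY]_p (`|grad_bound p.2| * slab_kernel T x p)%:E)%E.
Proof.
move=> T01 Ex; move/andP: (T01) => [T0 T1].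
have mi : measurable_fun setT (\1_`[0%R, T] : measurableTypeR R -> R) by exact: measurable_indic.
have mE1 : measurable_fun setT (\1_E : mpt -> R) by exact: measurable_indic.
pose F (p : measurableTypeR R * mpt) : R := \1_`[0, T] p.1 * (\1_E p.2 * v p.2 * dtK c d x p.1 p.2).
have mdt : measurable_fun setT (fun p : measurableTypeR R * mpt => dtK c d x p.1 p.2).
  exact: (measurable_dtK c d x measurable_fst measurable_snd).
have mF : measurable_fun setT F.
  apply: measurable_funM; first exact: (measurableT_comp mi measurable_fst).
  apply: measurable_funM => //; apply: measurable_funM.
    exact: (measurableT_comp mE1 measurable_snd).
  exact: (measurableT_comp mv measurable_snd).
pose Ck := B / ((1 - T) * d); pose Cd := (d + (h + d)) * B / ((1 - T) * d) ^+ 2.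
pose C := Cd * Ck + Ck * Cd.
have [xc1 xc2] := hE Ex (center_in d0 starE E0).
have dtC s w : s <= T -> `|dtK c d x s w| <= C.
  move=> sT; rewrite /dtK normrN; apply: (le_trans (ler_normD _ _)).
  apply: lerD; apply: normM_le.
  - exact: (dflx_bound d0 hE starE E0 hB).
  - exact: (ker_bound d0 hB).
  - exact: (ker_bound d0 hB).
  - exact: (dflx_bound d0 hE starE E0 hB).
have C0 : 0 <= C by exact: le_trans (normr_ge0 _) (dtC T x (lexx T)).
have mv1 : measurable_fun setT (fun w => `|\1_E w * v w|).
  by apply: measurableT_comp => //; exact: measurable_funM.
have Fle s w : `|F (s, w)| <= (C * \1_`[0, T] s) * `|\1_E w * v w|.
  rewrite /F /= [\1__ s]indicE; case: (boolP (s \in _)) => [/set_mem|_]; last first.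
    by rewrite mul0r normr0 mulr0 mul0r.
  rewrite /= in_itv/= => /andP[_ sT]; rewrite mul1r mulr1 mulrC.
  by apply: normM_le => //; exact: dtC.
(* F changes sign, so that Fubini's theorem requires absolute integrability: [dtK] is bounded for s
   <= T < 1, and v is integrable on E. *)
have iF : (leb \x leb2s R)%E.-integrable setT (EFin \o F).
  apply/integrable12ltyP; first exact/measurable_EFinP.
  have [r rE] : exists r : R, (\int[mu]_w `|\1_E w * v w|%:E = r%:E)%E.
    have /integrableP[_ vfin] := iv.
    exists (fine (\int[mu]_w `|\1_E w * v w|%:E)%E); rewrite fineK// ge0_fin_numE; last exact: integral_ge0.
    move: vfin; rewrite [X in (X < _)%E]integral_mkcond.
    congr (_ < _)%E; apply: eq_integral => w _; rewrite patchE indicE.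
    by case: (w \in E); rewrite /= ?mul1r// mul0r normr0.
  apply: (@le_lt_trans _ _ (\int[leb]_s (C * r * \1_`[0%R, T] s)%:E)%E).
    apply: ge0_le_integral => //.
    - by move=> s _; apply: integral_ge0 => w _; exact: abse_ge0.
    - apply: (@measurable_fun_fubini_tonelli_F _ _ _ _ R (leb2s R) (fun p => `|(F p)%:E|%E)) => //.
      by apply: measurableT_comp => //; exact/measurable_EFinP.
    - by apply/measurable_EFinP; exact: measurable_funM.
    - move=> s _; apply: (@le_trans _ _ (\int[mu]_w ((C * \1_`[0%R, T] s) * `|\1_E w * v w|)%:E)%E).
        apply: ge0_le_integral_EFin => //.
        + by apply: measurableT_comp => //; exact: (measurableT_comp mF (pair1_measurable s)).
        + exact: measurable_funM.
      rewrite ge0_integralZ_EFin//; last by rewrite mulr_ge0.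
      by rewrite rE -EFinM lee_fin mulrAC.
  under eq_integral do rewrite EFinM.
  rewrite integralZl//; last exact: integrable_indic_itv.
  have -> : (\int[leb]_s (\1_`[0%R, T] s)%:E = T%:E)%E.
    rewrite integral_indic// setIT.
    by apply: (etrans (lebesgue_measure_itv `[0%R, T])); rewrite /= lte_fin T0 sube0.
  by rewrite -EFinM ltry.
have mF1 s : measurable_fun setT (fun w => F (s, w)) by exact: (measurableT_comp mF (pair1_measurable s)).
have := Fubini iF.
(* Integration over s first gives the increment of the kernel, by the fundamental theorem of
   calculus; the other order presents, at each time s, the integral bounded by [dtK_integral]. *)
have -> : (\int[leb2s R]_w \int[leb]_s (EFin \o F) (s, w) = (avg T x - avg 0 x)%:E)%E.
  transitivity (\int[mu]_(w in E) (v w * (K2 T x w - K2 0 x w))%:E)%E.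
    rewrite [RHS]integral_mkcond; apply: eq_integral => w _.
    rewrite patchE; case: ifPn => wE; last first.
      rewrite integral0_eq// => s _ /=.
      by rewrite /F /= [\1_E w]indicE (negbTE wE) !mul0r mulr0.
    transitivity (\int[leb]_(s in `[0%R, T]) ((v w)%:E * (dtK c d x s w)%:E))%E.
      rewrite [RHS]integral_mkcond; apply: eq_integral => s _ /=.
      rewrite patchE /F /= [\1_E w]indicE wE mul1r indicE.
      by case: ifPn => sT; rewrite ?mul1r// mul0r.
    rewrite integralZl//; last first.
      have mI : measurable_fun `[0, T] (fun s => dtK c d x s w).
        by apply: (measurable_dtK c d x) => //; exact: measurable_funTS measurable_id.
      have iC : leb.-integrable `[0, T] (EFin \o cst C).
        apply: (@continuous_compact_integrable _ (cst C)); first exact: segment_compact.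
        by apply: continuous_subspaceT => y; apply: cvg_cst.
      apply: (le_integrable _ _ _ iC) => //; first exact/measurable_EFinP.
      move=> s /=; rewrite in_itv/= => /andP[_ sT].
      by rewrite lee_fin (ger0_norm C0) dtC.
    by rewrite (plane_kernel_FTC c d0).
  have T0' : 0 <= T by exact: ltW.
  have iD : mu.-integrable E (EFin \o (fun w => v w * K2 T x w - v w * K2 0 x w)).
    by apply: (integrableB mE (integrable_avg x T1) (integrable_avg x ltr01)).
  rewrite -EFin_Rint//; last by apply: eq_integrable iD => // w _ /=; rewrite mulrBr.
  congr EFin; rewrite /avg -RintegralB//; last 2 first.
  - exact: integrable_avg.
  - exact: integrable_avg.
  by apply: eq_Rintegral => w _; rewrite mulrBr.
move=> IE; rewrite -[(`|_|%:E)%E]/(`|(avg T x - avg 0 x)%:E|)%E -IE.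
apply: (le_trans (le_abse_integral _ _ _)) => //.
  exact: (measurable_fubini_F iF).
have mG : measurable_fun setT (fun p : measurableTypeR R * mpt => (`|grad_bound p.2| * slab_kernel T x p)%:E).
  apply/measurable_EFinP; apply: measurable_funM.
    by apply: measurableT_comp => //; exact: (measurableT_comp measurable_grad_bound measurable_snd).
  exact: (measurableT_comp (measurable_slab_kernel T) (pair1_measurable x)).
have G0 p : (0 <= (`|grad_bound p.2| * slab_kernel T x p)%:E)%E by rewrite lee_fin mulr_ge0// slab_kernel_ge0.
have -> : (\int[mY]_p (`|grad_bound p.2| * slab_kernel T x p)%:E =
    \int[leb]_s \int[leb2s R]_w (`|grad_bound w| * slab_kernel T x (s, w))%:E)%E.
  exact: (@fubini_tonelli1 _ _ _ _ R leb (leb2s R) _ mG G0).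
apply: ge0_le_integral => //.
- by apply: measurableT_comp => //; exact: (measurable_fubini_F iF).
- exact: (@measurable_fun_fubini_tonelli_F _ _ _ _ R (leb2s R) _ mG G0).
move=> s _; rewrite /fubini_F /F /slab_kernel /=.
have [sT|sT] := boolP (s \in `[0%R, T]%classic); last first.
  rewrite indicE (negbTE sT) integral0_eq ?abse0; last by move=> w _; rewrite mul0r.
  by rewrite integral_ge0// => w _; rewrite mul0r mulr0.
have /andP[s0 sT'] : 0 <= s <= T by move: sT => /set_mem; rewrite /= in_itv.
rewrite indicE sT.
have s01 : 0 <= s < 1 by rewrite s0 (le_lt_trans sT').
apply: (le_trans _ (le_trans (dtK_integral mE d0 hE starE E0 hB mg0 mg1 iv ig0 ig1 wg Ex s01) _)).
  rewrite [X in (_ <= `|X|)%E]integral_mkcond le_eqVlt; apply/orP; left; apply/eqP.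
  congr (`|_|)%E; apply: eq_integral => w _; rewrite patchE indicE.
  by case: ifPn => wE; rewrite (_ : true%:R = 1 :> R)// mul1r ?mul1r// !mul0r.
apply: ge0_le_integral_EFin => //.
- apply: measurable_funM; first exact: measurable_grad_bound.
  exact: measurable_cell_kernel.
- apply: measurable_funM; first by apply: measurableT_comp => //; exact: measurable_grad_bound.
  by apply: measurable_funM => //; exact: measurable_cell_kernel.
- by move=> w _; apply: mulr_ge0; [exact: grad_bound_ge0|exact: cell_kernel_ge0].
- by move=> w _; rewrite mul1r ler_wpM2r ?cell_kernel_ge0// ler_norm.
Qed.

End Poincare.

Section PoincareInequality.
Variable R : realType.
Local Notation pt := (R * R)%type.
Local Notation mpt := (measurableTypeR R * measurableTypeR R)%type.
Local Notation mu := (leb2 R).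
Local Notation leb := (@lebesgue_measure R).
Local Notation mY := (prodm leb (leb2s R)).

(* The square of the truncation at N of |v - cst| is controlled by the square of
   the gradient term y plus a multiple of the error x, which is only small in
   L^1. *)
Lemma sqr_le_of_leD (a N : R) (x y : \bar R) : 0 <= a <= N -> (0 <= x)%E -> (0 <= y)%E ->
  (a%:E <= x + y)%E -> ((a ^+ 2)%:E <= y ^+ 2 + (2 * N)%:E * x)%E.
Proof.
move=> /andP[a0 aN] x0 y0.
have [xE|xfin] := eqVneq x +oo%E; last first.
  have {}xfin : x \is a fin_num by rewrite ge0_fin_numE// lt_neqAle xfin leey.
  have [->|yfin] := eqVneq y +oo%E.
    by rewrite /= mulyy addye ?leey// gt_eqF// -(fineK xfin) -EFinM ltNyr.
  have {}yfin : y \is a fin_num by rewrite ge0_fin_numE// lt_neqAle yfin leey.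
  move: xfin yfin x0 y0 => /fineK <- /fineK <-; move: (fine x) (fine y) => X Y.
  rewrite -EFin_expe -EFinM -!EFinD !lee_fin => X0 Y0 aXY.
  have [aY|/ltW Ya] := leP a Y.
    by rewrite ler_wpDr//; [apply: mulr_ge0 => //; lra|rewrite lerXn2r// nnegrE].
  (* Here y <= a <= N and a - y <= x, hence a^2 - y^2 = (a - y) (a + y) <= 2 N x. *)
  nra.
rewrite xE; have [N0|N0] := eqVneq N 0.
  have -> : a = 0 by apply/eqP; rewrite eq_le a0 andbT -N0.
  by rewrite (expr0n _ 2) N0 mulr0 mul0e adde0 => _; exact: expe_ge0.
have N1 : 0 < 2 * N by rewrite mulr_gt0// lt_neqAle eq_sym N0 (le_trans a0).
by rewrite gt0_muley ?lte_fin// addey ?leey// gt_eqF// (lt_le_trans ltNy0)// expe_ge0.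
Qed.

Variables (E : set mpt) (c : pt) (d h B : R).
Hypothesis mE : measurable E.
Hypothesis d0 : 0 < d.
Hypothesis hE : forall x y : pt, E x -> E y -> `|x.1 - y.1| <= h /\ `|x.2 - y.2| <= h.
Hypothesis starE : forall (t : R) (x z : pt), 0 <= t < 1 -> E x ->
  `|z.1 - c.1| <= d -> `|z.2 - c.2| <= d ->
  E (t * x.1 + (1 - t) * z.1, t * x.2 + (1 - t) * z.2).
Hypothesis E0 : E !=set0.
Hypothesis hB : forall y : R, `|moll y| <= B /\ `|derive1 (@moll R) y| <= B.

Local Notation KE := (cell_kernel E c d).
Local Notation M := (kernel_mass d h B).
Local Notation K2 := (plane_kernel c d).

Variables v g0 g1 : mpt -> R.
Hypotheses (mv : measurable_fun setT v) (mg0 : measurable_fun setT g0)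
  (mg1 : measurable_fun setT g1).
Hypotheses (iv : mu.-integrable E (EFin \o v)) (ig0 : mu.-integrable E (EFin \o g0))
  (ig1 : mu.-integrable E (EFin \o g1)).
Hypothesis wg : wgrad E v g0 g1.

Local Notation Hg := (grad_bound d h g0 g1).
Local Notation Kp := (slab_kernel E c d).
Local Notation avg := (avg E c d v).

Let hB1 (y : R) : `|moll y| <= B. Proof. by have [] := hB y. Qed.

Let B0 : 0 <= B. Proof. exact: le_trans (normr_ge0 _) (hB1 0). Qed.

Let h0 : 0 < h.
Proof. exact: lt_le_trans (d_le_h d0 hE starE E0). Qed.

Let M0 : 0 <= M.
Proof. by rewrite /kernel_mass; apply: mulr_ge0; [apply: mulr_ge0 => //; exact: sqr_ge0|apply: addr_ge0 => //; exact: sqr_ge0]. Qed.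

Definition slab_avg (T : R) (x : mpt) : \bar R := (\int[mY]_p (`|Hg p.2| * Kp T x p)%:E)%E.
Definition kernel_osc (T : R) (x : mpt) : \bar R := (\int[mu]_w (`|v w - v x| * KE T x w)%:E)%E.

Let mi (T : R) : measurable_fun setT (\1_`[0%R, T] : measurableTypeR R -> R).
Proof. exact: measurable_indic. Qed.

Let mHg : measurable_fun setT Hg.
Proof. exact: measurable_grad_bound. Qed.

Let Hg0 w : 0 <= Hg w. Proof. by apply: (grad_bound_ge0 d0 hE starE E0). Qed.

Lemma grad_bound_integral2 : (\int[mu]_(w in E) (Hg w ^+ 2)%:E <=
  (2 * (h + d) ^+ 2)%:E *
   (\int[mu]_(w in E) (g0 w ^+ 2)%:E + \int[mu]_(w in E) (g1 w ^+ 2)%:E))%E.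
Proof.
have m0 : measurable_fun E (fun w => g0 w ^+ 2) by apply: measurable_funX; exact: measurable_funTS.
have m1 : measurable_fun E (fun w => g1 w ^+ 2) by apply: measurable_funX; exact: measurable_funTS.
rewrite -ge0_integralD_EFin//; [|by move=> ? _; exact: sqr_ge0..].
rewrite -ge0_integralZ_EFin//; last 3 first.
- exact: measurable_funD.
- by move=> x _; rewrite addr_ge0 ?sqr_ge0.
- by rewrite mulr_ge0// sqr_ge0.
apply: ge0_le_integral_EFin => //.
- by apply: measurable_funX; exact: measurable_funTS.
- by apply: measurable_funM => //; exact: measurable_funD.
- by move=> x _; exact: sqr_ge0.
move=> x _; rewrite /grad_bound exprMn [leRHS]mulrAC [leRHS]mulrC.
apply: ler_wpM2l; first exact: sqr_ge0.
rewrite -(real_normK (num_real (g0 x))) -(real_normK (num_real (g1 x))).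
by have := sqr_ge0 (`|g0 x| - `|g1 x|); nra.
Qed.

Lemma slab_kernel_integral1 T x : 0 < T < 1 -> (\int[mY]_p (Kp T x p)%:E <= 1)%E.
Proof.
move=> /andP[T0 T1].
have mG : measurable_fun setT (fun p : measurableTypeR R * mpt => (Kp T x p)%:E).
  by apply/measurable_EFinP; exact: (measurableT_comp (measurable_slab_kernel c d mE T) (pair1_measurable x)).
have G0 p : (0 <= (Kp T x p)%:E)%E by rewrite lee_fin slab_kernel_ge0.
have -> : (\int[mY]_p (Kp T x p)%:E = \int[leb]_s \int[leb2s R]_w (Kp T x (s, w))%:E)%E.
  exact: (@fubini_tonelli1 _ _ _ _ R leb (leb2s R) _ mG G0).
apply: (@le_trans _ _ (\int[leb]_s (\1_`[0%R, T] s)%:E)%E).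
  apply: ge0_le_integral => //.
  - by move=> ? _; exact: integral_ge0.
  - exact: (@measurable_fun_fubini_tonelli_F _ _ _ _ R (leb2s R) _ mG G0).
  - exact/measurable_EFinP.
  move=> s _; rewrite /slab_kernel /= indicE.
  have [sT|sT] := boolP (s \in `[0%R, T]%classic); last first.
    by rewrite integral0_eq// => w _; rewrite mul0r.
  have /andP[s0 sT'] : 0 <= s <= T by move: sT => /set_mem; rewrite /= in_itv.
  under eq_integral do rewrite (_ : true%:R = 1 :> R)// mul1r.
  by apply: (cell_kernel_integral_le1 d0 starE); rewrite s0 (le_lt_trans sT').
rewrite integral_indic// setIT.
by rewrite [leLHS](lebesgue_measure_itv `[0%R, T]) /= lte_fin T0 sube0 lee_fin ltW.
Qed.

Lemma slab_kernel_integral2 T p : 0 < T < 1 -> (\int[leb2s R]_x (Kp T x p)%:E <= M%:E)%E.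
Proof.
case: p => s w /andP[T0 T1]; rewrite /slab_kernel /= indicE.
have [sT|sT] := boolP (s \in `[0%R, T]%classic); last first.
  by rewrite integral0_eq// => x _; rewrite mul0r.
have /andP[s0 sT'] : 0 <= s <= T by move: sT => /set_mem; rewrite /= in_itv.
under eq_integral do rewrite (_ : true%:R = 1 :> R)// mul1r.
by apply: (cell_kernel_integral2 mE d0 hE starE) => //; rewrite s0 (le_lt_trans sT').
Qed.

Lemma slab_avg_integral2 T : 0 < T < 1 ->
  (\int[mu]_x (slab_avg T x) ^+ 2 <= M%:E * \int[mu]_(w in E) (Hg w ^+ 2)%:E)%E.
Proof.
move=> T01; move/andP: (T01) => [T0 T1].
(* The indicators are already present in the kernel; repeated in G, they confine its L^2 norm to E
   and to the times in [0, T], which contribute a factor T <= 1. *)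
pose G (p : measurableTypeR R * mpt) : R := \1_`[0, T] p.1 * (\1_E p.2 * Hg p.2).
have mE1 : measurable_fun setT (\1_E : mpt -> R) by exact: measurable_indic.
have mG2 : measurable_fun setT (fun w => \1_E w * Hg w) by exact: measurable_funM.
have mG : measurable_fun setT G.
  apply: measurable_funM; first exact: (measurableT_comp (mi T) measurable_fst).
  exact: (measurableT_comp mG2 measurable_snd).
have SE x : slab_avg T x = (\int[mY]_p (`|G p| * Kp T x p)%:E)%E.
  apply: eq_integral => -[s w] _; congr EFin; rewrite /G /slab_kernel /cell_kernel /= ![\1_`[_, _]%classic _]indicE ![\1_E w]indicE.
  by case: (s \in _); case: (w \in _); rewrite /= ?mul1r ?mul0r ?mulr0.
under eq_integral do rewrite SE.
apply: (le_trans (@schur2 _ _ _ _ R (leb2s R) mY (Kp T) M (measurable_slab_kernel c d mE T) (slab_kernel_ge0 E c d T) M0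
  (fun p => slab_kernel_integral2 p T01) G mG (fun x => slab_kernel_integral1 x T01))).
apply: lee_wpmul2l; first by rewrite lee_fin.
have mG' : measurable_fun setT (fun p => (G p ^+ 2)%:E).
  by apply/measurable_EFinP; exact: measurable_funX.
have G0' p : (0 <= (G p ^+ 2)%:E)%E by rewrite lee_fin sqr_ge0.
have -> : (\int[mY]_p (G p ^+ 2)%:E = \int[leb2s R]_w \int[leb]_s (G (s, w) ^+ 2)%:E)%E.
  exact: (@fubini_tonelli2 _ _ _ _ R leb (leb2s R) _ mG' G0').
rewrite [leRHS]integral_mkcond.
apply: ge0_le_integral => //.
- by move=> ? _; exact: integral_ge0.
- exact: (@measurable_fun_fubini_tonelli_G _ _ _ _ R leb _ mG' G0').
- by apply/(measurable_restrictT _ mE); apply/measurable_EFinP; apply: measurable_funX; exact: measurable_funTS.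
move=> w _; rewrite patchE.
have [wE|wE] := boolP (w \in E); last first.
  rewrite integral0_eq// => s _; rewrite /G/= [\1_E w]indicE (negbTE wE) mul0r mulr0 expr0n//.
apply: (@le_trans _ _ (\int[leb]_s ((Hg w ^+ 2) * (\1_`[0%R, T] s))%:E)%E).
  rewrite le_eqVlt; apply/orP; left; apply/eqP; apply: eq_integral => s _.
  congr EFin; rewrite /G /= [\1_E w]indicE wE mul1r exprMn mulrC; congr (_ * _).
  by rewrite indicE; case: (_ \in _); rewrite ?expr1n ?expr0n.
rewrite ge0_integralZ_EFin//; last exact: sqr_ge0.
rewrite integral_indic// setIT.
rewrite [X in (_ * X)%E](lebesgue_measure_itv `[0%R, T]) /= lte_fin T0 sube0 -EFinM lee_fin.
by rewrite ler_piMr ?sqr_ge0// ltW.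
Qed.

Lemma cell_kernel_in T x w : E x -> KE T x w = if w \in E then K2 T x w else 0.
Proof.
move=> Ex; rewrite /cell_kernel !indicE (mem_set Ex) (_ : true%:R = 1 :> R)// mul1r.
by case: ifPn => _; rewrite ?mul0r// (_ : true%:R = 1 :> R)// mul1r.
Qed.

Lemma avg_close T x : 0 <= T < 1 -> E x -> (`|v x - avg T x|%:E <= kernel_osc T x)%E.
Proof.
move=> T01 Ex; move/andP: (T01) => [T0 T1].
have mK : measurable_fun setT (fun w => K2 T x w).
  by apply: measurable_plane_kernel => //; exact: measurable_id.
have K1 : (\int[mu]_(w in E) (K2 T x w)%:E = 1)%E.
  rewrite -(cell_kernel_integral d0 starE T01 Ex) integral_mkcond; apply: eq_integral => w _.
  by rewrite patchE cell_kernel_in//; case: ifPn.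
have iK : mu.-integrable E (EFin \o (fun w => K2 T x w)).
  apply/integrableP; split; first by apply/measurable_EFinP; exact: measurable_funTS.
  rewrite (_ : (\int[_]_(_ in _) _)%E = 1%E) ?ltry// -K1; apply: eq_integral => w _ /=.
  by rewrite ger0_norm// plane_kernel_ge0.
have iK' : mu.-integrable E (EFin \o (fun w => v x * K2 T x w)).
  by have := integrableZl mE (v x) iK.
have -> : v x - avg T x = \int[mu]_(w in E) (v x * K2 T x w - v w * K2 T x w).
  have iA := integrable_avg c mE d0 hB iv x T1.
  rewrite RintegralB//.
  rewrite RintegralZl// (_ : \int[mu]_(w in E) K2 T x w = 1) ?mulr1//.
  by rewrite /Rintegral K1.
have iD : mu.-integrable E (EFin \o (fun w => v x * K2 T x w - v w * K2 T x w)).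
  exact: (integrableB mE iK' (integrable_avg c mE d0 hB iv x T1)).
rewrite -abse_EFin EFin_Rint//.
apply: (le_trans (le_abse_integral _ mE _)); first exact: measurable_int iD.
rewrite integral_mkcond le_eqVlt; apply/orP; left; apply/eqP; apply: eq_integral => w _.
rewrite patchE cell_kernel_in//; case: ifPn => wE; last by rewrite mulr0.
rewrite /= -mulrBl normrM distrC [ `|K2 _ _ _|]ger0_norm// plane_kernel_ge0//.
Qed.

Lemma truncated_poincare (N : R) : 0 <= N ->
  (\int[mu]_(x in E) ((Num.min `|v x - avg 0 c| N) ^+ 2)%:E <=
    M%:E * \int[mu]_(w in E) (Hg w ^+ 2)%:E)%E.
Proof.
move=> N0; apply/lee_addgt0Pr => e e0.
have e1 : 0 < e / (2 * N + 1) by rewrite divr_gt0// ltr_wpDl// mulr_ge0.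
have B0' : forall y, `|moll y| <= B := hB1.
have [del del0 hdel] := approx_L1 mE d0 hE starE E0 hB1 mv iv e1.
(* T is near enough to 1 for the L^1 error to be at most e / (2 N + 1), where the added 1 allows N =
   0; the maximum with 1/2 keeps T positive. *)
pose T := Num.max (1 - del / 2) (2^-1).
have T01 : 0 < T < 1 by rewrite /T; apply/andP; split; [rewrite lt_max invr_gt0 ltr0n orbT|rewrite gt_max; apply/andP; split; lra].
have T01' : 0 <= T < 1 by move/andP: T01 => [/ltW -> ->].
have Td : 1 - del < T by rewrite /T lt_max; apply/orP; left; lra.
have mmin : measurable_fun setT (fun x => (Num.min `|v x - avg 0 c| N) ^+ 2).
  apply: measurable_funX; apply: measurable_minr; last exact: measurable_cst.
  by apply: measurableT_comp => //; apply: measurable_funB => //; exact: measurable_cst.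
have mS : measurable_fun setT (slab_avg T).
  apply: (@measurable_fun_fubini_tonelli_F _ _ mpt _ R mY (fun q => (`|Hg q.2.2| * Kp T q.1 q.2)%:E)).
    apply/measurable_EFinP; apply: measurable_funM; last exact: measurable_slab_kernel.
    apply: measurableT_comp => //; apply: (measurableT_comp mHg).
    exact: (measurableT_comp measurable_snd measurable_snd).
  by move=> q; rewrite lee_fin mulr_ge0// slab_kernel_ge0.
have mD : measurable_fun setT (kernel_osc T).
  apply: (@measurable_fun_fubini_tonelli_F _ _ mpt mpt R (leb2s R) (fun q => (`|v q.2 - v q.1| * KE T q.1 q.2)%:E)).
    apply/measurable_EFinP; apply: measurable_funM.
      apply: measurableT_comp => //; apply: measurable_funB.
        exact: (measurableT_comp mv measurable_snd).
      exact: (measurableT_comp mv measurable_fst).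
    by apply: measurable_cell_kernel.
  by move=> q; rewrite lee_fin mulr_ge0// cell_kernel_ge0.
have S0 x : (0 <= slab_avg T x)%E by apply: integral_ge0 => p _; rewrite lee_fin mulr_ge0// slab_kernel_ge0.
have D0 x : (0 <= kernel_osc T x)%E by apply: integral_ge0 => p _; rewrite lee_fin mulr_ge0// cell_kernel_ge0.
have mS2 : measurable_fun setT (fun x => (slab_avg T x) ^+ 2)%E by exact: emeasurable_funM.
have S20 x : (0 <= slab_avg T x ^+ 2)%E by exact: expe_ge0.
have mD2 : measurable_fun setT (fun x => (2 * N)%:E * kernel_osc T x)%E.
  by apply: emeasurable_funM => //; exact: measurable_cst.
have N20 : 0 <= 2 * N by rewrite mulr_ge0.
have D20 x : (0 <= (2 * N)%:E * kernel_osc T x)%E by apply: mule_ge0; rewrite ?lee_fin.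
apply: (@le_trans _ _ (\int[mu]_(x in E) ((slab_avg T x) ^+ 2 + (2 * N)%:E * kernel_osc T x))%E).
  apply: ge0_le_integral => //.
  - by move=> x _; rewrite lee_fin sqr_ge0.
  - by apply/measurable_EFinP; exact: measurable_funTS.
  - by apply: measurable_funTS; apply: emeasurable_funD.
  move=> x Ex; apply: sqr_le_of_leD => //.
    by rewrite le_min normr_ge0 N0 ge_min lexx orbT.
  apply: (@le_trans _ _ (`|v x - avg T x|%:E + `|avg T x - avg 0 x|%:E)%E).
    rewrite -EFinD lee_fin ge_min; apply/orP; left.
    have -> : avg 0 c = avg 0 x by apply: eq_Rintegral => w _; rewrite (plane_kernel_0 _ _ c x).
    have -> : v x - avg 0 x = (v x - avg T x) + (avg T x - avg 0 x) by ring.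
    exact: ler_normD.
  apply: leeD; first exact: avg_close.
  exact: (avg_diff mE d0 hE starE E0 hB).
rewrite ge0_integralD//; [|exact: measurable_funTS..].
apply: leeD.
  apply: le_trans (slab_avg_integral2 T01).
  by apply: ge0_subset_integral => //; exact: measurableT.
rewrite ge0_integralZl_EFin//; last exact: measurable_funTS.
apply: (@le_trans _ _ ((2 * N)%:E * (e / (2 * N + 1))%:E)%E).
  apply: lee_wpmul2l; first by rewrite lee_fin.
  apply: (le_trans _ (hdel T T01' Td)).
  by apply: ge0_subset_integral => //; exact: measurableT.
rewrite -EFinM lee_fin mulrA ler_pdivrMr ?ltr_wpDl//; nra.
Qed.

(** Neither the constant [avg 0 c] nor the bound of [truncated_poincare] depends on the truncation
    level, so that monotone convergence removes the truncation. Only the integrability of v enters;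
    finiteness of the left-hand side is part of the conclusion when the gradient is square
    integrable. *)
Theorem poincare : exists cst : R,
  (\int[mu]_(x in E) ((v x - cst) ^+ 2)%:E <= (2 * M * (h + d) ^+ 2)%:E *
   (\int[mu]_(w in E) (g0 w ^+ 2)%:E + \int[mu]_(w in E) (g1 w ^+ 2)%:E))%E.
Proof.
exists (avg 0 c); set K := (X in (_ <= X)%E).
have HK (n : nat) : (\int[mu]_(x in E) ((Num.min `|v x - avg 0 c| n%:R) ^+ 2)%:E <= K)%E.
  apply: (le_trans (truncated_poincare (ler0n _ n))).
  apply: (le_trans (lee_wpmul2l _ grad_bound_integral2)); first by rewrite lee_fin.
  by rewrite muleA -EFinM mulrCA mulrA.
have mmin n : measurable_fun E (fun x => ((Num.min `|v x - avg 0 c| n%:R) ^+ 2)%:E).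
  apply/measurable_EFinP; apply: measurable_funX; apply: measurable_minr; last exact: measurable_cst.
  apply: measurableT_comp => //; apply: measurable_funB; last exact: measurable_cst.
  exact: measurable_funTS.
have nd x : E x -> nondecreasing_seq (fun n => ((Num.min `|v x - avg 0 c| n%:R) ^+ 2)%:E).
  move=> _ m n mn; rewrite lee_fin; apply: lerXn2r; rewrite ?nnegrE ?le_min ?normr_ge0 ?ler0n//.
  by rewrite !ge_min lexx /= ler_nat mn orbT.
have g0n n x : E x -> (0 <= ((Num.min `|v x - avg 0 c| n%:R) ^+ 2)%:E)%E.
  by move=> _; rewrite lee_fin sqr_ge0.
have := @cvg_monotone_convergence _ _ _ mu _ mE _ mmin g0n nd.
have -> : (\int[mu]_(x in E) limn (fun n => ((Num.min `|v x - avg 0 c| n%:R) ^+ 2)%:E) =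
          \int[mu]_(x in E) ((v x - avg 0 c) ^+ 2)%:E)%E.
  apply: eq_integral => x _; apply: cvg_lim => //.
  apply: (cvg_near_cst _); exists (Num.truncn `|v x - avg 0 c|).+1 => // n /= Hn.
  rewrite min_l; first by rewrite real_normK ?num_real.
  by rewrite (le_trans (ltW (truncnS_gt _)))// ler_nat.
move=> cv; rewrite -(cvg_lim _ cv)//.
apply: lime_le; first by apply/cvg_ex; eexists; exact: cv.
by exists 0%N => // n _; exact: HK.
Qed.

End PoincareInequality.

(** * The Bramble-Hilbert lemma *)

Section WeakGradients.
Variable R : realType.
Local Notation pt := (R * R)%type.
Local Notation mpt := (measurableTypeR R * measurableTypeR R)%type.
Local Notation mu := (leb2 R).
Local Notation leb := (@lebesgue_measure R).

Lemma continuous_bounded_ball (f : R -> R) (a r : R) : continuous f ->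
  exists2 C : R, 0 < C & forall y, `|y - a| <= r -> `|f y| <= C.
Proof.
move=> cf.
have cf' : {within `[a - r, a + r], continuous f} by exact: continuous_subspaceT.
have := continuous_compact cf' (@segment_compact R _ _).
move=> /compact_bounded[M [_ HM]]; exists (`|M| + 1); first by rewrite ltr_wpDl.
move=> y yr; apply: HM; first by rewrite ltr_pwDr// ler_norm.
by exists y => //=; rewrite in_itv/= -ler_distlC distrC.
Qed.

Lemma continuous_bounded_supp (f : R -> R) (a r : R) : continuous f ->
  (forall y, r < `|y - a| -> f y = 0) ->
  exists2 C : R, 0 < C & forall y, `|f y| <= C.
Proof.
move=> cf f0; have [C C0 HC] := continuous_bounded_ball a r cf; exists C => // y.
by have [/HC//|/f0 ->] := leP `|y - a| r; rewrite normr0 ltW.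
Qed.

Lemma derive1_supp (f : R -> R) (a r : R) : (forall y, r <= `|y - a| -> f y = 0) ->
  forall y, r < `|y - a| -> derive1 f y = 0.
Proof.
move=> f0; apply: (@derive1_zero_on R [set y | r < `|y - a|]).
  rewrite (_ : [set _ | _] = (fun y => `|y - a|) @^-1` [set z | r < z])//.
  apply: open_comp; last exact: open_gt.
  move=> y _; apply: cvg_norm; apply: cvgB; [exact: cvg_id|exact: cvg_cst].
by move=> y /= ry; apply: f0; exact: ltW.
Qed.

Lemma derive1_integral0 (F : R -> R) (a r k : R) : 0 < r -> smooth1 F ->
  (forall y, r <= `|y - a| -> F y = 0) ->
  (\int[leb]_x (derive1 F x * k)%:E = 0)%E.
Proof.
move=> r0 sF F0.
transitivity (\int[leb]_(x in `[(a - r)%R, (a + r)%R]) (derive1 F x * k)%:E)%E.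
  rewrite [RHS]integral_mkcond; apply: eq_integral => x _; rewrite patchE.
  case: ifPn => // /negP; rewrite inE /= in_itv/= -ler_distlC distrC => /negP.
  by rewrite -ltNge => /(derive1_supp F0) ->; rewrite mul0r.
have FTC := @continuous_FTC2_cc R (fun x => derive1 F x * k) (fun x => F x * k) (a - r) (a + r).
apply: (etrans (FTC _ _ _)).
- lra.
- move=> x _; have H := is_deriveM (smooth1_is_derive x sF) (is_derive_cst k x (1 : R)).
  by apply: (is_derive_eq H); rewrite /GRing.scale/= mulr0 add0r mulrC.
- by move=> x _; apply: cvgM; [exact: (smooth1_continuous (smooth1_derive sF))|exact: cvg_cst].
rewrite !F0 ?mul0r ?subrr//.
  by rewrite addrAC subrr add0r normrN ger0_norm// ltW.
by rewrite addrAC subrr add0r ger0_norm// ltW.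
Qed.

Lemma measurable_prod2 (f g : R -> R) : continuous f -> continuous g ->
  measurable_fun setT (fun x : mpt => f x.1 * g x.2).
Proof.
move=> cf cg; apply: measurable_funM.
- exact: (measurableT_comp (continuous_measurable_fun cf) measurable_fst).
- exact: (measurableT_comp (continuous_measurable_fun cg) measurable_snd).
Qed.

Lemma bounded_supp_integrable (f : mpt -> R) (C r : R) (a : pt) : measurable_fun setT f ->
  0 < r -> (forall x, `|f x| <= C) -> (forall x, ~ box a r x -> f x = 0) ->
  mu.-integrable setT (EFin \o f).
Proof.
move=> mf r0 fC f0.
apply/integrableP; split; first exact/measurable_EFinP.
have C0 : 0 <= C by exact: le_trans (normr_ge0 _) (fC 0).
apply: (@le_lt_trans _ _ ((C * (2 * r) ^+ 2)%:E)); last exact: ltry.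
apply: (@box_integral_le _ (fun x => `|f x|) C r a) => //.
- exact: measurableT_comp.
- by move=> x; rewrite normr_ge0 fC.
- by move=> x /f0 ->; rewrite normr0.
Qed.

Lemma prod_supp_integrable (f g : R -> R) (a : pt) (r : R) : 0 < r -> continuous f -> continuous g ->
  (forall y, r < `|y - a.1| -> f y = 0) -> (forall y, r < `|y - a.2| -> g y = 0) ->
  mu.-integrable setT (fun x => (f x.1 * g x.2)%:E).
Proof.
move=> r0 cf cg f0 g0.
have [C C0 fC] := continuous_bounded_supp cf f0.
have [D D0 gD] := continuous_bounded_supp cg g0.
apply: (@bounded_supp_integrable _ (C * D) (2 * r) a).
- exact: measurable_prod2.
- by rewrite mulr_gt0.
- by move=> x; exact: normM_le.
move=> x xb; have [x1|/f0 ->] := leP `|x.1 - a.1| r; last by rewrite mul0r.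
have [x2|/g0 ->] := leP `|x.2 - a.2| r; last by rewrite mulr0.
exfalso; apply: xb; rewrite /box /= -!ltr_distlC ![ `|a.1 - _|]distrC ![ `|a.2 - _|]distrC.
by split; (apply: le_lt_trans; [eassumption|]); rewrite ltr_pMl// ltr1n.
Qed.

Lemma restrict_Rintegral (E : set mpt) (f : mpt -> R) : (forall x, ~ E x -> f x = 0) ->
  \int[mu]_(x in E) f x = \int[mu]_x f x.
Proof.
move=> f0; rewrite /Rintegral [in LHS]integral_mkcond; congr fine; apply: eq_integral => x _.
by rewrite patchE; case: ifPn => // /negP; rewrite inE => /f0 ->.
Qed.

Lemma prod_derive_integral0 (F H : R -> R) (a : pt) (r : R) : 0 < r -> smooth1 F -> smooth1 H ->
  (forall y, r <= `|y - a.1| -> F y = 0) -> (forall y, r <= `|y - a.2| -> H y = 0) ->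
  (\int[mu]_x (derive1 F x.1 * H x.2)%:E = 0)%E /\
  (\int[mu]_x (F x.1 * derive1 H x.2)%:E = 0)%E.
Proof.
move=> r0 sF sH F0 H0.
have H0' y : r < `|y - a.2| -> H y = 0 by move=> ?; apply: H0; exact: ltW.
have F0' y : r < `|y - a.1| -> F y = 0 by move=> ?; apply: F0; exact: ltW.
have cF := smooth1_continuous sF; have cH := smooth1_continuous sH.
have cF' := smooth1_continuous (smooth1_derive sF).
have cH' := smooth1_continuous (smooth1_derive sH).
have iF : (leb \x leb)%E.-integrable setT (fun x => (derive1 F x.1 * H x.2)%:E).
  by apply: (@prod_supp_integrable _ _ a r) => //; exact: derive1_supp.
have iH : (leb \x leb)%E.-integrable setT (fun x => (F x.1 * derive1 H x.2)%:E).
  by apply: (@prod_supp_integrable _ _ a r) => //; exact: derive1_supp.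
split.
  rewrite -[LHS](integral21_prod_meas1 iF) /fubini_G /=.
  by under eq_integral do rewrite (derive1_integral0 _ r0 sF F0); rewrite integral0.
rewrite -[LHS](integral12_prod_meas1 iH) /fubini_F /=.
apply: integral0_eq => x _; rewrite -[RHS](derive1_integral0 (F x) r0 sH H0).
by apply: eq_integral => y _; rewrite mulrC.
Qed.

Lemma boxed_bounded (E : set pt) (f1 f2 : R -> R) : smooth1 f1 -> smooth1 f2 -> boxed E f1 f2 ->
  exists2 C : R, 0 < C & forall x : pt, [/\ `|f1 x.1 * f2 x.2| <= C,
    `|derive1 f1 x.1 * f2 x.2| <= C & `|f1 x.1 * derive1 f2 x.2| <= C].
Proof.
move=> s1 s2 [a [r [r0 _ f10 f20]]].
have [A A0 hA] := continuous_bounded_supp (smooth1_continuous s1) (fun y ry => f10 y (ltW ry)).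
have [B B0 hB] := continuous_bounded_supp (smooth1_continuous s2) (fun y ry => f20 y (ltW ry)).
have [A' A'0 hA'] := continuous_bounded_supp (smooth1_continuous (smooth1_derive s1)) (derive1_supp f10).
have [B' B'0 hB'] := continuous_bounded_supp (smooth1_continuous (smooth1_derive s2)) (derive1_supp f20).
have AB : 0 <= A * B by rewrite mulr_ge0// ltW.
have A'B : 0 <= A' * B by rewrite mulr_ge0// ltW.
have AB' : 0 <= A * B' by rewrite mulr_ge0// ltW.
exists (A * B + A' * B + A * B' + 1); first by rewrite ltr_wpDl// !addr_ge0.
move=> x; split.
- by apply: (le_trans (normM_le (hA _) (hB _))); lra.
- by apply: (le_trans (normM_le (hA' _) (hB _))); lra.
- by apply: (le_trans (normM_le (hA _) (hB' _))); lra.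
Qed.

Lemma wgradB (E : set mpt) (v g0 g1 w k0 k1 : mpt -> R) : measurable E ->
  mu.-integrable E (EFin \o v) -> mu.-integrable E (EFin \o g0) -> mu.-integrable E (EFin \o g1) ->
  mu.-integrable E (EFin \o w) -> mu.-integrable E (EFin \o k0) -> mu.-integrable E (EFin \o k1) ->
  wgrad E v g0 g1 -> wgrad E w k0 k1 ->
  wgrad E (fun x => v x - w x) (fun x => g0 x - k0 x) (fun x => g1 x - k1 x).
Proof.
move=> mE iv ig0 ig1 iw ik0 ik1 wv ww f1 f2 s1 s2 bf.
have [C C0 hC] := boxed_bounded s1 s2 bf.
have cf1 := smooth1_continuous s1; have cf2 := smooth1_continuous s2.
have cf1' := smooth1_continuous (smooth1_derive s1).
have cf2' := smooth1_continuous (smooth1_derive s2).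
have RB (u u' : mpt -> R) (p q : R -> R) : continuous p -> continuous q ->
    (forall x : mpt, `|p x.1 * q x.2| <= C) ->
    mu.-integrable E (EFin \o u) -> mu.-integrable E (EFin \o u') ->
    \int[mu]_(x in E) ((u x - u' x) * (p x.1 * q x.2)) =
    \int[mu]_(x in E) (u x * (p x.1 * q x.2)) - \int[mu]_(x in E) (u' x * (p x.1 * q x.2)).
  move=> cp cq pq iu iu'; have mpq := measurable_funTS (measurable_prod2 cp cq) (D := E).
  have i1 := integrableM_bounded mE iu mpq (fun x _ => pq x).
  have i2 := integrableM_bounded mE iu' mpq (fun x _ => pq x).
  rewrite -(RintegralB mE i1 i2).
  by apply: eq_Rintegral => x _; rewrite mulrBl.
have hC0 x : `|f1 x.1 * f2 x.2| <= C by have [] := hC x.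
have hC1 x : `|derive1 f1 x.1 * f2 x.2| <= C by have [] := hC x.
have hC2 x : `|f1 x.1 * derive1 f2 x.2| <= C by have [] := hC x.
have [v1 v2] := wv f1 f2 s1 s2 bf; have [w1 w2] := ww f1 f2 s1 s2 bf.
split.
  by rewrite (RB v w (derive1 f1) f2)// (RB g0 k0 f1 f2)// v1 w1 opprB opprK addrC.
by rewrite (RB v w f1 (derive1 f2))// (RB g1 k1 f1 f2)// v2 w2 opprB opprK addrC.
Qed.

(** Multiplied by the test function, p(x1) q(x2) becomes the product of p f1 and q f2, which is
    smooth with support in the same square. Its partial derivatives have integral 0, and the product
    rule splits them into the two sides of the claim. *)
Lemma wgrad_prod (E : set mpt) (p q : R -> R) : measurable E -> smooth1 p -> smooth1 q ->
  wgrad E (fun x => p x.1 * q x.2) (fun x => derive1 p x.1 * q x.2)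
    (fun x => p x.1 * derive1 q x.2).
Proof.
move=> mE sp sq f1 f2 s1 s2 [a [r [r0 aE f10 f20]]].
have outE (A B : mpt -> R) (u w : R -> R) (x : mpt) : (forall y, r < `|y - a.1| -> u y = 0) ->
    (forall y, r < `|y - a.2| -> w y = 0) -> ~ E x -> A x * (u x.1 * w x.2) = 0.
  move=> u0 w0 nE; have [x1|/u0 ->] := leP `|x.1 - a.1| r; last by rewrite mul0r mulr0.
  have [x2|/w0 ->] := leP `|x.2 - a.2| r; last by rewrite !mulr0.
  by exfalso; apply: nE; exact: aE.
have f10' y : r < `|y - a.1| -> f1 y = 0 by move=> ?; apply: f10; exact: ltW.
have f20' y : r < `|y - a.2| -> f2 y = 0 by move=> ?; apply: f20; exact: ltW.
have d10 := derive1_supp f10; have d20 := derive1_supp f20.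
have sF : smooth1 (fun y => p y * f1 y) by exact: smooth1_mul.
have sH : smooth1 (fun y => q y * f2 y) by exact: smooth1_mul.
have F0 y : r <= `|y - a.1| -> p y * f1 y = 0 by move=> /f10 ->; rewrite mulr0.
have H0 y : r <= `|y - a.2| -> q y * f2 y = 0 by move=> /f20 ->; rewrite mulr0.
have dM (g f : R -> R) y : smooth1 g -> smooth1 f ->
    derive1 (fun y => g y * f y) y = derive1 g y * f y + g y * derive1 f y.
  move=> sg sf; have H := is_deriveM (smooth1_is_derive y sg) (smooth1_is_derive y sf).
  by rewrite derive1E; apply: (etrans (@derive_val _ _ _ _ _ _ _ H)); rewrite /GRing.scale/= addrC mulrC.
have [I1 I2] := prod_derive_integral0 r0 sF sH F0 H0.
have cts f : smooth1 f -> continuous f := @smooth1_continuous R f.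
have ipr (b1 b2 : R -> R) (u w : R -> R) : continuous b1 -> continuous b2 -> continuous u -> continuous w ->
    (forall y, r < `|y - a.1| -> u y = 0) -> (forall y, r < `|y - a.2| -> w y = 0) ->
    mu.-integrable setT (fun x => (b1 x.1 * b2 x.2 * (u x.1 * w x.2))%:E).
  move=> cb1 cb2 cu cw u0 w0.
  have : mu.-integrable setT (fun x => ((b1 x.1 * u x.1) * (b2 x.2 * w x.2))%:E).
    apply: (@prod_supp_integrable (fun y => b1 y * u y) (fun y => b2 y * w y) a r) => //.
    - by move=> y; apply: cvgM; [exact: cb1|exact: cu].
    - by move=> y; apply: cvgM; [exact: cb2|exact: cw].
    - by move=> y /u0 ->; rewrite mulr0.
    - by move=> y /w0 ->; rewrite mulr0.
  by apply: eq_integrable => // x _; congr EFin; rewrite mulrACA.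
split.
- rewrite (@restrict_Rintegral E (fun x => p x.1 * q x.2 * (derive1 f1 x.1 * f2 x.2))); last first.
    by move=> x; exact: (outE (fun x => p x.1 * q x.2) (fun=> 0)).
  rewrite (@restrict_Rintegral E (fun x => derive1 p x.1 * q x.2 * (f1 x.1 * f2 x.2))); last first.
    by move=> x; exact: (outE (fun x => derive1 p x.1 * q x.2) (fun=> 0)).
  apply/eqP; rewrite -addr_eq0 -RintegralD//; last 2 first.
  + by apply: (ipr p q (derive1 f1) f2) => //; apply: cts => //; exact: smooth1_derive.
  + by apply: (ipr (derive1 p) q f1 f2) => //; apply: cts => //; exact: smooth1_derive.
  apply/eqP; rewrite /Rintegral -[RHS]/(fine 0%E) -I1; congr fine; apply: eq_integral => x _.
  by congr EFin; rewrite (dM p f1)//; move: (derive1 p _) (derive1 f1 _) => p' f'; ring.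
- rewrite (@restrict_Rintegral E (fun x => p x.1 * q x.2 * (f1 x.1 * derive1 f2 x.2))); last first.
    by move=> x; exact: (outE (fun x => p x.1 * q x.2) (fun=> 0)).
  rewrite (@restrict_Rintegral E (fun x => p x.1 * derive1 q x.2 * (f1 x.1 * f2 x.2))); last first.
    by move=> x; exact: (outE (fun x => p x.1 * derive1 q x.2) (fun=> 0)).
  apply/eqP; rewrite -addr_eq0 -RintegralD//; last 2 first.
  + by apply: (ipr p q f1 (derive1 f2)) => //; apply: cts => //; exact: smooth1_derive.
  + by apply: (ipr p (derive1 q) f1 f2) => //; apply: cts => //; exact: smooth1_derive.
  apply/eqP; rewrite /Rintegral -[RHS]/(fine 0%E) -I2; congr fine; apply: eq_integral => x _.
  by congr EFin; rewrite (dM q f2)//; move: (derive1 q _) (derive1 f2 _) => p' f'; ring.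
Qed.

End WeakGradients.

(** * Polynomials of two variables and their derivatives *)

Section Polynomials.
Variable R : realType.
Local Notation pt := (R * R)%type.
Local Notation mpt := (measurableTypeR R * measurableTypeR R)%type.
Local Notation mu := (leb2 R).

Lemma poly_lt_add d (f g : pt -> R) : poly_lt d f -> poly_lt d g ->
  poly_lt d (fun x => f x + g x).
Proof.
move=> [c fE] [c' gE]; exists (fun i j => c i j + c' i j) => x; rewrite fE gE -big_split/=.
by apply: eq_bigr => i _; rewrite -big_split/=; apply: eq_bigr => j _; rewrite -!mulrDl.
Qed.

Lemma poly_lt_scale d (a : R) (f : pt -> R) : poly_lt d f -> poly_lt d (fun x => a * f x).
Proof.
move=> [c fE]; exists (fun i j => a * c i j) => x; rewrite fE mulr_sumr.
by apply: eq_bigr => i _; rewrite mulr_sumr; apply: eq_bigr => j _; rewrite !mulrA.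
Qed.

Lemma poly_lt0 d : poly_lt d (fun=> 0 : R).
Proof.
exists (fun _ _ => 0) => x; rewrite big1// => i _; rewrite big1// => j _.
by rewrite !mul0r.
Qed.

Lemma poly_lt_sum d n (f : 'I_n -> pt -> R) : (forall i, poly_lt d (f i)) ->
  poly_lt d (fun x => \sum_(i < n) f i x).
Proof.
elim: n f => [|n IH] f pf.
  by under eq_fun do rewrite big_ord0; exact: poly_lt0.
under eq_fun do rewrite big_ord_recr/=.
by apply: poly_lt_add => //; apply: IH => i.
Qed.

Lemma poly_lt_monomial d (i j : nat) : (i + j < d)%N ->
  poly_lt d (fun x : pt => x.1 ^+ i * x.2 ^+ j).
Proof.
move=> ijd; exists (fun i' j' => ((i' == i) && (j' == j))%:R) => x.
have id_ : (i < d)%N by exact: leq_ltn_trans (leq_addr j i) ijd.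
have jd : (j < d - i)%N by rewrite ltn_subRL.
rewrite (bigD1 (Ordinal id_))//= (bigD1 (Ordinal jd))//= !eqxx mul1r.
rewrite big1 ?addr0; last first.
  by move=> j' /negbTE; rewrite -val_eqE/= => ->; rewrite !mul0r.
rewrite big1 ?addr0// => i' /negbTE; rewrite -val_eqE/= => -> /=.
by rewrite big1// => j' _; rewrite !mul0r.
Qed.

Lemma poly_lt_le d e (f : pt -> R) : (d <= e)%N -> poly_lt d f -> poly_lt e f.
Proof.
move=> de [c fE]; rewrite (_ : f = fun x => \sum_(i < d) \sum_(j < d - i) c i j * (x.1 ^+ i * x.2 ^+ j)).
  apply: poly_lt_sum => i; apply: poly_lt_sum => j; apply: poly_lt_scale.
  apply: poly_lt_monomial; apply: leq_trans de.
  by have := ltn_ord j; rewrite ltn_subRL.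
apply/funext => x; rewrite fE; apply: eq_bigr => i _; apply: eq_bigr => j _.
by rewrite mulrA.
Qed.

Lemma poly_lt_cst d (a : R) : poly_lt d.+1 (fun _ : pt => a).
Proof.
have -> : (fun _ : pt => a) = fun x : pt => a * (x.1 ^+ 0 * x.2 ^+ 0).
  by apply/funext => x; rewrite !expr0 !mulr1.
exact/poly_lt_scale/poly_lt_monomial.
Qed.

(* the a-th derivative of t^m / m! *)
Definition dpow (m a : nat) (t : R) : R :=
  if (a <= m)%N then t ^+ (m - a) / ((m - a)`!)%:R else 0.

Lemma smooth1_dpow m a : smooth1 (dpow m a).
Proof.
rewrite /dpow; case: (leqP a m) => _; last exact: smooth1_cst.
by apply: smooth1_mul; [exact: smooth1_pow|exact: smooth1_cst].
Qed.

Lemma is_derive_dpow m a (t : R) : is_derive (t : R) (1 : R) (dpow m a) (dpow m a.+1 t).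
Proof.
rewrite /dpow; have [am|ma] := leqP a m; last first.
  by rewrite ltnNge (ltnW ma) /=; exact: is_derive_cst.
move: am; rewrite leq_eqVlt => /predU1P[->|am].
  rewrite ltnn subnn.
  have -> : (fun t : R => t ^+ 0 / (0`!)%:R) = cst 1 by apply/funext => x; rewrite expr0 fact0 divr1.
  exact: is_derive_cst.
rewrite am; have -> : (m - a)%N = (m - a.+1).+1 by rewrite subnS prednK// subn_gt0.
set n := (m - a.+1)%N.
have H := is_deriveM (is_deriveX n.+1 (is_derive_id t (1 : R))) (is_derive_cst (n.+1`!%:R^-1 : R) t (1 : R)).
rewrite exprfctE in H.
apply: (is_derive_eq H); rewrite /GRing.scale/= mulr0 add0r mulr1.
have f0 : (n`!)%:R != 0 :> R by rewrite pnatr_eq0 -lt0n fact_gt0.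
have n0 : n.+1%:R != 0 :> R by rewrite pnatr_eq0.
rewrite factS natrM; move: f0 n0; move: (_%:R) (_%:R) (_ ^+ _) => p q z p0 q0.
by field; rewrite p0 q0.
Qed.

Lemma derive1_dpow m a : derive1 (dpow m a) = dpow m a.+1.
Proof.
by apply/funext => t; rewrite derive1E; apply: (@derive_val _ _ _ _ _ _ _ (is_derive_dpow m a t)).
Qed.

(* the (a,b)-th derivative of sum_(m + n = r) c m n x^m y^n / (m! n!) *)
Definition dhom (r : nat) (c : nat -> nat -> R) (a b : nat) (x : pt) : R :=
  \sum_(m < r.+1) c m (r - m)%N * dpow m a x.1 * dpow (r - m) b x.2.

(** Only the term m = a survives: if m < a the factor in the first variable is differentiated too
    often, and if m > a the factor in the second one is. *)
Lemma dhom_top r c a b x : (a + b = r)%N -> dhom r c a b x = c a b.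
Proof.
move=> abr; have ar : (a < r.+1)%N by rewrite ltnS -abr leq_addr.
have rab : (r - a)%N = b by rewrite -abr addKn.
rewrite /dhom (bigD1 (Ordinal ar))//= rab /dpow !leqnn !subnn !expr0 fact0 divr1 !mulr1.
rewrite big1 ?addr0// => m; rewrite -val_eqE/= => ma.
have [am|_] := leqP a m; last by rewrite mulr0 mul0r.
have -> : (b <= r - m)%N = false by have := ltn_ord m; lia.
by rewrite mulr0.
Qed.

Lemma poly_lt_dhom r c : poly_lt r.+1 (dhom r c 0 0).
Proof.
apply: poly_lt_sum => m; rewrite /dpow !leq0n !subn0.
rewrite (_ : (fun _ => _) = fun x : pt => (c m (r - m)%N / (m`!)%:R / ((r - m)`!)%:R) *
   (x.1 ^+ m * x.2 ^+ (r - m))); last by apply/funext => x; ring.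
by apply/poly_lt_scale/poly_lt_monomial; rewrite subnKC// -ltnS.
Qed.

End Polynomials.

Section BrambleHilbert.
Variable R : realType.
Local Notation pt := (R * R)%type.
Local Notation mpt := (measurableTypeR R * measurableTypeR R)%type.
Local Notation mu := (leb2 R).

Variables (E : set mpt) (c : pt) (d h B : R).
Hypothesis mE : measurable E.
Hypothesis d0 : 0 < d.
Hypothesis hE : forall x y : pt, E x -> E y -> `|x.1 - y.1| <= h /\ `|x.2 - y.2| <= h.
Hypothesis starE : forall (t : R) (x z : pt), 0 <= t < 1 -> E x ->
  `|z.1 - c.1| <= d -> `|z.2 - c.2| <= d ->
  E (t * x.1 + (1 - t) * z.1, t * x.2 + (1 - t) * z.2).
Hypothesis E0 : E !=set0.
Hypothesis hB : forall y : R, `|moll y| <= B /\ `|derive1 (@moll R) y| <= B.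

Local Notation CP := (2 * kernel_mass d h B * (h + d) ^+ 2).

(** [G a b] stands for the derivative of [G 0 0], a times in the first and b times in the second
    variable. First-order relations between neighbours are what the Poincare inequality consumes at
    each order. *)
Definition wfamily (r : nat) (G : nat -> nat -> mpt -> R) : Prop :=
  (forall a b, (a + b <= r)%N ->
     measurable_fun setT (G a b) /\ mu.-integrable E (EFin \o G a b)) /\
  (forall a b, (a + b < r)%N -> wgrad E (G a b) (G a.+1 b) (G a b.+1)).

Lemma CP_ge0 : 0 <= CP.
Proof.
rewrite /kernel_mass; apply: mulr_ge0; last exact: sqr_ge0.
apply: mulr_ge0 => //; apply: mulr_ge0; first by apply: mulr_ge0 => //; exact: sqr_ge0.
by apply: addr_ge0 => //; exact: sqr_ge0.
Qed.

Lemma continuous_prod_integrable (p q : R -> R) : continuous p -> continuous q ->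
  mu.-integrable E (fun x : mpt => (p x.1 * q x.2)%:E).
Proof.
move=> cp cq.
have [x1 hx] : exists x1 : pt, E x1 by have [x] := E0; exists x.
have [C C0 hC] := continuous_bounded_ball x1.1 h cp.
have [D D0 hD] := continuous_bounded_ball x1.2 h cq.
have i1 : mu.-integrable E (EFin \o cst (1 : R)).
  apply/integrableP; split; first by apply/measurable_EFinP; exact: measurable_cst.
  under eq_integral do rewrite /= normr1.
  by rewrite integral_cst//= mul1e; exact: (muE_lty mE d0 hE starE).
have := @integrableM_bounded R E (cst 1) (fun x => p x.1 * q x.2) (C * D) mE i1.
move=> /(_ (measurable_funTS (measurable_prod2 cp cq))) H.
have {}H : mu.-integrable E (fun x : mpt => (cst 1 x * (p x.1 * q x.2))%:E).
  apply: H => x Ex; have [h1 h2] := hE Ex hx.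
  by apply: normM_le; [exact: hC|exact: hD].
by apply: eq_integrable H => // x _; rewrite mul1r.
Qed.

Lemma eq_wgrad (v g0 g1 v' g0' g1' : mpt -> R) : v =1 v' -> g0 =1 g0' -> g1 =1 g1' ->
  wgrad E v g0 g1 -> wgrad E v' g0' g1'.
Proof. by move=> /funext -> /funext -> /funext ->. Qed.

Lemma integrable_dpow (k : R) m n a b :
  mu.-integrable E (EFin \o (fun x : mpt => k * dpow m a x.1 * dpow n b x.2)).
Proof.
apply: (@continuous_prod_integrable (fun y => k * dpow m a y)).
  by apply: smooth1_continuous; apply: smooth1_scale; exact: smooth1_dpow.
by apply: smooth1_continuous; exact: smooth1_dpow.
Qed.

Lemma integrable_subdpow n r (cc : nat -> nat -> R) (u : mpt -> R) a b :
  mu.-integrable E (EFin \o u) ->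
  mu.-integrable E (EFin \o (fun x : mpt =>
    u x - \sum_(m < n) cc m (r - m)%N * dpow m a x.1 * dpow (r - m) b x.2)).
Proof.
move=> iu; elim: n => [|n IH].
  by apply: eq_integrable iu => // x _ /=; rewrite big_ord0 subr0.
have := integrableB mE IH (integrable_dpow (cc n (r - n)%N) n (r - n) a b).
by apply: eq_integrable => // x _ /=; rewrite big_ord_recr/= opprD addrA.
Qed.

Lemma integrable_subdhom r (cc : nat -> nat -> R) (u : mpt -> R) a b :
  mu.-integrable E (EFin \o u) ->
  mu.-integrable E (EFin \o (fun x => u x - dhom r cc a b x)).
Proof. exact: integrable_subdpow. Qed.

(** The terms of [dhom] are subtracted one at a time, each being a product function covered by
    [wgrad_prod]. *)
Lemma wgrad_subdhom r (cc : nat -> nat -> R) (v g0 g1 : mpt -> R) a b :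
  mu.-integrable E (EFin \o v) -> mu.-integrable E (EFin \o g0) ->
  mu.-integrable E (EFin \o g1) -> wgrad E v g0 g1 ->
  wgrad E (fun x => v x - dhom r cc a b x) (fun x => g0 x - dhom r cc a.+1 b x)
    (fun x => g1 x - dhom r cc a b.+1 x).
Proof.
move=> iv ig0 ig1 wv; rewrite /dhom.
move: (r.+1) => n; elim: n => [|n IH].
  by apply: eq_wgrad wv => x; rewrite big_ord0 subr0.
pose p a' (y : R) := cc n (r - n)%N * dpow n a' y.
have sp : smooth1 (p a) by apply: smooth1_scale; exact: smooth1_dpow.
have sq : smooth1 (@dpow R (r - n) b) by exact: smooth1_dpow.
have dp : derive1 (p a) = p a.+1.
  apply/funext => y; have H := is_deriveM (is_derive_cst (cc n (r - n)%N) y (1 : R)) (is_derive_dpow n a y).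
  rewrite derive1E; apply: (etrans (@derive_val _ _ _ _ _ _ _ H)).
  by rewrite /GRing.scale/= mulr0 addr0.
have iS (u : mpt -> R) a' b' : mu.-integrable E (EFin \o u) -> _ := @integrable_subdpow n r cc u a' b'.
have iT a' b' := integrable_dpow (cc n (r - n)%N) n (r - n) a' b'.
have := wgradB mE (iS v a b iv) (iS g0 a.+1 b ig0) (iS g1 a b.+1 ig1)
  (iT a b) _ _ IH (wgrad_prod mE sp sq).
rewrite dp derive1_dpow => /(_ (iT a.+1 b) (iT a b.+1)).
by apply: eq_wgrad => x; rewrite big_ord_recr/= opprD addrA.
Qed.

Lemma measurable_dhom r (cc : nat -> nat -> R) a b : measurable_fun setT (dhom r cc a b : mpt -> R).
Proof.
apply: measurable_sum => m; apply: (@measurable_prod2 R (fun y => cc m (r - m)%N * dpow m a y)).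
  by apply: smooth1_continuous; apply: smooth1_scale; exact: smooth1_dpow.
by apply: smooth1_continuous; exact: smooth1_dpow.
Qed.

(** The factor 2 in front of CP counts the two components of the gradient, each of which contributes
    A. *)
Lemma poincare_top r G (A : R) : wfamily r.+1 G ->
  (forall a b, (a + b)%N = r.+1 -> (\int[mu]_(x in E) ((G a b x) ^+ 2)%:E <= A%:E)%E) ->
  forall a b, (a + b)%N = r -> exists cst : R,
    (\int[mu]_(x in E) ((G a b x - cst) ^+ 2)%:E <= (2 * CP * A)%:E)%E.
Proof.
move=> [iG wG] topG a b abr.
have abr0 : (a + b <= r.+1)%N by rewrite abr.
have abr1 : (a.+1 + b <= r.+1)%N by rewrite addSn abr.
have abr2 : (a + b.+1 <= r.+1)%N by rewrite addnS abr.
have [m0 i0] := iG _ _ abr0; have [m1 i1] := iG _ _ abr1; have [m2 i2] := iG _ _ abr2.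
have wg : wgrad E (G a b) (G a.+1 b) (G a b.+1) by apply: wG; rewrite abr.
have [k hk] := poincare mE d0 hE starE E0 hB m0 m1 m2 i0 i1 i2 wg.
exists k; apply: (le_trans hk).
apply: (@le_trans _ _ (CP%:E * (A%:E + A%:E))%E).
  apply: lee_wpmul2l; first by rewrite lee_fin CP_ge0.
  by apply: leeD; apply: topG; rewrite ?addSn ?addnS abr.
by rewrite -EFinD -EFinM lee_fin le_eqVlt; apply/orP; left; apply/eqP; ring.
Qed.

(* Subtracting the homogeneous polynomial whose derivatives of order r + 1 are the
   given constants makes the derivatives of order r close to constants, by the
   Poincare inequality. *)
Theorem bramble_hilbert r G (A : R) : 0 <= A -> wfamily r G ->
  (forall a b, (a + b)%N = r -> exists cst : R,
     (\int[mu]_(x in E) ((G a b x - cst) ^+ 2)%:E <= A%:E)%E) ->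
  exists q, poly_lt r.+1 q /\
    (\int[mu]_(x in E) ((G 0%N 0%N x - q x) ^+ 2)%:E <= ((2 * CP) ^+ r * A)%:E)%E.
Proof.
elim: r G A => [|r IH] G A A0 [iG wG] topG.
  have [k hk] := topG 0%N 0%N erefl.
  by exists (fun=> k); split; [exact: poly_lt_cst|rewrite expr0 mul1r].
have [cc hcc] : exists cc : nat -> nat -> R, forall a b, (a + b)%N = r.+1 ->
    (\int[mu]_(x in E) ((G a b x - cc a b) ^+ 2)%:E <= A%:E)%E.
  have H (ab : nat * nat) : exists k : R, (ab.1 + ab.2)%N = r.+1 ->
      (\int[mu]_(x in E) ((G ab.1 ab.2 x - k) ^+ 2)%:E <= A%:E)%E.
    have [/topG[k hk]|ne] := pselect ((ab.1 + ab.2)%N = r.+1); first by exists k.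
    by exists 0.
  have [f hf] := choice H.
  by exists (fun a b => f (a, b)) => a b; exact: (hf (a, b)).
pose G' a b (x : mpt) := G a b x - dhom r.+1 cc a b x.
have mG' a b : (a + b <= r.+1)%N -> measurable_fun setT (G' a b).
  by move=> /iG[mG _]; apply: measurable_funB => //; exact: measurable_dhom.
have W1 : wfamily r.+1 G'.
  split => a b abr; last first.
    apply: wgrad_subdhom; last exact: wG.
    - by have [] := iG a b (ltnW abr).
    - by have [] := iG a.+1 b abr.
    - by have [] := iG a b.+1; rewrite ?addnS.
  split; first exact: mG'.
  by apply: integrable_subdhom; have [] := iG a b abr.
have wf' : wfamily r G'.
  by split => a b abr; [apply: W1.1; exact: leqW|apply: W1.2; exact: ltnW].
have CPA0 : 0 <= 2 * CP * A by rewrite mulr_ge0// mulr_ge0// CP_ge0.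
have top a b : (a + b)%N = r.+1 -> (\int[mu]_(x in E) ((G' a b x) ^+ 2)%:E <= A%:E)%E.
  move=> ab; apply: le_trans (hcc a b ab); rewrite le_eqVlt; apply/orP; left; apply/eqP.
  by apply: eq_integral => x _; rewrite /G' dhom_top.
have [q [pq hq]] := IH G' _ CPA0 wf' (poincare_top W1 top).
exists (fun x => q x + dhom r.+1 cc 0 0 x); split.
  apply: poly_lt_add; first by apply: poly_lt_le pq.
  exact: poly_lt_dhom.
rewrite exprSr -mulrA; apply: (le_trans _ hq); rewrite le_eqVlt; apply/orP; left; apply/eqP.
by apply: eq_integral => x _; rewrite /G' opprD addrA addrAC.
Qed.

End BrambleHilbert.

(** * Sobolev norms on a cell *)

Section TestFunctions.
Variable R : realType.
Local Notation pt := (R * R)%type.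
Local Notation mpt := (measurableTypeR R * measurableTypeR R)%type.
Local Notation mu := (leb2 R).

Definition tens (f1 f2 : R -> R) (x : pt) : R := f1 x.1 * f2 x.2.

Lemma is_derive_tens (f1 f2 : R -> R) (x : pt) : smooth1 f1 -> smooth1 f2 ->
  is_derive x (axis R 0) (tens f1 f2) (derive1 f1 x.1 * f2 x.2) /\
  is_derive x (axis R 1) (tens f1 f2) (f1 x.1 * derive1 f2 x.2).
Proof.
move=> s1 s2.
have q1 : (fun h => h^-1 *: ((f1 \o shift x.1) (h *: (1 : R)) - f1 x.1)) @ (0:R)^' --> derive1 f1 x.1.
  by rewrite derive1E; have := @smooth1_derivable R f1 x.1 s1; exact.
have q2 : (fun h => h^-1 *: ((f2 \o shift x.2) (h *: (1 : R)) - f2 x.2)) @ (0:R)^' --> derive1 f2 x.2.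
  by rewrite derive1E; have := @smooth1_derivable R f2 x.2 s2; exact.
split.
  have H : (fun h => h^-1 *: ((tens f1 f2 \o shift x) (h *: axis R 0) - tens f1 f2 x)) @ (0:R)^' -->
      (derive1 f1 x.1 * f2 x.2).
    rewrite (_ : (fun h => _) = fun h => (h^-1 *: ((f1 \o shift x.1) (h *: (1 : R)) - f1 x.1)) * f2 x.2).
      by apply: cvgM => //; exact: cvg_cst.
    apply/funext => h; rewrite /tens /axis/= /GRing.scale/= mulr0 add0r.
    by rewrite -mulrA mulrBl.
  by apply: DeriveDef; [exact: cvgP H|exact: cvg_lim H].
have H : (fun h => h^-1 *: ((tens f1 f2 \o shift x) (h *: axis R 1) - tens f1 f2 x)) @ (0:R)^' -->
    (f1 x.1 * derive1 f2 x.2).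
  rewrite (_ : (fun h => _) = fun h => f1 x.1 * (h^-1 *: ((f2 \o shift x.2) (h *: (1 : R)) - f2 x.2))).
    by apply: cvgM => //; exact: cvg_cst.
  apply/funext => h; rewrite /tens /axis/= /GRing.scale/= mulr0 add0r.
  by rewrite -mulrBr mulrCA.
by apply: DeriveDef; [exact: cvgP H|exact: cvg_lim H].
Qed.

Lemma partial_tens (i : 'I_2) (f1 f2 : R -> R) : smooth1 f1 -> smooth1 f2 ->
  partial i (tens f1 f2) = if i == 0 then tens (derive1 f1) f2 else tens f1 (derive1 f2).
Proof.
move=> s1 s2; apply/funext => x; have [D0 D1] := is_derive_tens x s1 s2.
rewrite /partial; case: (unliftP 0 i) => [j ->|->].
  rewrite (_ : lift 0 j = 1) /=; first exact: (@derive_val _ _ _ _ _ _ _ D1).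
  by apply/val_inj; rewrite /= (ord1 j).
exact: (@derive_val _ _ _ _ _ _ _ D0).
Qed.

(** Only the multiplicities of the two directions matter, whatever their order in the list. *)
Lemma partials_tens (l : seq 'I_2) (f1 f2 : R -> R) : smooth1 f1 -> smooth1 f2 ->
  partials l (tens f1 f2) =
    tens (derive1n (count_mem 0 l) f1) (derive1n (count (predC1 0) l) f2).
Proof.
move=> s1 s2; elim: l => [|i l IH]; first by [].
rewrite /= -/(partials l _) IH partial_tens; [|exact: smooth1_derive1n..].
by case: (i == 0).
Qed.

Lemma multi_partial_tens (a b : nat) (f1 f2 : R -> R) : smooth1 f1 -> smooth1 f2 ->
  multi_partial a b (tens f1 f2) = tens (derive1n a f1) (derive1n b f2).
Proof.
move=> s1 s2; rewrite /multi_partial partials_tens// !count_cat !count_nseq/=.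
by rewrite !mul1n !mul0n addn0.
Qed.

Lemma continuous_tens (f1 f2 : R -> R) : continuous f1 -> continuous f2 -> continuous (tens f1 f2).
Proof.
move=> c1 c2 x; apply: cvgM.
- by apply: (@cvg_comp _ _ _ fst f1); [exact: cvg_fst|exact: c1].
- by apply: (@cvg_comp _ _ _ snd f2); [exact: cvg_snd|exact: c2].
Qed.

Lemma smooth_tens (f1 f2 : R -> R) : smooth1 f1 -> smooth1 f2 -> smooth (tens f1 f2).
Proof.
move=> s1 s2 l x; rewrite partials_tens//.
have s1' := smooth1_derive1n (count_mem 0 l) s1.
have s2' := smooth1_derive1n (count (predC1 0) l) s2.
split; first by apply: continuous_tens; exact: smooth1_continuous.
move=> i; have [D0 D1] := is_derive_tens x s1' s2'.
case: (unliftP 0 i) => [j ->|->]; last exact: (@ex_derive _ _ _ _ _ _ _ D0).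
rewrite (_ : lift 0 j = 1); first exact: (@ex_derive _ _ _ _ _ _ _ D1).
by apply/val_inj; rewrite /= (ord1 j).
Qed.

Lemma test_function_tens (D : set pt) (f1 f2 : R -> R) (a : pt) (r : R) :
  smooth1 f1 -> smooth1 f2 ->
  (forall z : pt, `|z.1 - a.1| <= r -> `|z.2 - a.2| <= r -> D z) ->
  (forall y, r < `|y - a.1| -> f1 y = 0) -> (forall y, r < `|y - a.2| -> f2 y = 0) ->
  test_function D (tens f1 f2).
Proof.
move=> s1 s2 aD f10 f20.
pose K : set pt := `[a.1 - r, a.1 + r]%classic `*` `[a.2 - r, a.2 + r]%classic.
have cK : compact K by apply: compact_setX; exact: segment_compact.
have sK : supp (tens f1 f2) `<=` K.
  rewrite /supp (closure_id K).1; last exact: compact_closed.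
  apply: closureS => x /= nz; apply: contrapT => nK; move: nz; apply/negP/negPn.
  have [x1|/f10 e] := leP `|x.1 - a.1| r; last by rewrite /tens e mul0r eqxx.
  have [x2|/f20 e] := leP `|x.2 - a.2| r; last by rewrite /tens e mulr0 eqxx.
  by exfalso; apply: nK; rewrite /K /= !in_itv/= -!ler_distlC ![ `|a.1 - _|]distrC ![ `|a.2 - _|]distrC.
split; first exact: smooth_tens.
- by apply: (subclosed_compact _ cK sK); exact: closed_closure.
- move=> x /sK [] /=; rewrite !in_itv/= -!ler_distlC distrC => h1; rewrite distrC => h2.
  exact: aD.
Qed.

End TestFunctions.

(** * Squared norms as integrals *)

Section Norms.
Variable R : realType.
Local Notation pt := (R * R)%type.
Local Notation mpt := (measurableTypeR R * measurableTypeR R)%type.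
Local Notation mu := (leb2 R).

Lemma poweR2 (x : \bar R) : (0 <= x)%E -> (x `^ 2)%E = (x ^+ 2)%E.
Proof.
case: x => [x|_|//]; last by rewrite poweRyr// /= mulyy.
by move=> x0; rewrite poweR_EFin powR_mulrn// -EFin_expe.
Qed.

Lemma sqre_sqrte (x : \bar R) : (0 <= x)%E -> ((x `^ 2^-1) ^+ 2)%E = x.
Proof. by move=> x0; rewrite -poweR2 ?poweR_ge0// -poweRrM mulVf// poweRe1. Qed.

Lemma lee_sqre (x y : \bar R) : (0 <= x)%E -> (0 <= y)%E -> (x ^+ 2 <= y ^+ 2)%E -> (x <= y)%E.
Proof.
move=> x0 y0; rewrite -!poweR2// => xy.
have := @gt0_ler_poweR R 2^-1 _ _ _ _ _ xy; rewrite -!poweRrM mulfV// !poweRe1//.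
by apply; [rewrite invr_ge0|rewrite in_itv/= poweR_ge0 leey..].
Qed.

Lemma lee_sqre2 (x y : \bar R) : (0 <= x)%E -> (x <= y)%E -> (x ^+ 2 <= y ^+ 2)%E.
Proof. by move=> x0 xy; apply: lee_pmul. Qed.

Lemma Lnorm2_sqr (D : set mpt) (f : mpt -> \bar R) : (forall x, D x -> 0 <= f x)%E ->
  ('N[mu]_2%:E[f \_ D] ^+ 2 = \int[mu]_(x in D) (f x ^+ 2))%E.
Proof.
move=> f0; rewrite -poweR2 ?Lnorm_ge0// poweR_Lnorm// [RHS]integral_mkcond.
apply: eq_integral => x _; rewrite !patchE; case: ifPn => [/set_mem/f0 fx|_].
  by rewrite gee0_abs// poweR2.
by rewrite abse0 poweR0r.
Qed.

Lemma normLp_ge0 p (D : set pt) (f : pt -> R) : (0 <= normLp p D f)%E.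
Proof. exact: Lnorm_ge0. Qed.

Lemma normLp2_sqr (D : set pt) (f : pt -> R) :
  (normLp 2%:E D f ^+ 2 = \int[mu]_(x in D) ((f x) ^+ 2)%:E)%E.
Proof.
rewrite /normLp -Lnorm_abse -[X in ('N[_]__[X])%E]/(abse \o (EFin \o f \_ D)).
rewrite (_ : _ \o _ = (fun x => `|f x|%:E) \_ D)%E.
  rewrite Lnorm2_sqr; last by move=> x _; rewrite lee_fin.
  by apply: eq_integral => x _; rewrite -EFin_expe real_normK// num_real.
by apply/funext => x; rewrite /= !patchE; case: ifPn => //= _; rewrite normr0.
Qed.

Section Matrices.
Variables m n : nat.
Implicit Types A B : 'M[R]_(m, n).

Lemma ddotE A : ddot A A = \sum_i \sum_j A i j ^+ 2.
Proof. by apply: eq_bigr => i _; apply: eq_bigr => j _; rewrite expr2. Qed.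

Lemma ddot_ge0 A : 0 <= ddot A A.
Proof. by rewrite ddotE; do 2!(apply: sumr_ge0 => ? _); exact: sqr_ge0. Qed.

Lemma frob_sqr A : frob A ^+ 2 = ddot A A.
Proof. by rewrite sqr_sqrtr// ddot_ge0. Qed.

Lemma frob_ge0 A : 0 <= frob A. Proof. exact: sqrtr_ge0. Qed.

Lemma entry_le_frob A i j : (A i j) ^+ 2 <= frob A ^+ 2.
Proof.
rewrite frob_sqr ddotE (bigD1 i)//= (bigD1 j)//= -addrA lerDl.
by apply: addr_ge0; [|apply: sumr_ge0 => ? _]; apply: sumr_ge0 => ? _; exact: sqr_ge0.
Qed.

Lemma measurable_ddot d (T : measurableType d) (D : set T) (u v : T -> 'M[R]_(m, n)) :
  (forall i j, measurable_fun D (fun x => u x i j)) ->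
  (forall i j, measurable_fun D (fun x => v x i j)) ->
  measurable_fun D (fun x => ddot (u x) (v x)).
Proof.
move=> mu_ mv; apply: measurable_sum => i; apply: measurable_sum => j.
exact: measurable_funM.
Qed.

Lemma measurable_frob2 d (T : measurableType d) (D : set T) (u : T -> 'M[R]_(m, n)) :
  (forall i j, measurable_fun D (fun x => u x i j)) ->
  measurable_fun D (fun x => frob (u x) ^+ 2).
Proof. by move=> mu_; under eq_fun do rewrite frob_sqr; exact: measurable_ddot. Qed.

Lemma normLpM2_sqr (D : set pt) (u : pt -> 'M[R]_(m, n)) :
  (normLpM 2%:E D u ^+ 2 = \int[mu]_(x in D) (frob (u x) ^+ 2)%:E)%E.
Proof. exact: normLp2_sqr. Qed.

Lemma normLpM_ge0 p (D : set pt) (u : pt -> 'M[R]_(m, n)) : (0 <= normLpM p D u)%E.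
Proof. exact: Lnorm_ge0. Qed.

Definition quot (w : R) (u : pt -> 'M[R]_(m, n)) (x y : pt) : R :=
  frob (u x - u y) / enorm (x - y) `^ w.

Lemma frac_seminorm2_sqr (w : R) (D : set pt) (u : pt -> 'M[R]_(m, n)) :
  (frac_seminorm 2%:E w D u ^+ 2 =
   \int[mu]_(x in D) \int[mu]_(y in D) (quot w u x y ^+ 2)%:E)%E.
Proof.
rewrite /frac_seminorm Lnorm2_sqr; last by move=> x _; exact: Lnorm_ge0.
by apply: eq_integral => x _; rewrite -normLp2_sqr.
Qed.

End Matrices.

Lemma inLp2P (D : set pt) (f : pt -> R) : inLp 2%:E D f ->
  measurable_fun setT (f \_ D : mpt -> R) /\ (\int[mu]_(x in D) ((f x) ^+ 2)%:E < +oo)%E.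
Proof.
rewrite /inLp inE => /andP[]; rewrite !inE/= /finite_norm => mf fin; split => //.
rewrite -normLp2_sqr; move: fin; rewrite -/(normLp 2%:E D f).
by have := normLp_ge0 2%:E D f; case: (normLp _ _ _) => // r _ _; rewrite -EFin_expe ltry.
Qed.

Lemma measurable_restrict_sub (D E : set mpt) (f : mpt -> R) : E `<=` D -> measurable E ->
  measurable_fun setT (f \_ D) -> measurable_fun E f.
Proof.
move=> ED mE mf; apply: (eq_measurable_fun (f \_ D)); last exact: measurable_funTS.
by move=> x /set_mem/ED Dx; rewrite patchE mem_set.
Qed.

Lemma sqr_integrable (D : set mpt) (f : mpt -> R) : measurable D -> (mu D < +oo)%E ->
  measurable_fun D f -> (\int[mu]_(x in D) ((f x) ^+ 2)%:E < +oo)%E ->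
  mu.-integrable D (EFin \o f).
Proof.
move=> mD muD mf f2; apply/integrableP; split; first exact/measurable_EFinP.
apply: (@le_lt_trans _ _ (\int[mu]_(x in D) (1 + (f x) ^+ 2)%:E)%E).
  apply: ge0_le_integral_EFin => //.
  - exact: measurableT_comp.
  - by apply: measurable_funD; [exact: measurable_cst|exact: measurable_funX].
  - by move=> x _; have := sqr_ge0 (`|f x| - 1); rewrite sqrrB1 real_normK ?num_real//; have := normr_ge0 (f x); lra.
rewrite ge0_integralD_EFin//; last 2 first.
- exact: measurable_funX.
- by move=> x _; exact: sqr_ge0.
by rewrite integral_cst//= mul1e lte_add_pinfty.
Qed.

End Norms.

(** * Geometry of the cells *)

Section CellGeometry.
Variable R : realType.
Local Notation pt := (R * R)%type.
Local Notation mpt := (measurableTypeR R * measurableTypeR R)%type.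
Local Notation mu := (leb2 R).

Lemma dotp_ge0 (x : pt) : 0 <= dotp x x.
Proof. by rewrite /dotp addr_ge0// -expr2 sqr_ge0. Qed.

Lemma enorm_sqr (x : pt) : enorm x ^+ 2 = x.1 ^+ 2 + x.2 ^+ 2.
Proof. by rewrite sqr_sqrtr ?dotp_ge0// /dotp !expr2. Qed.

Lemma enorm_ge0 (x : pt) : 0 <= enorm x. Proof. exact: sqrtr_ge0. Qed.

Lemma coord_le_enorm (x : pt) : `|x.1| <= enorm x /\ `|x.2| <= enorm x.
Proof.
by split; rewrite -ler_sqr ?nnegrE ?enorm_ge0// real_normK ?num_real// enorm_sqr;
  rewrite ?lerDl ?lerDr sqr_ge0.
Qed.

Lemma enorm_lt_of_coord (x : pt) (r : R) : 0 < r -> `|x.1| <= r -> `|x.2| <= r ->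
  enorm x < 2 * r.
Proof.
move=> r0 x1 x2; rewrite ltNge; apply/negP => H.
have : (2 * r) ^+ 2 <= enorm x ^+ 2 by rewrite lerXn2r ?nnegrE ?enorm_ge0// mulr_ge0// ltW.
rewrite enorm_sqr -(real_normK (num_real x.1)) -(real_normK (num_real x.2)).
have := normr_ge0 x.1; have := normr_ge0 x.2; move: `|x.1| `|x.2| x1 x2 => p q; nra.
Qed.

Lemma enorm_eq0 (x : pt) : enorm x = 0 -> x = 0.
Proof.
move=> x0; have [] := coord_le_enorm x; rewrite x0 !normr_le0 => /eqP h1 /eqP h2.
by case: x h1 h2 {x0} => a b /= -> ->.
Qed.

Lemma diam_has_sup (D : set pt) : bounded_set D -> D !=set0 ->
  has_sup [set d | exists x y, [/\ D x, D y & d = enorm (x - y)]].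
Proof.
move=> /bounded_sub_box[M M0 DM] [x Dx]; split; first by exists (enorm (x - x)), x, x.
exists (2 * (2 * M)) => _ [a [b [/DM [] a1 a2 /DM [] b1 b2 ->]]].
apply/ltW/enorm_lt_of_coord; rewrite ?mulr_gt0//=.
  by move: a1 b1; rewrite /= => /andP[? ?] /andP[? ?]; rewrite ler_norml; apply/andP; split; lra.
by move: a2 b2; rewrite /= => /andP[? ?] /andP[? ?]; rewrite ler_norml; apply/andP; split; lra.
Qed.

Lemma le_diam (D : set pt) x y : bounded_set D -> D x -> D y -> enorm (x - y) <= diam D.
Proof.
move=> bD Dx Dy; have hs := diam_has_sup bD (ex_intro _ x Dx).
by apply: sup_upper_bound => //; exists x, y.
Qed.

Lemma diam_gt0 (D : set pt) : bounded_set D -> open D -> D !=set0 -> 0 < diam D.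
Proof.
move=> bD oD [x Dx].
have /nbhs_ballP[e /= e0 he] : nbhs x D by exact: open_nbhs_nbhs.
pose y : pt := (x.1 + e / 2, x.2).
have Dy : D y.
  by apply: he; split => /=; rewrite /ball/= ?subrr ?normr0// opprD addrA subrr add0r normrN gtr0_norm; lra.
apply: lt_le_trans (le_diam bD Dy Dx).
rewrite lt_neqAle enorm_ge0 andbT eq_sym; apply/eqP => /enorm_eq0.
move=> /(congr1 fst) /=; rewrite addrAC subrr add0r; lra.
Qed.

(** The centre set of star-shapedness is a square of half-side d, adapted to the product form of the
    kernel, and h bounds the diameter. *)
Record cell_geometry (E : set pt) (c : pt) (d h : R) : Prop := CellGeometry {
  cg_open : open E;
  cg_bounded : bounded_set E;
  cg_d0 : 0 < d;
  cg_h0 : 0 < h;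
  cg_h : forall x y : pt, E x -> E y -> enorm (x - y) <= h;
  cg_star : forall (t : R) (x z : pt), 0 <= t < 1 -> E x ->
    `|z.1 - c.1| <= d -> `|z.2 - c.2| <= d ->
    E (t * x.1 + (1 - t) * z.1, t * x.2 + (1 - t) * z.2);
  cg_ne : E !=set0;
  cg_box : box c d `<=` E }.

(** A square of half-side rho fits in the ball of radius 2 rho around its centre; hence d = eta h /
    2 for a ball of radius eta h. *)
Lemma regular_cell_geometry (chat eta : R) (T : mesh R) (j : 'I_(ncell T)) : 0 < eta ->
  is_polygon (cell T j) -> mesh_regular chat eta T ->
  exists c, cell_geometry (pdom (cell T j)) c (eta * diam (pdom (cell T j)) / 2)
     (diam (pdom (cell T j))).
Proof.
move=> eta0 [[ne oE _ bE] _ _ _ _] /(_ j) /= [_ [c [cE starE]]].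
have h0 := diam_gt0 bE oE ne; set h := diam _ in h0 cE starE *.
have d0 : 0 < eta * h / 2 by rewrite divr_gt0// mulr_gt0.
have zball (z : pt) : `|z.1 - c.1| <= eta * h / 2 -> `|z.2 - c.2| <= eta * h / 2 ->
    eball c (eta * h) z.
  move=> z1 z2; rewrite /eball /=; have -> : eta * h = 2 * (eta * h / 2) by field.
  exact: enorm_lt_of_coord.
exists c; split => //.
- by move=> x y; exact: le_diam.
- move=> t x z /andP[t0 t1] Ex z1 z2; apply: (starE z x (zball z z1 z2) Ex).
  exists t; first by rewrite t0 ltW.
  rewrite [RHS]surjective_pairing; congr pair; rewrite /= /GRing.scale/=; ring.
- move=> z [/= z1 z2]; apply: cE; apply: zball.
    by rewrite ltW// distrC ltr_distlC.
  by rewrite ltW// distrC ltr_distlC.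
Qed.

(** The definition for (a, b), tested with a first derivative of a product, and the definition for
    the next order, tested with the product itself, have the same left-hand side. Equating the
    right-hand sides gives the first-order relation, up to the common sign. Restriction to D makes
    the functions measurable on the whole plane. *)
Lemma weak_partials_wfamily (m n r : nat) (D E : set pt) (u : pt -> 'M[R]_(m, n)) g
    (i : 'I_m) (j : 'I_n) : open D -> open E -> bounded_set E -> E `<=` D ->
  weak_partials 2%:E D r u g ->
  wfamily E r (fun a b => (fun x => g a b x i j) \_ D).
Proof.
move=> oD oE bE ED [_ wp].
have mD := open_measurable2 oD; have mE := open_measurable2 oE.
have muE := leb2_bounded_lty mE bE.
have gE a b x : E x -> ((fun x => g a b x i j) \_ D) x = g a b x i j.
  by move=> /ED Dx; rewrite patchE mem_set.
split => [a b abr|a b abr f1 f2 s1 s2 bf].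
  have [/(_ i j) L2 _] := wp a b abr; have [mg g2] := inLp2P L2; split => //.
  apply: (sqr_integrable mE muE (measurable_funTS mg)).
  apply: le_lt_trans g2; rewrite [leRHS]integral_mkcond.
  apply: (@le_trans _ _ (\int[mu]_x (((fun x => g a b x i j) \_ D) x ^+ 2)%:E)%E).
    apply: (@ge0_subset_integral _ _ _ mu _ _ mE (@measurableT _ mpt)) => //.
      by apply/measurable_EFinP; exact: measurable_funX.
    by move=> x _; rewrite lee_fin sqr_ge0.
  rewrite le_eqVlt; apply/orP; left; apply/eqP; apply: eq_integral => x _.
  by rewrite !patchE; case: ifPn => // _; rewrite expr0n.
have [a0 [r0 [r0_0 aE f10 f20]]] := bf.
have f10' y : r0 < `|y - a0.1| -> f1 y = 0 by move=> ?; apply: f10; exact: ltW.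
have f20' y : r0 < `|y - a0.2| -> f2 y = 0 by move=> ?; apply: f20; exact: ltW.
have d10 := derive1_supp f10; have d20 := derive1_supp f20.
have RE (v : mpt -> R) (h1 h2 : R -> R) : (forall y, r0 < `|y - a0.1| -> h1 y = 0) ->
    (forall y, r0 < `|y - a0.2| -> h2 y = 0) ->
    \int[mu]_(x in E) ((v \_ D) x * (h1 x.1 * h2 x.2)) = \int[mu]_(x in D) (v x * (h1 x.1 * h2 x.2)).
  move=> h10 h20; have h0 (x : mpt) : ~ E x -> h1 x.1 * h2 x.2 = 0.
    move=> nE; have [x1|/h10 ->] := leP `|x.1 - a0.1| r0; last by rewrite mul0r.
    have [x2|/h20 ->] := leP `|x.2 - a0.2| r0; last by rewrite mulr0.
    by exfalso; apply: nE; exact: aE.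
  rewrite [LHS]restrict_Rintegral; last by move=> x /h0 ->; rewrite mulr0.
  rewrite [RHS]restrict_Rintegral; last first.
    by move=> x nD; rewrite h0 ?mulr0// => /ED.
  apply: eq_Rintegral => x _; have [/ED Dx|/h0 ->] := pselect (E x); last by rewrite !mulr0.
  by rewrite patchE mem_set.
have aD (z : pt) : `|z.1 - a0.1| <= r0 -> `|z.2 - a0.2| <= r0 -> D z.
  by move=> ? ?; apply: ED; exact: aE.
have s1' := smooth1_derive s1; have s2' := smooth1_derive s2.
have [_ wab] := wp a b (ltnW abr).
have abr1 : (a.+1 + b <= r)%N by rewrite addSn.
have abr2 : (a + b.+1 <= r)%N by rewrite addnS.
have [_ wab1] := wp a.+1 b abr1; have [_ wab2] := wp a b.+1 abr2.
have sgn0 k : (-1) ^+ k != 0 :> R by rewrite signr_eq0.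
rewrite !RE//; split.
- apply: (mulfI (sgn0 (a + b)%N)).
  have := wab i j _ (test_function_tens s1' s2 aD d10 f20').
  have := wab1 i j _ (test_function_tens s1 s2 aD f10' f20').
  rewrite !multi_partial_tens// /tens -derive1Sn addSn exprS mulN1r mulNr mulrN => -> <-//.
- apply: (mulfI (sgn0 (a + b)%N)).
  have := wab i j _ (test_function_tens s1 s2' aD f10' d20).
  have := wab2 i j _ (test_function_tens s1 s2 aD f10' f20').
  rewrite !multi_partial_tens// /tens -derive1Sn addnS exprS mulN1r mulNr mulrN => -> <-//.
Qed.

End CellGeometry.

(** * Polynomial approximation on a cell *)

Section CellEstimate.
Variable R : realType.
Local Notation pt := (R * R)%type.
Local Notation mpt := (measurableTypeR R * measurableTypeR R)%type.
Local Notation mu := (leb2 R).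

Lemma measurable_enorm : measurable_fun setT (@enorm R : mpt -> R).
Proof.
apply: (measurableT_comp (continuous_measurable_fun (@sqrt_continuous R))).
by apply: measurable_funD; apply: measurable_funM;
  (exact: measurable_fst || exact: measurable_snd).
Qed.

Section Quotient.
Variables (m n : nat).
Implicit Types u : pt -> 'M[R]_(m, n).

Lemma measurable_quot2 w u : (forall i j, measurable_fun setT (fun x : mpt => u x i j)) ->
  measurable_fun setT (fun p : mpt * mpt => quot w u p.1 p.2 ^+ 2).
Proof.
move=> mu_; rewrite /quot; under eq_fun do rewrite expr_div_n.
apply: measurable_funM.
  apply: measurable_frob2 => i j.
  rewrite (_ : (fun _ => _) = fun p : mpt * mpt => u p.1 i j - u p.2 i j); last first.
    by apply/funext => p; rewrite !mxE.
  apply: measurable_funB.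
    exact: (measurableT_comp (mu_ i j) measurable_fst).
  exact: (measurableT_comp (mu_ i j) measurable_snd).
apply: measurable_funV; apply: measurable_funX.
apply: (measurableT_comp (measurable_powR w)); apply: (measurableT_comp measurable_enorm).
have m1 (f g : mpt * mpt -> measurableTypeR R) : measurable_fun setT f -> measurable_fun setT g ->
    measurable_fun setT (fun p => f p - g p) by move=> mf mg; exact: measurable_funB.
apply/measurable_fun_pairP; split.
- apply: m1; [exact: (measurableT_comp measurable_fst measurable_fst)|exact: (measurableT_comp measurable_fst measurable_snd)].
- apply: m1; [exact: (measurableT_comp measurable_snd measurable_fst)|exact: (measurableT_comp measurable_snd measurable_snd)].
Qed.

(** The values outside D are arbitrary; extension by zero makes the function measurable on the whole
    plane, so that Tonelli's theorem applies to the quotients. *)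
Definition restr (D : set pt) u (x : pt) : 'M[R]_(m, n) :=
  \matrix_(i, j) ((fun x => u x i j) \_ D) x.

Lemma restrE D u x : D x -> restr D u x = u x.
Proof. by move=> Dx; apply/matrixP => i j; rewrite mxE patchE mem_set. Qed.

(* The factor 2 avoids a discussion of the equality case in the mean value
   argument; W = 0 is handled separately. *)
Lemma exists_good_point (E D : set pt) (w h mu0 W : R) u : open D -> open E -> E `<=` D ->
  (forall x y, E x -> E y -> enorm (x - y) <= h) -> 0 < mu0 -> (mu0%:E <= mu E)%E ->
  0 <= w -> 0 <= h ->
  (forall i j, measurable_fun setT ((fun x : mpt => u x i j) \_ D)) ->
  (\int[mu]_(y in E) \int[mu]_(x in E) (quot w u y x ^+ 2)%:E <= W%:E)%E -> 0 <= W ->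
  exists2 y, E y &
    (\int[mu]_(x in E) (frob (u x - u y) ^+ 2)%:E <= ((h `^ w) ^+ 2 * (2 / mu0 * W))%:E)%E.
Proof.
move=> oD oE ED hE mu00 muE w0 h0 mu_ IW W0.
have mD := open_measurable2 oD; have mE := open_measurable2 oE.
pose v := restr D u.
have vE x : E x -> v x = u x by move=> Ex; apply: restrE; exact: ED.
have mv i j : measurable_fun setT (fun x : mpt => v x i j).
  have -> : (fun x : mpt => v x i j) = (fun x => u x i j) \_ D by apply/funext => x; rewrite mxE.
  exact: mu_.
pose F (p : mpt * mpt) : \bar R := (\1_E p.2 * quot w v p.1 p.2 ^+ 2)%:E.
have mF : measurable_fun setT F.
  apply/measurable_EFinP; apply: measurable_funM; last exact: measurable_quot2.
  by apply: (measurableT_comp _ measurable_snd); exact: measurable_indic.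
have F0 p : (0 <= F p)%E by rewrite lee_fin mulr_ge0// sqr_ge0.
pose I (y : mpt) : \bar R := (\int[leb2s R]_x F (y, x))%E.
have mI : measurable_fun setT I by exact: (@measurable_fun_fubini_tonelli_F _ _ mpt mpt R (leb2s R) F mF F0).
have I0 y : (0 <= I y)%E by apply: integral_ge0.
have IE y : E y -> I y = (\int[mu]_(x in E) (quot w u y x ^+ 2)%:E)%E.
  move=> Ey; rewrite [RHS]integral_mkcond; apply: eq_integral => x _.
  rewrite patchE /F /= indicE; case: ifPn => [/set_mem Ex|_]; last by rewrite mul0r.
  by rewrite mul1r /quot !vE.
have IW' : (\int[mu]_(y in E) I y <= W%:E)%E.
  apply: le_trans IW; rewrite le_eqVlt; apply/orP; left; apply/eqP.
  by apply: eq_integral => y /set_mem; exact: IE.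
have [y Ey Iy] : exists2 y, E y & (I y <= (2 / mu0 * W)%:E)%E.
  apply: contrapT => nex.
  have {}nex y : E y -> ((2 / mu0 * W)%:E < I y)%E.
    by move=> Ey; rewrite ltNge; apply/negP => Iy; apply: nex; exists y.
  have mIE : measurable_fun E I by exact: measurable_funTS.
  (* For W = 0 the assumption says I > 0 on all of E, whereas the vanishing integral makes I zero
     almost everywhere on E, a set of positive measure. *)
  have [W00|W1] := eqVneq W 0.
    have I00 : (\int[mu]_(y in E) `|I y| = 0)%E.
      under eq_integral do rewrite gee0_abs//.
      by apply/eqP; rewrite eq_le integral_ge0// andbT (le_trans IW')// W00.
    have /(ae_eq_integral_abs mu mE mIE).1 [N [mN N0 EN]] := I00.
    have : (mu E <= mu N)%E.
      apply: le_measure; rewrite ?inE// => y Ey; apply: EN => /= /(_ Ey) Iy.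
      by have := nex y Ey; rewrite Iy W00 mulr0 ltxx.
    by rewrite N0; apply/negP; rewrite -ltNge; apply: lt_le_trans muE; rewrite lte_fin.
  have {}W1 : 0 < W by rewrite lt_neqAle eq_sym W1.
  (* I exceeds 2 W / mu0 on E, whose measure is at least mu0, so that its integral would be at least
     2 W. *)
  have : ((2 * W)%:E <= W%:E)%E.
    apply: le_trans IW'.
    apply: (@le_trans _ _ (\int[mu]_(y in E) (cst (2 / mu0 * W)%:E) y)%E).
      rewrite integral_cst//; apply: (@le_trans _ _ ((2 / mu0 * W)%:E * mu0%:E)%E).
        by rewrite -EFinM lee_fin; rewrite mulrAC divfK ?gt_eqF.
      by apply: lee_wpmul2l => //; rewrite lee_fin mulr_ge0// divr_ge0// ltW.
    apply: ge0_le_integral => //.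
    + by move=> y _; rewrite lee_fin mulr_ge0// divr_ge0// ltW.
    + by move=> y Ey; apply/ltW/nex.
  by rewrite lee_fin; lra.
exists y => //; rewrite (EFinM (_ ^+ 2)).
apply: (@le_trans _ _ (((h `^ w) ^+ 2)%:E * I y)%E); last first.
  by apply: lee_wpmul2l => //; rewrite lee_fin sqr_ge0.
rewrite IE// -ge0_integralZ_EFin//; last 3 first.
- apply: (@eq_measurable_fun _ _ _ _ _ (fun x => quot w v y x ^+ 2)).
    by move=> x /set_mem Ex; rewrite /quot !vE.
  apply: measurable_funTS; exact: (measurableT_comp (measurable_quot2 w mv) (pair1_measurable y)).
- by move=> x _; exact: sqr_ge0.
- exact: sqr_ge0.
have mq : measurable_fun E (fun x => quot w u y x ^+ 2).
  apply: (@eq_measurable_fun _ _ _ _ _ (fun x => quot w v y x ^+ 2)).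
    by move=> x /set_mem Ex; rewrite /quot !vE.
  apply: measurable_funTS; exact: (measurableT_comp (measurable_quot2 w mv) (pair1_measurable y)).
apply: ge0_le_integral_EFin => //.
- apply: measurable_frob2 => i j.
  apply: (@eq_measurable_fun _ _ _ _ _ (fun x => v x i j - u y i j)).
    by move=> x /set_mem Ex; rewrite vE// !mxE.
  have mvE : measurable_fun E (fun x : mpt => v x i j) by exact: (measurable_funTS (mv i j)).
  exact: (measurable_funB mvE (measurable_cst (u y i j))).
- exact: measurable_funM.
- by move=> x _; exact: sqr_ge0.
move=> x Ex; rewrite /quot.
(* On the diagonal the denominator of the quotient degenerates, but the left-hand side is 0.
   Elsewhere |x - y| <= h, so that h^w times the quotient dominates the difference. *)
have [->|xy] := eqVneq x y.
  rewrite subrr (_ : frob 0 = 0) ?mul0r ?expr0n ?mulr0//.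
  by apply/eqP; rewrite -(@eqrXn2 _ 2)// ?frob_ge0// frob_sqr ddotE expr0n big1// => i _; rewrite big1// => j _; rewrite mxE expr0n.
have e0 : 0 < enorm (y - x).
  by rewrite lt_neqAle enorm_ge0 andbT eq_sym; apply: contra xy => /eqP/enorm_eq0/eqP; rewrite subr_eq0 eq_sym.
have -> : frob (u x - u y) = frob (u y - u x).
  apply/eqP; rewrite -(@eqrXn2 _ 2)// ?frob_ge0// !frob_sqr !ddotE; apply/eqP.
  by apply: eq_bigr => i _; apply: eq_bigr => j _; rewrite !mxE -sqrrN opprB.
have ew0 : 0 < enorm (y - x) `^ w by rewrite powR_gt0.
rewrite -exprMn; apply: lerXn2r; rewrite ?nnegrE ?frob_ge0//.
  by rewrite mulr_ge0 ?powR_ge0 ?divr_ge0 ?frob_ge0 ?powR_ge0.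
rewrite mulrCA -[leLHS]mulr1; apply: ler_wpM2l; first exact: frob_ge0.
rewrite ler_pdivlMr// mul1r; apply: ge0_ler_powR => //; rewrite ?nnegrE ?enorm_ge0//.
exact: hE.
Qed.

End Quotient.
(* The constant of [poincare_top] divided by h ^ 2, for d = eta h / 2. *)
Definition bh_const (eta B : R) : R := 256 * B ^+ 2 * (1 + (2 / eta) ^+ 2) * (1 + eta / 2) ^+ 2.

Lemma bh_const_ge0 eta B : 0 <= bh_const eta B.
Proof.
rewrite /bh_const; apply: mulr_ge0; last exact: sqr_ge0.
apply: mulr_ge0; first by apply: mulr_ge0; [exact: ler0n|exact: sqr_ge0].
by apply: addr_ge0; [exact: ler01|exact: sqr_ge0].
Qed.

(** The square of the leading part of the Sobolev norm, localised to E: derivatives of order s, or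
    the Slobodeckij double integrals over E x E when s is not an integer. In this form the
    contributions of disjoint cells add up. *)
Definition cell_energy (m n : nat) (s : R) (E : set pt) (g : nat -> nat -> pt -> 'M[R]_(m, n)) :
    \bar R :=
  let r := Num.truncn s in let theta := s - r%:R in
  (if (theta == 0)%R then
     \sum_(a < r.+1) \int[mu]_(x in E) (frob (g a (r - a)%N x) ^+ 2)%:E
   else \sum_(a < r.+1) \int[mu]_(x in E) \int[mu]_(y in E)
          (quot (1 + theta)%R (g a (r - a)%N) x y ^+ 2)%:E)%E.

Lemma cell_energy_ge0 m n s E (g : nat -> nat -> pt -> 'M[R]_(m, n)) :
  (0 <= cell_energy s E g)%E.
Proof.
rewrite /cell_energy; case: ifP => _; apply: sume_ge0 => a _; apply: integral_ge0 => x _.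
  by rewrite lee_fin sqr_ge0.
by apply: integral_ge0 => y _; rewrite lee_fin sqr_ge0.
Qed.

Section Cell.
Variables (D E : set pt) (c : pt) (eta h B : R).
Hypothesis oD : open D.
Hypothesis ED : E `<=` D.
Hypothesis eta0 : 0 < eta.
Hypothesis gE : cell_geometry E c (eta * h / 2) h.
Hypothesis hB : forall y : R, `|moll y| <= B /\ `|derive1 (@moll R) y| <= B.
Variables (m n k : nat) (s : R).
Hypothesis sP : 1 <= s <= k.+1%:R.
Local Notation r := (Num.truncn s).
Local Notation theta := (s - r%:R).
Variables (u : pt -> 'M[R]_(m, n)) (g : nat -> nat -> pt -> 'M[R]_(m, n)).
Hypothesis wp : weak_partials 2%:E D r u g.

Let mE : measurable (E : set mpt). Proof. exact: open_measurable2 (cg_open gE). Qed.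
Let d0 := cg_d0 gE.
Let h0 := cg_h0 gE.
Let E0 := cg_ne gE.
Let starE := cg_star gE.

Let hE (x y : pt) : E x -> E y -> `|x.1 - y.1| <= h /\ `|x.2 - y.2| <= h.
Proof.
move=> Ex Ey; have [h1 h2] := coord_le_enorm (x - y); have hh := cg_h gE Ex Ey.
by split; [exact: le_trans h1 hh|exact: le_trans h2 hh].
Qed.

Let CPE : 2 * (2 * kernel_mass (eta * h / 2) h B * (h + eta * h / 2) ^+ 2) = bh_const eta B * h ^+ 2.
Proof. by rewrite /bh_const /kernel_mass; field; rewrite !gt_eqF. Qed.

Let r1 : (1 <= r)%N.
Proof. by have /andP[s1 _] := sP; rewrite truncn_ge_nat// (le_trans ler01). Qed.

Let s0 : 0 <= s.
Proof. by have /andP[s1 _] := sP; rewrite (le_trans ler01). Qed.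

Let rs : r%:R <= s. Proof. by have := truncn_le s; rewrite s0. Qed.

Let powhs : (h `^ s) ^+ 2 = (h ^+ 2) ^+ r * (h `^ theta) ^+ 2.
Proof.
rewrite -exprM mulnC exprM -exprMn; congr (_ ^+ 2).
have {1}-> : s = r%:R + theta by rewrite addrC subrK.
move: theta => th; rewrite powRD; last by rewrite (gt_eqF h0) implybT.
by rewrite powR_mulrn// ltW.
Qed.

(** If s is an integer, the bounded derivatives of order r make those of order r - 1 close to
    constants, by the Poincare inequality; starting one order lower keeps the degree below r, hence
    at most k even for s = k + 1. Otherwise r <= k, and the derivatives of order r are close to
    their values at a good point. In the factor 1 + 2 / eta^2 the first term serves the first case
    and the second term the other. *)
Lemma scalar_estimate (W : R) i j : 0 <= W -> (cell_energy s E g <= W%:E)%E ->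
  exists q, poly_lt k.+1 q /\
    (\int[mu]_(x in E) ((u x i j - q x) ^+ 2)%:E <=
     (bh_const eta B ^+ r * (1 + 2 / eta ^+ 2) * ((h `^ s) ^+ 2 * W))%:E)%E.
Proof.
move=> W0 eW.
pose G a b : mpt -> R := (fun x => g a b x i j) \_ D.
have GE a b x : E x -> G a b x = g a b x i j by move=> Ex; rewrite /G patchE mem_set//; exact: ED.
have wG : wfamily E r G := weak_partials_wfamily i j oD (cg_open gE) (cg_bounded gE) ED wp.
have K0 := bh_const_ge0 eta B.
have e2 : 0 <= 2 / eta ^+ 2 by rewrite divr_ge0// sqr_ge0.
have final (q : pt -> R) d A : (d <= k.+1)%N -> poly_lt d q ->
   (\int[mu]_(x in E) ((G 0%N 0%N x - q x) ^+ 2)%:E <= A%:E)%E ->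
   A <= bh_const eta B ^+ r * (1 + 2 / eta ^+ 2) * ((h `^ s) ^+ 2 * W) ->
   exists q, poly_lt k.+1 q /\
    (\int[mu]_(x in E) ((u x i j - q x) ^+ 2)%:E <=
     (bh_const eta B ^+ r * (1 + 2 / eta ^+ 2) * ((h `^ s) ^+ 2 * W))%:E)%E.
  move=> dk pq qA Ale; exists q; split; first exact: poly_lt_le pq.
  apply: (@le_trans _ _ A%:E); last by rewrite lee_fin.
  apply: le_trans qA; rewrite le_eqVlt; apply/orP; left; apply/eqP.
  apply: eq_integral => x /set_mem Ex; rewrite GE//.
  by have [-> _] := wp.
move: eW; rewrite /cell_energy; case: ifPn => [/eqP th0|th0] eW.
- have topG a b : (a + b)%N = r -> (\int[mu]_(x in E) ((G a b x) ^+ 2)%:E <= W%:E)%E.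
    move=> abr; have ar : (a < r.+1)%N by rewrite ltnS -abr leq_addr.
    have rab : (r - a)%N = b by rewrite -abr addKn.
    apply: le_trans eW; rewrite (bigD1 (Ordinal ar))//=.
    apply: (@le_trans _ _ (\int[mu]_(x in E) (frob (g a (r - a)%N x) ^+ 2)%:E)%E); last first.
      apply: leeDl; apply: sume_ge0 => a' _; apply: integral_ge0 => x _.
      by rewrite lee_fin sqr_ge0.
    have mg i' j' : measurable_fun E (fun x : mpt => g a b x i' j').
      have [/(_ i' j')/inLp2P[mg _] _] : inLpM 2%:E D (g a b) /\ weak_partial D a b u (g a b).
        by apply: wp.2; rewrite abr.
      exact: (measurable_restrict_sub ED mE mg).
    rewrite rab; apply: ge0_le_integral_EFin => //.
    + apply: measurable_funX; apply: (@eq_measurable_fun _ _ _ _ _ (fun x => g a b x i j)) => //.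
      by move=> x /set_mem Ex; rewrite GE.
    + exact: measurable_frob2.
    + by move=> x _; exact: sqr_ge0.
    + by move=> x Ex; rewrite GE//; exact: entry_le_frob.
  have [r' rE] : exists r', r = r'.+1 by exists r.-1; rewrite prednK.
  have wG1 : wfamily E r'.+1 G by rewrite -rE.
  have wG' : wfamily E r' G.
    by split => a b abr; [apply: wG1.1; exact: leqW|apply: wG1.2; exact: ltnW].
  have topG1 a b : (a + b)%N = r'.+1 -> (\int[mu]_(x in E) ((G a b x) ^+ 2)%:E <= W%:E)%E.
    by rewrite -rE; exact: topG.
  have A0 : 0 <= 2 * (2 * kernel_mass (eta * h / 2) h B * (h + eta * h / 2) ^+ 2) * W.
    by rewrite CPE mulr_ge0// mulr_ge0// sqr_ge0.
  have [q [pq qA]] := bramble_hilbert mE d0 hE starE E0 hB A0 wG'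
    (poincare_top mE d0 hE starE E0 hB wG1 topG1).
  apply: (final q _ _ _ pq qA).
    rewrite -rE -(ler_nat R); apply: le_trans rs _.
    by have /andP[] := sP.
  rewrite CPE mulrA -exprSr -rE powhs th0 powRr0 expr1n mulr1 exprMn.
  move: (exprn_ge0 r K0) (exprn_ge0 r (sqr_ge0 h)) e2.
  move: (bh_const eta B ^+ r) ((h ^+ 2) ^+ r) (2 / _) => p1 p2 p5 h1 h2 h5.
  have := mulr_ge0 (mulr_ge0 h1 h5) (mulr_ge0 h2 W0); nra.
- have rk : (r < k.+1)%N.
    rewrite -(ltr_nat R); have /andP[_ sk] := sP; apply: lt_le_trans sk.
    by rewrite lt_neqAle rs andbT eq_sym -subr_eq0.
  have th : 0 <= theta by rewrite subr_ge0.
  have mu0 : 0 < (eta * h) ^+ 2 by rewrite exprn_gt0// mulr_gt0.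
  have muE : (((eta * h) ^+ 2)%:E <= mu E)%E.
    have -> : (eta * h) ^+ 2 = (2 * (eta * h / 2)) ^+ 2 by field.
    rewrite -(leb2_box c d0); apply: le_measure; rewrite ?inE//; last exact: (cg_box gE).
    exact: measurable_box.
  (* The lower bound (eta h)^2 of the measure is the area of the inscribed square. Its h^2 cancels
     against the exponent 1 + theta of the seminorm, leaving h^(2 theta). *)
  pose A := (h `^ (1 + theta)) ^+ 2 * (2 / (eta * h) ^+ 2 * W).
  have A0 : 0 <= A by rewrite /A mulr_ge0 ?sqr_ge0// mulr_ge0// divr_ge0// ltW.
  have topG a b : (a + b)%N = r -> exists cst : R,
      (\int[mu]_(x in E) ((G a b x - cst) ^+ 2)%:E <= A%:E)%E.
    move=> abr; have ar : (a < r.+1)%N by rewrite ltnS -abr leq_addr.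
    have rab : (r - a)%N = b by rewrite -abr addKn.
    have mg i' j' : measurable_fun setT ((fun x : mpt => g a b x i' j') \_ D).
      have [/(_ i' j')/inLp2P[mg _] _] : inLpM 2%:E D (g a b) /\ weak_partial D a b u (g a b).
        by apply: wp.2; rewrite abr.
      exact: mg.
    have gW : (\int[mu]_(y in E) \int[mu]_(x in E) (quot (1 + theta) (g a b) y x ^+ 2)%:E <= W%:E)%E.
      apply: le_trans eW; rewrite (bigD1 (Ordinal ar))//= rab.
      apply: leeDl; apply: sume_ge0 => a' _; apply: integral_ge0 => x _.
      by apply: integral_ge0 => y _; rewrite lee_fin sqr_ge0.
    have th1 : 0 <= 1 + theta by rewrite addr_ge0.
    have [y Ey hy] := exists_good_point oD (cg_open gE) ED (fun x y => @cg_h _ _ _ _ _ gE x y)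
      mu0 muE th1 (ltW h0) mg gW W0.
    exists (g a b y i j); apply: le_trans hy.
    have mgE i' j' : measurable_fun E (fun x : mpt => g a b x i' j').
      exact: (measurable_restrict_sub ED mE (mg i' j')).
    apply: ge0_le_integral_EFin => //.
    + apply: measurable_funX; apply: (@eq_measurable_fun _ _ _ _ _ (fun x => g a b x i j - g a b y i j)) => //.
        by move=> x /set_mem Ex; rewrite GE.
      exact: (measurable_funB (mgE i j) (measurable_cst (g a b y i j))).
    + apply: measurable_frob2 => i' j'.
      rewrite (_ : (fun _ => _) = fun x => g a b x i' j' - g a b y i' j'); last first.
        by apply/funext => x; rewrite !mxE.
      exact: (measurable_funB (mgE i' j') (measurable_cst (g a b y i' j'))).
    + by move=> x _; exact: sqr_ge0.
    + move=> x Ex; rewrite GE//; have := entry_le_frob (g a b x - g a b y) i j.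
      by rewrite !mxE.
  have [q [pq qA]] := bramble_hilbert mE d0 hE starE E0 hB A0 wG topG.
  apply: (final q _ _ rk pq qA).
  have hS t : h `^ (1 + t) = h * h `^ t.
    by rewrite powRD ?powRr1 ?(ltW h0)// (gt_eqF h0) implybT.
  rewrite CPE exprMn /A powhs hS.
  have -> : (h * h `^ theta) ^+ 2 * (2 / (eta * h) ^+ 2 * W) = 2 / eta ^+ 2 * ((h `^ theta) ^+ 2 * W).
    by move: (h `^ theta) => z; field; rewrite !gt_eqF.
  move: (exprn_ge0 r K0) (exprn_ge0 r (sqr_ge0 h)) (sqr_ge0 (h `^ theta)) e2.
  move: (bh_const eta B ^+ r) ((h ^+ 2) ^+ r) ((h `^ _) ^+ 2) (2 / _) => p1 p2 p3 p5 h1 h2 h3 h5.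
  have := mulr_ge0 h1 (mulr_ge0 h2 (mulr_ge0 h3 W0)); nra.
Qed.

End Cell.
End CellEstimate.

(** * The polynomial projector *)

Section Projection.
Variable R : realType.
Local Notation pt := (R * R)%type.
Local Notation mpt := (measurableTypeR R * measurableTypeR R)%type.
Local Notation mu := (leb2 R).

Definition sqr_int (E : set mpt) (f : mpt -> R) : Prop :=
  measurable_fun E f /\ (\int[mu]_(x in E) ((f x) ^+ 2)%:E < +oo)%E.

Definition ip (E : set mpt) (f g : mpt -> R) : R := \int[mu]_(x in E) (f x * g x).

Variable E : set mpt.
Hypothesis mE : measurable E.

Lemma sqr_int0 : sqr_int E (fun=> 0).
Proof.
split; first exact: measurable_cst.
by rewrite integral0_eq// => x _; rewrite expr0n.
Qed.

Lemma sqr_intD (a : R) f g : sqr_int E f -> sqr_int E g -> sqr_int E (fun x => a * f x + g x).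
Proof.
move=> [mf f2] [mg g2].
have maf : measurable_fun E (fun x => a * f x) by apply: measurable_funM => //; exact: measurable_cst.
have mf2 : measurable_fun E (fun x => f x ^+ 2) by exact: measurable_funX.
have mg2 : measurable_fun E (fun x => g x ^+ 2) by exact: measurable_funX.
have maf2 : measurable_fun E (fun x => 2 * a ^+ 2 * f x ^+ 2).
  by apply: measurable_funM => //; exact: measurable_cst.
have mg22 : measurable_fun E (fun x => 2 * g x ^+ 2).
  by apply: measurable_funM => //; exact: measurable_cst.
split; first exact: measurable_funD.
apply: (@le_lt_trans _ _ (\int[mu]_(x in E) (2 * a ^+ 2 * f x ^+ 2 + 2 * g x ^+ 2)%:E)%E).
  apply: ge0_le_integral_EFin => //.
  - by apply: measurable_funX; exact: measurable_funD.
  - exact: measurable_funD.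
  - by move=> x _; exact: sqr_ge0.
  - by move=> x _; have := sqr_ge0 (a * f x - g x); rewrite sqrrB sqrrD exprMn; nra.
have a20 : 0 <= 2 * a ^+ 2 by rewrite mulr_ge0// sqr_ge0.
rewrite ge0_integralD_EFin//; last 2 first.
- by move=> x _; rewrite mulr_ge0// sqr_ge0.
- by move=> x _; rewrite mulr_ge0// sqr_ge0.
rewrite !ge0_integralZ_EFin//; [|by move=> x _; exact: sqr_ge0..].
rewrite lte_add_pinfty//; apply: lte_mul_pinfty => //; rewrite ?lee_fin//.
Qed.

Lemma sqr_intZ (a : R) f : sqr_int E f -> sqr_int E (fun x => a * f x).
Proof.
move=> sf; have := sqr_intD a sf sqr_int0.
by rewrite (_ : (fun x => a * f x + 0) = fun x => a * f x)//; apply/funext => x; rewrite addr0.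
Qed.

Lemma sqr_intB f g : sqr_int E f -> sqr_int E g -> sqr_int E (fun x => f x - g x).
Proof.
move=> sf sg; have := sqr_intD (-1) sg sf.
by rewrite (_ : (fun x => -1 * g x + f x) = fun x => f x - g x)//; apply/funext => x; ring.
Qed.

Lemma sqr_int_sum n (f : 'I_n -> mpt -> R) : (forall i, sqr_int E (f i)) ->
  sqr_int E (fun x => \sum_(i < n) f i x).
Proof.
elim: n f => [|n IH] f sf.
  by under eq_fun do rewrite big_ord0; exact: sqr_int0.
under eq_fun do rewrite big_ord_recr/= addrC -[f _ _]mul1r.
by apply: sqr_intD => //; exact: IH.
Qed.

Lemma ip_integrable f g : sqr_int E f -> sqr_int E g -> mu.-integrable E (fun x => (f x * g x)%:E).
Proof.
move=> [mf f2] [mg g2]; apply/integrableP; split.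
  by apply/measurable_EFinP; exact: measurable_funM.
apply: (@le_lt_trans _ _ (\int[mu]_(x in E) (f x ^+ 2 + g x ^+ 2)%:E)%E).
  apply: ge0_le_integral_EFin => //.
  - by apply: measurableT_comp => //; exact: measurable_funM.
  - by apply: measurable_funD; exact: measurable_funX.
  - move=> x _; rewrite normrM -[f x ^+ 2]real_normK ?num_real// -[g x ^+ 2]real_normK ?num_real//.
    by have := sqr_ge0 (`|f x| - `|g x|); have := sqr_ge0 (`|f x|); have := sqr_ge0 (`|g x|); rewrite sqrrB; nra.
rewrite ge0_integralD_EFin//; last 4 first.
- exact: measurable_funX.
- exact: measurable_funX.
- by move=> x _; exact: sqr_ge0.
- by move=> x _; exact: sqr_ge0.
by rewrite lte_add_pinfty.
Qed.

Lemma ipC f g : ip E f g = ip E g f.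
Proof. by apply: eq_Rintegral => x _; rewrite mulrC. Qed.

Lemma ipD (a : R) f g w : sqr_int E f -> sqr_int E g -> sqr_int E w ->
  ip E (fun x => a * f x + g x) w = a * ip E f w + ip E g w.
Proof.
move=> sf sg sw; rewrite /ip -RintegralZl//; last exact: ip_integrable.
rewrite -RintegralD//; last 2 first.
- have := ip_integrable (sqr_intZ a sf) sw; apply: eq_integrable => // x _.
  by rewrite /= mulrA.
- exact: ip_integrable.
by apply: eq_Rintegral => x _; rewrite mulrDl mulrA.
Qed.

Lemma ip_sumr n (f : mpt -> R) (g : 'I_n -> mpt -> R) : sqr_int E f ->
  (forall i, sqr_int E (g i)) -> ip E f (fun x => \sum_(i < n) g i x) = \sum_(i < n) ip E f (g i).
Proof.
move=> sf; elim: n g => [|n IH] g sg.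
  rewrite big_ord0 /ip; under eq_Rintegral do rewrite big_ord0 mulr0.
  by rewrite /Rintegral integral0.
rewrite big_ord_recr/= -IH// ipC.
rewrite (_ : (fun x => _) = fun x => 1 * (\sum_(i < n) g (widen_ord (leqnSn n) i) x) + g ord_max x); last first.
  by apply/funext => x; rewrite big_ord_recr/= mul1r.
by rewrite ipD//; [rewrite mul1r ipC [X in _ + X]ipC|exact: sqr_int_sum].
Qed.

Lemma ip_ge0 f : 0 <= ip E f f.
Proof. by apply: Rintegral_ge0 => x _; rewrite -expr2 sqr_ge0. Qed.

(** The square norm of f + t w is then affine in t and nonnegative for every real t, so that its
    slope is 0. *)
Lemma ip0_orth f w : sqr_int E f -> sqr_int E w -> ip E w w = 0 -> ip E f w = 0.
Proof.
move=> sf sw w0.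
have H t : 0 <= ip E f f + 2 * t * ip E f w.
  have stw := sqr_intD t sw sf.
  have := ip_ge0 (fun x => t * w x + f x).
  rewrite (ipD t sw sf stw) (ipC w) (ipC f (fun x => t * w x + f x)).
  rewrite (ipD t sw sf sw) (ipD t sw sf sf) w0 (ipC w f).
  by move: (ip E f f) (ip E f w) => p q; nra.
apply/eqP; apply: contraT => n0.
have := H (- (ip E f f + 1) / (2 * ip E f w)).
have -> : 2 * (- (ip E f f + 1) / (2 * ip E f w)) * ip E f w = - (ip E f f + 1) by field.
by lra.
Qed.

Definition spanned (e : nat -> mpt -> R) (N : nat) (p : mpt -> R) : Prop :=
  exists c : nat -> R, forall x, p x = \sum_(i < N) c i * e i x.

Lemma spanned_sqr_int e N p : (forall i, sqr_int E (e i)) -> spanned e N p -> sqr_int E p.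
Proof.
move=> se [c pE]; rewrite (_ : p = fun x => \sum_(i < N) c i * e i x); last exact/funext.
by apply: sqr_int_sum => i; exact: sqr_intZ.
Qed.

(** Gram-Schmidt, one function at a time, without linear independence: if the new direction w has
    norm 0, it is orthogonal to everything by [ip0_orth], and the coefficient 0 will do. *)
Lemma projection_exists (e : nat -> mpt -> R) N : (forall i, sqr_int E (e i)) ->
  forall f, sqr_int E f -> exists2 p, spanned e N p &
    forall j, (j < N)%N -> ip E (fun x => f x - p x) (e j) = 0.
Proof.
move=> se; elim: N => [|N IH] f sf.
  by exists (fun=> 0) => //; exists (fun=> 0) => x; rewrite big_ord0.
have [p sp pO] := IH f sf; have [q sq qO] := IH (e N) (se N).
have sP := spanned_sqr_int se sp; have sQ := spanned_sqr_int se sq.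
have sfp := sqr_intB sf sP.
pose w x := e N x - q x; have sw : sqr_int E w := sqr_intB (se N) sQ.
pose t := if ip E w w == 0 then 0 else ip E (fun x => f x - p x) w / ip E w w.
exists (fun x => t * w x + p x).
  have [a aE] := sp; have [b bE] := sq.
  exists (fun i => if (i < N)%N then a i - t * b i else t) => x.
  rewrite big_ord_recr/= ltnn /w aE bE.
  rewrite [X in _ = X + _](eq_bigr (fun i : 'I_N => a i * e i x - t * (b i * e i x))); last first.
    by move=> i _; rewrite ltn_ord; ring.
  by rewrite sumrB -mulr_sumr; ring.
have sO j : (j < N)%N -> ip E w (e j) = 0 by exact: qO.
have fE : (fun x => f x - (t * w x + p x)) = fun x => - t * w x + (f x - p x).
  by apply/funext => x; ring.
have lowO j : (j < N)%N -> ip E (fun x => f x - (t * w x + p x)) (e j) = 0.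
  by move=> jN; rewrite fE ipD// sO// pO// mulr0 addr0.
have sall : sqr_int E (fun x => f x - (t * w x + p x)) by rewrite fE; exact: sqr_intD.
move=> j; rewrite ltnS leq_eqVlt => /predU1P[->|]; last exact: lowO.
have eE : e N = fun x => 1 * w x + q x by apply/funext => x; rewrite /w mul1r subrK.
have qz : ip E (fun x => f x - (t * w x + p x)) q = 0.
  have [b bE] := sq; rewrite (_ : q = fun x => \sum_(i < N) b i * e i x); last exact/funext.
  rewrite ip_sumr//; last by move=> i; exact: sqr_intZ.
  rewrite big1// => i _; rewrite ipC.
  have := ipD (b i) (se i) sqr_int0 sall.
  rewrite (_ : (fun x => b i * e i x + 0) = fun x => b i * e i x); last by apply/funext => x; rewrite addr0.
  move=> ->; rewrite (ipC (e i)) lowO ?ltn_ord// mulr0 add0r /ip.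
  by under eq_Rintegral do rewrite mul0r; rewrite /Rintegral integral0.
rewrite eE ipC ipD// (ipC q) qz addr0 mul1r ipC fE ipD//.
rewrite /t; case: ifPn => [/eqP w0|w0]; first by rewrite oppr0 mul0r add0r ip0_orth.
by rewrite mulNr divfK// addNr.
Qed.

(** The index n codes the pair of exponents by division by d. Pairs of total degree d or more give
    the zero function, so that the simple range n < d * d covers all monomials of total degree below
    d. *)
Definition monomial (d n : nat) (x : mpt) : R :=
  if (n %/ d + n %% d < d)%N then x.1 ^+ (n %/ d) * x.2 ^+ (n %% d) else 0.

Lemma poly_lt_monomial_index d n : poly_lt d (monomial d n : pt -> R).
Proof.
rewrite /monomial; case: (boolP (n %/ d + n %% d < d)%N) => nd; last exact: poly_lt0.
exact: poly_lt_monomial.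
Qed.

Lemma spanned_poly_lt d N p : spanned (monomial d) N p -> poly_lt d p.
Proof.
move=> [c pE]; rewrite (_ : p = fun x => \sum_(i < N) c i * monomial d i x); last exact/funext.
by apply: poly_lt_sum => i; apply: poly_lt_scale; exact: poly_lt_monomial_index.
Qed.

Lemma ip_poly_lt0 d (f p : mpt -> R) : sqr_int E f -> (forall n, sqr_int E (monomial d n)) ->
  (forall n, (n < d * d)%N -> ip E f (monomial d n) = 0) -> poly_lt d p -> ip E f p = 0.
Proof.
move=> sf sm f0 [c pE].
have mE' i j : (i + j < d)%N -> (fun x : mpt => c i j * (x.1 ^+ i * x.2 ^+ j)) = (fun x => c i j * monomial d (i * d + j) x) /\
    (i * d + j < d * d)%N.
  move=> ijd; have jd : (j < d)%N by exact: leq_ltn_trans (leq_addl i j) ijd.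
  have id_ : (i < d)%N by exact: leq_ltn_trans (leq_addr j i) ijd.
  split.
    apply/funext => x; congr (_ * _); rewrite /monomial divnMDl; last exact: leq_ltn_trans jd.
    rewrite divn_small// addn0.
    by rewrite modnMDl modn_small// ijd.
  by apply: (@leq_trans (i.+1 * d)); [rewrite mulSn addnC ltn_add2r|rewrite leq_mul2r id_ orbT].
have ijd (i : 'I_d) (j : 'I_(d - i)) : (i + j < d)%N by have := ltn_ord j; rewrite ltn_subRL.
have sT (i : 'I_d) (j : 'I_(d - i)) : sqr_int E (fun x : mpt => c i j * (x.1 ^+ i * x.2 ^+ j)).
  by have [-> _] := mE' _ _ (ijd i j); exact: sqr_intZ.
rewrite (_ : p = fun x => \sum_(i < d) \sum_(j < d - i) c i j * (x.1 ^+ i * x.2 ^+ j)); last first.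
  by apply/funext => x; rewrite pE; apply: eq_bigr => i _; apply: eq_bigr => j _; rewrite mulrA.
rewrite ip_sumr//; last by move=> i; apply: sqr_int_sum.
rewrite big1// => i _; rewrite ip_sumr// big1// => j _.
have [-> lt] := mE' _ _ (ijd i j); rewrite ipC.
rewrite (_ : (fun x => c i j * _) = fun x => c i j * monomial d (i * d + j) x + 0); last first.
  by apply/funext => x; rewrite addr0.
rewrite ipD//; last exact: sqr_int0.
rewrite ipC f0// mulr0 add0r /ip.
by under eq_Rintegral do rewrite mul0r; rewrite /Rintegral integral0.
Qed.

End Projection.

(** * The projector on tensor fields *)

Section PiE.
Variable R : realType.
Local Notation pt := (R * R)%type.
Local Notation mpt := (measurableTypeR R * measurableTypeR R)%type.
Local Notation mu := (leb2 R).

Lemma continuous_sqr_int (E : set mpt) (f : pt -> R) : open (E : set pt) ->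
  bounded_set (E : set pt) -> continuous f -> measurable_fun setT (f : mpt -> R) -> sqr_int E f.
Proof.
move=> oE bE cf mf; have mE := open_measurable2 oE; have muE := leb2_bounded_lty mE bE.
split; first exact: measurable_funTS.
have [M M0 EM] := bounded_sub_box bE.
pose K : set pt := `[- M, M]%classic `*` `[- M, M]%classic.
have cK : compact K by apply: compact_setX; exact: segment_compact.
have cfK : {within K, continuous f} by exact: continuous_subspaceT.
have /compact_bounded[C [_ HC]] := continuous_compact cfK cK.
pose C' := `|C| + 1.
have fC x : E x -> `|f x| <= C'.
  move=> /EM[]; rewrite /= !sub0r !add0r => /andP[a1 a2] /andP[b1 b2].
  apply: HC; first by rewrite /C' ltr_pwDr// ler_norm.
  by exists x => //=; split; rewrite /= in_itv/= !ltW.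
apply: (@le_lt_trans _ _ (\int[mu]_(x in E) (cst (C' ^+ 2)%:E) x)%E).
  apply: ge0_le_integral_EFin => //.
  - by apply: measurable_funX; exact: measurable_funTS.
  - by move=> x _; exact: sqr_ge0.
  move=> x Ex; rewrite -[f x ^+ 2]real_normK ?num_real// lerXn2r ?nnegrE//; last exact: fC.
  exact: le_trans (fC x Ex).
rewrite integral_cst//; apply: lte_mul_pinfty => //; rewrite lee_fin; exact: sqr_ge0.
Qed.

Lemma poly_sqr_int (E : set mpt) d p : open (E : set pt) ->
  bounded_set (E : set pt) -> poly_lt d p -> sqr_int E p.
Proof.
move=> oE bE [c pE]; have mE := open_measurable2 oE.
have H i j : sqr_int E (fun x : mpt => x.1 ^+ i * x.2 ^+ j).
  have ci : continuous (fun y : R => y ^+ i) := smooth1_continuous (smooth1_pow R i).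
  have cj : continuous (fun y : R => y ^+ j) := smooth1_continuous (smooth1_pow R j).
  apply: (@continuous_sqr_int E (tens (fun y => y ^+ i) (fun y => y ^+ j))) => //.
    exact: continuous_tens.
  exact: (measurable_prod2 ci cj).
rewrite (_ : p = fun x => \sum_(i < d) \sum_(j < d - i) c i j * (x.1 ^+ i * x.2 ^+ j)); last first.
  by apply/funext => x; rewrite pE; apply: eq_bigr => i _; apply: eq_bigr => j _; rewrite mulrA.
apply: (sqr_int_sum mE) => i; apply: (sqr_int_sum mE) => j; exact: (sqr_intZ mE).
Qed.

Lemma monomial_sqr_int (E : set mpt) d n : open (E : set pt) ->
  bounded_set (E : set pt) -> sqr_int E (@monomial R d n).
Proof. by move=> oE bE; apply: poly_sqr_int => //; exact: poly_lt_monomial_index. Qed.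

Definition sqr_intM (E : set mpt) m n (u : mpt -> 'M[R]_(m, n)) : Prop :=
  forall i j, sqr_int E (fun x => u x i j).

Lemma ddot_integral (E : set mpt) m n (u v : mpt -> 'M[R]_(m, n)) : measurable E ->
  sqr_intM E u -> sqr_intM E v ->
  \int[mu]_(x in E) ddot (u x) (v x) = \sum_i \sum_j ip E (fun x => u x i j) (fun x => v x i j) /\
  mu.-integrable E (fun x => (ddot (u x) (v x))%:E).
Proof.
move=> mE su sv.
have iij i j := ip_integrable mE (su i j) (sv i j).
have iS (N : nat) (f : 'I_N -> mpt -> R) : (forall i, mu.-integrable E (EFin \o f i)) ->
   \int[mu]_(x in E) (\sum_i f i x) = \sum_i \int[mu]_(x in E) f i x /\
   mu.-integrable E (fun x => (\sum_i f i x)%:E).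
  elim: N f => [|N IH] f fi.
    rewrite big_ord0 /Rintegral; split.
      by under eq_integral do rewrite big_ord0; rewrite integral0.
    by under eq_fun do rewrite big_ord0; exact: integrable0.
  have [IE Ii] := IH (fun i => f (widen_ord (leqnSn N) i)) (fun i => fi _).
  split; last first.
    have := integrableD mE Ii (fi ord_max); apply: eq_integrable => // x _ /=.
    by rewrite big_ord_recr.
  rewrite big_ord_recr/= -IE -RintegralD//.
  by apply: eq_Rintegral => x _; rewrite big_ord_recr.
have Irow i := iS n (fun j x => u x i j * v x i j) (iij i).
have [H1 H2] := iS m (fun i x => \sum_j u x i j * v x i j) (fun i => (Irow i).2).
split; last exact: H2.
by rewrite [LHS]H1; apply: eq_bigr => i _; rewrite (Irow i).1.
Qed.

Lemma poly_ltM_sqr_int (E : set mpt) d m n (q : pt -> 'M[R]_(m, n)) : open (E : set pt) ->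
  bounded_set (E : set pt) -> poly_ltM d q -> sqr_intM E q.
Proof. by move=> oE bE pq i j; exact: poly_sqr_int (pq i j). Qed.

Lemma sqr_intMB (E : set mpt) m n (u v : mpt -> 'M[R]_(m, n)) : measurable E ->
  sqr_intM E u -> sqr_intM E v -> sqr_intM E (fun x => u x - v x).
Proof.
move=> mE su sv i j.
rewrite (_ : (fun _ => _) = fun x => u x i j - v x i j); last by apply/funext => x; rewrite !mxE.
exact: (sqr_intB mE (su i j) (sv i j)).
Qed.

(** [PiE] is chosen by [xget] with default value 0, so that its defining property holds once some
    projection exists. One is assembled from scalar projections of the entries. *)
Lemma PiE_spec k (E : polygon R) (tau : pt -> 'M[R]_2) : open (pdom E) -> bounded_set (pdom E) ->
  sqr_intM (pdom E) tau ->
  poly_ltM k.+1 (PiE k E tau) /\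
    forall r : pt -> 'M[R]_2, poly_ltM k.+1 r ->
      \int[mu]_(x in pdom E) ddot (tau x - PiE k E tau x) (r x) = 0.
Proof.
move=> oE bE st; have mE := open_measurable2 oE.
rewrite /PiE; case: xgetP => [q _ //|/= none]; exfalso.
have sm n := monomial_sqr_int k.+1 n oE bE.
have H (ij : 'I_2 * 'I_2) : exists p : pt -> R, spanned (@monomial R k.+1) (k.+1 * k.+1) p /\
    forall n, (n < k.+1 * k.+1)%N -> ip (pdom E) (fun x => tau x ij.1 ij.2 - p x) (@monomial R k.+1 n) = 0.
  have [p sp pO] := projection_exists mE (k.+1 * k.+1) sm (st ij.1 ij.2).
  by exists p.
have [f hf] := choice H.
pose q (x : pt) : 'M[R]_2 := \matrix_(i, j) f (i, j) x.
have pq : poly_ltM k.+1 q.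
  move=> i j; have [sp _] := hf (i, j).
  rewrite (_ : (fun x => q x i j) = f (i, j)); last by apply/funext => x; rewrite mxE.
  exact: spanned_poly_lt sp.
apply: (none q); split => // r pr.
have sr := poly_ltM_sqr_int oE bE pr; have sq := poly_ltM_sqr_int oE bE pq.
have stq := sqr_intMB mE st sq.
have [-> _] := ddot_integral mE stq sr.
rewrite big1// => i _; rewrite big1// => j _.
apply: (ip_poly_lt0 mE (stq i j) sm _ (pr i j)) => n nk.
have [_ /(_ n nk) hij] := hf (i, j); rewrite -[RHS]hij; congr ip.
by apply/funext => x; rewrite !mxE.
Qed.

(** Pythagoras: q - P is polynomial, where P is the projection of tau, hence orthogonal to tau -
    P. *)
Lemma PiE_quasi_optimal k (E : polygon R) (tau q : pt -> 'M[R]_2) : open (pdom E) ->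
  bounded_set (pdom E) -> sqr_intM (pdom E) tau -> poly_ltM k.+1 q ->
  (\int[mu]_(x in pdom E) (frob (q x - PiE k E tau x) ^+ 2)%:E <=
   \int[mu]_(x in pdom E) (frob (q x - tau x) ^+ 2)%:E)%E.
Proof.
move=> oE bE st pq; have mE := open_measurable2 oE.
have [pP oP] := PiE_spec k oE bE st.
set P := PiE k E tau in pP oP *.
have sP := poly_ltM_sqr_int oE bE pP; have sq := poly_ltM_sqr_int oE bE pq.
have pqP : poly_ltM k.+1 (fun x => q x - P x).
  move=> i j; rewrite (_ : (fun _ => _) = fun x => q x i j + -1 * P x i j); last first.
    by apply/funext => x; rewrite !mxE mulN1r.
  by apply: poly_lt_add => //; exact: poly_lt_scale.
have sqP := sqr_intMB mE sq sP; have stP := sqr_intMB mE st sP.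
have sqt := sqr_intMB mE sq st.
have [_ i1] := ddot_integral mE sqP sqP.
have [_ i2] := ddot_integral mE stP stP.
have [_ i3] := ddot_integral mE stP sqP.
have [_ i4] := ddot_integral mE sqt sqt.
under eq_integral do rewrite frob_sqr.
under [leRHS]eq_integral do rewrite frob_sqr.
rewrite -EFin_Rint// -EFin_Rint// lee_fin.
have -> : \int[mu]_(x in pdom E) ddot (q x - tau x) (q x - tau x) =
   \int[mu]_(x in pdom E) ddot (q x - P x) (q x - P x) +
   \int[mu]_(x in pdom E) ddot (tau x - P x) (tau x - P x) -
   2 * \int[mu]_(x in pdom E) ddot (tau x - P x) (q x - P x).
  rewrite -RintegralZl// -RintegralD// -RintegralB//.
  - apply: eq_Rintegral => x _; rewrite /ddot mulr_sumr -!big_split -sumrN -big_split/=.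
    apply: eq_bigr => i _; rewrite mulr_sumr -!big_split -sumrN -big_split/=.
    by apply: eq_bigr => j _; rewrite !mxE; ring.
  - exact: (integrableD mE i1 i2).
  - exact: (integrableZl mE 2 i3).
rewrite (oP _ pqP) mulr0 subr0 lerDl; apply: Rintegral_ge0 => x _; exact: ddot_ge0.
Qed.

End PiE.

(** * From the cells to the domain *)

Section Meshes.
Variable R : realType.
Local Notation pt := (R * R)%type.
Local Notation mpt := (measurableTypeR R * measurableTypeR R)%type.
Local Notation mu := (leb2 R).

(** Off the null set of cell boundaries, each point of D lies in exactly one open cell, so that the
    restrictions of f to the cells add up to f. *)
Lemma mesh_integral (D : set pt) (T : mesh R) (f : mpt -> \bar R) : open D ->
  is_mesh D T -> measurable_fun (D : set mpt) f -> (forall x, D x -> 0 <= f x)%E ->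
  (\int[mu]_(x in D) f x = \sum_(j < ncell T) \int[mu]_(x in pdom (cell T j)) f x)%E.
Proof.
move=> oD mT mf f0; have mD := open_measurable2 oD.
have [Tp TD Tdisj _] := mT.
have mE j : measurable (pdom (cell T j) : set mpt).
  by apply: open_measurable2; have [[_ oE _ _] _ _ _ _] := Tp j.
have mfE j : measurable_fun setT (f \_ (pdom (cell T j))).
  by apply/(measurable_restrictT _ (mE j)); apply: measurable_funS mf.
have fE0 j x : (0 <= (f \_ (pdom (cell T j))) x)%E.
  by rewrite patchE; case: ifPn => // /set_mem/TD/f0.
rewrite integral_mkcond.
transitivity (\int[mu]_x \sum_(j < ncell T) (f \_ (pdom (cell T j))) x)%E; last first.
  by rewrite ge0_integral_sum//; apply: eq_bigr => j _; rewrite [RHS]integral_mkcond.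
apply: ge0_ae_eq_integral => //.
- exact/(measurable_restrictT _ mD).
- exact: emeasurable_sum.
- by move=> x _; rewrite patchE; case: ifPn => // /set_mem/f0.
- by move=> x _; apply: sume_ge0 => j _; exact: fE0.
have [N [mN N0 subN]] := mesh_cover mT.
exists N; split => // x nx; apply: subN => cov; apply: nx => _.
have [Dx|nD] := pselect (D x); last first.
  rewrite patchE memNset// big1// => j _; rewrite patchE memNset//.
  by move=> /TD.
have [j Ej] := cov Dx; rewrite patchE mem_set// (bigD1 j)//= patchE mem_set//.
rewrite big1 ?adde0// => i ij; rewrite patchE memNset// => Ei.
by have : (pdom (cell T i) `&` pdom (cell T j)) x by []; rewrite Tdisj.
Qed.

Lemma le_mesh_size (T : mesh R) j : diam (pdom (cell T j)) <= mesh_size T.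
Proof. exact: (@le_bigmax _ _ _ 0 (fun j => diam (pdom (cell T j))) j). Qed.

Lemma PihE k (D : set pt) (T : mesh R) tau j x : is_mesh D T -> pdom (cell T j) x ->
  Pih k T tau x = PiE k (cell T j) tau x.
Proof.
move=> [_ _ Tdisj _] Ex; rewrite /Pih (bigD1 j) ?mem_set//=.
rewrite big1 ?addr0// => i /andP[/set_mem Ei ij].
by have : (pdom (cell T i) `&` pdom (cell T j)) x by []; rewrite Tdisj.
Qed.

Lemma inLpM_measurable m n (D : set pt) (u : pt -> 'M[R]_(m, n)) : inLpM 2%:E D u ->
  forall i j, measurable_fun setT ((fun x : mpt => u x i j) \_ D).
Proof. by move=> Lu i j; have [mg _] := inLp2P (Lu i j). Qed.

Lemma inLpM_sqr_intM m n (D E : set pt) (u : pt -> 'M[R]_(m, n)) : open D -> open E -> E `<=` D ->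
  inLpM 2%:E D u -> sqr_intM E u.
Proof.
move=> oD oE ED Lu i j; have [mg g2] := inLp2P (Lu i j).
have mE := open_measurable2 oE; have mD := open_measurable2 oD.
split; first exact: (measurable_restrict_sub ED mE mg).
apply: le_lt_trans g2; apply: (@ge0_subset_integral _ _ _ mu _ _ mE mD) => //.
- apply/measurable_EFinP; apply: measurable_funX.
  exact: (measurable_restrict_sub (@subset_refl _ D) mD mg).
- by move=> x _; rewrite lee_fin sqr_ge0.
Qed.

Lemma measurable_quot_integral m n (D E : set pt) w (u : pt -> 'M[R]_(m, n)) : open D -> open E ->
  E `<=` D -> inLpM 2%:E D u ->
  measurable_fun (D : set mpt) (fun x => \int[mu]_(y in E) (quot w u x y ^+ 2)%:E)%E.
Proof.
move=> oD oE ED Lu; have mE := open_measurable2 oE; have mD := open_measurable2 oD.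
have mv i j : measurable_fun setT (fun x : mpt => restr D u x i j).
  have -> : (fun x : mpt => restr D u x i j) = (fun x => u x i j) \_ D by apply/funext => x; rewrite mxE.
  exact: (inLpM_measurable Lu).
pose F (p : mpt * mpt) : \bar R := (\1_E p.2 * quot w (restr D u) p.1 p.2 ^+ 2)%:E.
have mF : measurable_fun setT F.
  apply/measurable_EFinP; apply: measurable_funM; last exact: measurable_quot2.
  by apply: (measurableT_comp _ measurable_snd); exact: measurable_indic.
have F0 p : (0 <= F p)%E by rewrite lee_fin mulr_ge0// sqr_ge0.
pose I (y : mpt) : \bar R := (\int[leb2s R]_x F (y, x))%E.
have mI : measurable_fun setT I by exact: (@measurable_fun_fubini_tonelli_F _ _ mpt mpt R (leb2s R) F mF F0).
apply: (eq_measurable_fun I); last exact: measurable_funTS.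
move=> y /set_mem Dy; rewrite [RHS]integral_mkcond; apply: eq_integral => x _.
rewrite patchE /F /= indicE; case: ifPn => [/set_mem/ED Dx|_]; last by rewrite mul0r.
by rewrite mul1r /quot !restrE.
Qed.

Lemma measurable_quot1 m n (D : set pt) w (u : pt -> 'M[R]_(m, n)) x : open D ->
  D x -> inLpM 2%:E D u ->
  measurable_fun (D : set mpt) (fun y => quot w u x y ^+ 2).
Proof.
move=> oD Dx Lu; have mD := open_measurable2 oD.
have mv i j : measurable_fun setT (fun x : mpt => restr D u x i j).
  have -> : (fun x : mpt => restr D u x i j) = (fun x => u x i j) \_ D by apply/funext => y; rewrite mxE.
  exact: (inLpM_measurable Lu).
apply: (@eq_measurable_fun _ _ _ _ _ (fun y => quot w (restr D u) x y ^+ 2)).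
  by move=> y /set_mem Dy; rewrite /quot !restrE.
apply: measurable_funTS; exact: (measurableT_comp (measurable_quot2 w mv) (pair1_measurable x)).
Qed.

(** The quantity whose infimum over g is [normH]. Fixing g means that the same weak derivatives are
    used on every cell. *)
Definition sobolev_norm m n s (D : set pt) (g : nat -> nat -> pt -> 'M[R]_(m, n)) : \bar R :=
  let r := Num.truncn s in let theta := s - r%:R in
  (((\sum_(a < r.+1) \sum_(b < r.+1 - a) normLpM 2%:E D (g a b) ^+ 2) +
          (if (theta == 0)%R then 0 else
             \sum_(a < r.+1) frac_seminorm 2%:E (1 + theta)%R D
                               (g a (r - a)%N) ^+ 2)) `^ 2^-1%R)%E.

(** For an integer s the derivatives of order s are among the terms of the norm. Otherwise, the
    integrals over E x E, for the various cells E, are taken over disjoint parts of D x D. *)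
Lemma mesh_energy m n s (D : set pt) (T : mesh R) u (g : nat -> nat -> pt -> 'M[R]_(m, n)) :
  open D -> is_mesh D T -> weak_partials 2%:E D (Num.truncn s) u g ->
  (\sum_(j < ncell T) cell_energy s (pdom (cell T j)) g <= sobolev_norm s D g ^+ 2)%E.
Proof.
move=> oD mT [_ wp]; have mD := open_measurable2 oD; have [Tp TD _ _] := mT.
have oE j : open (pdom (cell T j)) by have [[_ oE _ _] _ _ _ _] := Tp j.
have mE j := open_measurable2 (oE j).
rewrite /sobolev_norm /cell_energy; set r := Num.truncn s; set th := s - r%:R.
have P1 : (0 <= \sum_(a < r.+1) \sum_(b < r.+1 - a) normLpM 2%:E D (g a b) ^+ 2)%E.
  by do 2!(apply: sume_ge0 => ? _); apply: expe_ge0; exact: normLpM_ge0.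
have Lg (a : 'I_r.+1) : inLpM 2%:E D (g a (r - a)%N).
  by have [] := wp a (r - a)%N; rewrite ?subnKC// -ltnS.
rewrite sqre_sqrte; last first.
  apply: adde_ge0 => //; case: ifP => // _; apply: sume_ge0 => a _; apply: expe_ge0.
  exact: Lnorm_ge0.
case: ifPn => th0.
  rewrite adde0 exchange_big/=; apply: lee_sum => a _.
  have mfr : measurable_fun (D : set mpt) (fun x => (frob (g a (r - a)%N x) ^+ 2)%:E).
    apply/measurable_EFinP; apply: measurable_frob2 => i j.
    exact: (measurable_restrict_sub (@subset_refl _ D) mD (inLpM_measurable (Lg a) i j)).
  rewrite -(mesh_integral oD mT mfr); last by move=> x _; rewrite lee_fin sqr_ge0.
  rewrite -normLpM2_sqr.
  have ra : (r - a < r.+1 - a)%N by rewrite ltn_sub2r// ltnS -ltnS.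
  rewrite (bigD1 (Ordinal ra))//=; apply: leeDl; apply: sume_ge0 => b _.
  by apply: mule_ge0; exact: normLpM_ge0.
apply: (@le_trans _ _ (\sum_(a < r.+1) frac_seminorm 2%:E (1 + th) D (g a (r - a)%N) ^+ 2)%E); last exact: leeDr.
rewrite exchange_big; apply: lee_sum => a _; rewrite frac_seminorm2_sqr.
have m1 := measurable_quot_integral (1 + th) oD oD (@subset_refl _ D) (Lg a).
rewrite (mesh_integral oD mT m1); last first.
  by move=> x _; apply: integral_ge0 => y _; rewrite lee_fin sqr_ge0.
apply: lee_sum => j _.
apply: ge0_le_integral => //.
- by move=> x _; apply: integral_ge0 => y _; rewrite lee_fin sqr_ge0.
- apply: measurable_funS (TD j) (measurable_quot_integral (1 + th) oD (oE j) (TD j) (Lg a)) => //.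
- exact: measurable_funS (TD j) m1.
move=> x /TD Dx; apply: ge0_subset_integral => //; last by move=> y _; rewrite lee_fin sqr_ge0.
by apply/measurable_EFinP; exact: measurable_quot1.
Qed.

(** One copy of the constant of [scalar_estimate] for each of the m n entries. The added 1 makes it
    positive, so that its product with an infinite energy is infinite. *)
Definition cell_const (m n r : nat) (eta B : R) : R :=
  (m * n)%:R * (bh_const eta B ^+ r * (1 + 2 / eta ^+ 2)) + 1.

Lemma cell_const_gt0 m n r eta B : 0 < cell_const m n r eta B.
Proof.
rewrite /cell_const ltr_wpDl//; apply: mulr_ge0 => //; apply: mulr_ge0.
  by apply: exprn_ge0; exact: bh_const_ge0.
by apply: addr_ge0 => //; apply: divr_ge0 => //; exact: sqr_ge0.
Qed.

Lemma cell_estimate m n k s (D E : set pt) c eta h B u (g : nat -> nat -> pt -> 'M[R]_(m, n)) :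
  open D -> E `<=` D -> 0 < eta -> cell_geometry E c (eta * h / 2) h ->
  (forall y : R, `|moll y| <= B /\ `|derive1 (@moll R) y| <= B) ->
  1 <= s <= k.+1%:R -> weak_partials 2%:E D (Num.truncn s) u g ->
  exists q : pt -> 'M[R]_(m, n), poly_ltM k.+1 q /\
    (\int[mu]_(x in E) (frob (u x - q x) ^+ 2)%:E <=
     (cell_const m n (Num.truncn s) eta B * (h `^ s) ^+ 2)%:E * cell_energy s E g)%E.
Proof.
move=> oD ED eta0 gE hB sP wp.
have [oE bE] := (cg_open gE, cg_bounded gE); have mE := open_measurable2 oE.
have h0 := cg_h0 gE.
have KH0 : 0 < cell_const m n (Num.truncn s) eta B * (h `^ s) ^+ 2.
  by apply: mulr_gt0; [exact: cell_const_gt0|rewrite exprn_gt0// powR_gt0].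
have [eoo|efin] := eqVneq (cell_energy s E g) +oo%E.
  exists (fun=> 0); split.
    by move=> i j; under eq_fun do rewrite mxE; exact: poly_lt0.
  by rewrite eoo gt0_muley ?leey// lte_fin.
have e0 := cell_energy_ge0 s E g.
have {}efin : cell_energy s E g \is a fin_num by rewrite ge0_fin_numE// lt_neqAle efin leey.
set W := fine (cell_energy s E g).
have WE : cell_energy s E g = W%:E by rewrite fineK.
have W0 : 0 <= W by rewrite -lee_fin -WE.
have eW : (cell_energy s E g <= W%:E)%E by rewrite WE.
have H (ij : 'I_m * 'I_n) := scalar_estimate oD ED eta0 gE hB sP wp ij.1 ij.2 W0 eW.
have [f hf] := choice H.
exists (fun x => \matrix_(i, j) f (i, j) x); split.
  move=> i j; rewrite (_ : (fun _ => _) = f (i, j)); last by apply/funext => x; rewrite mxE.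
  by have [] := hf (i, j).
have su : sqr_intM E u.
  by apply: (inLpM_sqr_intM oD) => //; have [<- /(_ 0%N 0%N isT)[]] := wp.
have sf i j : sqr_int E (f (i, j)) by apply: (poly_sqr_int oE bE (hf (i, j)).1).
have sd i j : sqr_int E (fun x => u x i j - f (i, j) x) := sqr_intB mE (su i j) (sf i j).
have md i j : measurable_fun E (fun x : mpt => ((u x i j - f (i, j) x) ^+ 2)%:E).
  by apply/measurable_EFinP; apply: measurable_funX; have [] := sd i j.
have d0 i j x : (0 <= ((u x i j - f (i, j) x) ^+ 2)%:E)%E by rewrite lee_fin sqr_ge0.
have -> : (\int[mu]_(x in E) (frob (u x - \matrix_(i, j) f (i, j) x) ^+ 2)%:E =
   \sum_i \sum_j \int[mu]_(x in E) ((u x i j - f (i, j) x) ^+ 2)%:E)%E.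
  transitivity (\int[mu]_(x in E) \sum_i \sum_j ((u x i j - f (i, j) x) ^+ 2)%:E)%E.
    apply: eq_integral => x _; rewrite frob_sqr ddotE -sumEFin; apply: eq_bigr => i _.
    by rewrite -sumEFin; apply: eq_bigr => j _; rewrite !mxE.
  rewrite ge0_integral_sum//; last 2 first.
  - by move=> i; apply: emeasurable_sum => j; exact: md.
  - by move=> i x _; apply: sume_ge0 => j _.
  by apply: eq_bigr => i _; rewrite ge0_integral_sum// => j; exact: md.
set A := bh_const eta B ^+ Num.truncn s * (1 + 2 / eta ^+ 2).
apply: (@le_trans _ _ (\sum_(i < m) \sum_(j < n) (A * ((h `^ s) ^+ 2 * W))%:E)%E).
  by apply: lee_sum => i _; apply: lee_sum => j _; have [] := hf (i, j).
under eq_bigr do rewrite sumEFin.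
rewrite sumEFin WE -EFinM lee_fin !sumr_const !card_ord -mulrnA mulnC -mulr_natl.
rewrite /cell_const -/A.
have HW : 0 <= (h `^ s) ^+ 2 * W by rewrite mulr_ge0// sqr_ge0.
by rewrite -[leRHS]mulrA mulrDl mul1r -[_ * A * _]mulrA lerDl.
Qed.

End Meshes.

(** * The pressure error in terms of the other errors *)

Section Pressure.
Variable R : realType.
Local Notation pt := (R * R)%type.
Local Notation mpt := (measurableTypeR R * measurableTypeR R)%type.
Local Notation mu := (leb2 R).

Lemma frob2_triangle m n (A B C : 'M[R]_(m, n)) :
  frob (A - C) ^+ 2 <= 2 * frob (A - B) ^+ 2 + 2 * frob (B - C) ^+ 2.
Proof.
rewrite !frob_sqr !ddotE !mulr_sumr -big_split/=; apply: ler_sum => i _.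
rewrite !mulr_sumr -big_split/=; apply: ler_sum => j _; rewrite !mxE.
have := sqr_ge0 ((A i j - B i j) - (B i j - C i j)); nra.
Qed.

Lemma frob2_sym m n (A B : 'M[R]_(m, n)) : frob (A - B) ^+ 2 = frob (B - A) ^+ 2.
Proof.
rewrite !frob_sqr !ddotE; apply: eq_bigr => i _; apply: eq_bigr => j _.
by rewrite !mxE -sqrrN opprB.
Qed.

Lemma measurable_sqr_intM (E : set mpt) m n (u : mpt -> 'M[R]_(m, n)) : sqr_intM E u ->
  measurable_fun E (fun x => frob (u x) ^+ 2).
Proof. by move=> su; apply: measurable_frob2 => i j; have [] := su i j. Qed.

Lemma frob2_integral_triangle (E : set mpt) m n (u v w : mpt -> 'M[R]_(m, n)) : measurable E ->
  sqr_intM E u -> sqr_intM E v -> sqr_intM E w ->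
  (\int[mu]_(x in E) (frob (u x - w x) ^+ 2)%:E <=
   2%:E * \int[mu]_(x in E) (frob (u x - v x) ^+ 2)%:E +
   2%:E * \int[mu]_(x in E) (frob (v x - w x) ^+ 2)%:E)%E.
Proof.
move=> mE su sv sw.
have muw := measurable_sqr_intM (sqr_intMB mE su sw).
have muv := measurable_sqr_intM (sqr_intMB mE su sv).
have mvw := measurable_sqr_intM (sqr_intMB mE sv sw).
have m1 : measurable_fun E (fun x => 2 * frob (u x - v x) ^+ 2).
  by apply: measurable_funM => //; exact: measurable_cst.
have m2 : measurable_fun E (fun x => 2 * frob (v x - w x) ^+ 2).
  by apply: measurable_funM => //; exact: measurable_cst.
have g1 x : E x -> 0 <= frob (u x - v x) ^+ 2 by move=> _; exact: sqr_ge0.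
have g2 x : E x -> 0 <= frob (v x - w x) ^+ 2 by move=> _; exact: sqr_ge0.
rewrite -(ge0_integralZ_EFin mu mE muv g1 (ler0n R 2)) -(ge0_integralZ_EFin mu mE mvw g2 (ler0n R 2)).
rewrite -ge0_integralD_EFin//; last 2 first.
- by move=> x Ex; apply: mulr_ge0 => //; exact: g1.
- by move=> x Ex; apply: mulr_ge0 => //; exact: g2.
apply: ge0_le_integral_EFin => //.
- exact: measurable_funD.
- by move=> x _; exact: sqr_ge0.
- by move=> x _; exact: frob2_triangle.
Qed.

Lemma ge0_muleD_2_22 (x y : \bar R) : (0 <= x)%E -> (0 <= y)%E ->
  (2%:E * x + 2%:E * (2%:E * x + 2%:E * y) = 6%:E * x + 4%:E * y)%E.
Proof.
move=> x0 y0; have x2 : (0 <= 2%:E * x)%E by rewrite mule_ge0.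
have y2 : (0 <= 2%:E * y)%E by rewrite mule_ge0.
rewrite (ge0_muleDr 2%:E x2 y2) !muleA addeA -!EFinM -ge0_muleDl ?lee_fin//.
by rewrite -EFinD -!natrM -natrD.
Qed.

(** The triangle inequality is used in the form |a + b|^2 <= 2 |a|^2 + 2 |b|^2, through q and then,
    after quasi-optimality, through sigma; hence the coefficients 2 + 2 * 2 = 6 and 2 * 2 = 4. *)
Lemma tensor_cell k s (D : set pt) (E : polygon R) c eta h B sigma tau
    (g : nat -> nat -> pt -> 'M[R]_2) :
  open D -> pdom E `<=` D -> 0 < eta -> cell_geometry (pdom E) c (eta * h / 2) h ->
  (forall y : R, `|moll y| <= B /\ `|derive1 (@moll R) y| <= B) ->
  1 <= s <= k.+1%:R -> weak_partials 2%:E D (Num.truncn s) sigma g ->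
  inLpM 2%:E D tau ->
  (\int[mu]_(x in pdom E) (frob (sigma x - PiE k E tau x) ^+ 2)%:E <=
   (6 * (cell_const 2 2 (Num.truncn s) eta B * (h `^ s) ^+ 2))%:E * cell_energy s (pdom E) g +
   4%:E * \int[mu]_(x in pdom E) (frob (sigma x - tau x) ^+ 2)%:E)%E.
Proof.
move=> oD ED eta0 gE hB sP wp Lt.
have [q [pq hq]] := cell_estimate oD ED eta0 gE hB sP wp.
have [oE bE] := (cg_open gE, cg_bounded gE); have mE := open_measurable2 oE.
have ssig : sqr_intM (pdom E) sigma.
  by apply: (inLpM_sqr_intM oD) => //; have [<- /(_ 0%N 0%N isT)[]] := wp.
have stau := inLpM_sqr_intM oD oE ED Lt.
have sq := poly_ltM_sqr_int oE bE pq.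
have [pP _] := PiE_spec k oE bE stau; have sP' := poly_ltM_sqr_int oE bE pP.
have qo := PiE_quasi_optimal oE bE stau pq.
apply: (le_trans (frob2_integral_triangle mE ssig sq sP')).
apply: (@le_trans _ _ (2%:E * \int[mu]_(x in pdom E) (frob (sigma x - q x) ^+ 2)%:E +
   2%:E * (2%:E * \int[mu]_(x in pdom E) (frob (sigma x - q x) ^+ 2)%:E +
     2%:E * \int[mu]_(x in pdom E) (frob (sigma x - tau x) ^+ 2)%:E))%E).
  apply: leeD => //; apply: lee_wpmul2l => //; apply: (le_trans qo).
  apply: (le_trans (frob2_integral_triangle mE sq ssig stau)).
  by apply: leeD => //; under eq_integral do rewrite frob2_sym.
have I0 (v : pt -> 'M[R]_2) : (0 <= \int[mu]_(x in pdom E) (frob (v x) ^+ 2)%:E)%E.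
  by apply: integral_ge0 => x _; rewrite lee_fin sqr_ge0.
rewrite ge0_muleD_2_22//; apply: leeD => //; rewrite EFinM -muleA.
by apply: lee_wpmul2l; rewrite ?lee_fin.
Qed.

Lemma sqr_tr_le (A : 'M[R]_2) : \tr A ^+ 2 <= 2 * frob A ^+ 2.
Proof.
rewrite frob_sqr ddotE /mxtrace !big_ord_recl !big_ord0 !addr0.
set a := A 0 0; set b := A _ _; set c := A _ 0; set d := A _ _.
have := sqr_ge0 (a - d); have := sqr_ge0 b; have := sqr_ge0 c; nra.
Qed.

Lemma sqr_tr_otimes_le (u v : 'cV[R]_2) : \tr (otimes u v) ^+ 2 <= frob u ^+ 2 * frob v ^+ 2.
Proof.
rewrite !frob_sqr !ddotE /otimes /mxtrace !big_ord_recl !big_ord0 !addr0 !mxE !big_ord1 !mxE.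
set a := u _ _; set b := v _ _; set c := u _ _; set d := v _ _.
have := sqr_ge0 (a * d - c * b); nra.
Qed.

(** With t and w the two traces of the differences, (t + w)^2 / 4 <= t^2 / 2 + w^2 / 2. The trace of
    a 2 x 2 matrix satisfies t^2 <= 2 |S - P|^2, and w is the scalar product of u - v and beta, so
    that Cauchy-Schwarz applies. *)
Lemma pressure_pointwise (S P : 'M[R]_2) (u v beta : 'cV[R]_2) (b : R) :
  frob beta <= b ->
  (- 2^-1 * (\tr S + \tr (otimes u beta)) - - 2^-1 * (\tr P + \tr (otimes v beta))) ^+ 2 <=
  frob (S - P) ^+ 2 + b ^+ 2 / 2 * frob (u - v) ^+ 2.
Proof.
move=> bb.
have -> : - 2^-1 * (\tr S + \tr (otimes u beta)) - - 2^-1 * (\tr P + \tr (otimes v beta)) =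
    - 2^-1 * (\tr (S - P) + \tr (otimes (u - v) beta)).
  rewrite /otimes mulmxBl !raddfB/=; move: (\tr S) (\tr P) (\tr _) (\tr _) => ? ? ? ?; ring.
have h1 := sqr_tr_le (S - P); have h2 := sqr_tr_otimes_le (u - v) beta.
have h3 : frob beta ^+ 2 <= b ^+ 2.
  by rewrite lerXn2r// ?nnegrE ?frob_ge0// (le_trans _ bb)// frob_ge0.
have h4 := ler_wpM2l (sqr_ge0 (frob (u - v))) h3.
move: (\tr (S - P)) (\tr (otimes (u - v) beta)) h1 h2 => t w; move: (frob (S - P) ^+ 2) (frob (u - v) ^+ 2) h4 => F U.
have := sqr_ge0 (t - w); nra.
Qed.

(** Squared norms are used because they are additive over the cells. On each cell the power of its
    diameter is replaced by that of the mesh size only at the end, which needs s >= 0. *)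
Lemma pressure_estimate k s chat eta B (D : set pt) (T : mesh R) sigma sigmah
    (u uh beta : pt -> 'cV[R]_2) (p ph : pt -> R) (b : R)
    (g : nat -> nat -> pt -> 'M[R]_2) :
  open D -> 0 < eta -> is_mesh D T -> mesh_regular chat eta T ->
  (forall y : R, `|moll y| <= B /\ `|derive1 (@moll R) y| <= B) ->
  1 <= s <= k.+1%:R -> weak_partials 2%:E D (Num.truncn s) sigma g ->
  inLpM 2%:E D sigmah -> inLpM 2%:E D u -> inLpM 2%:E D uh ->
  inLp 2%:E D p -> inLp 2%:E D ph ->
  {ae mu, forall x, D x -> frob (beta x) <= b} ->
  {ae mu, forall x, D x -> p x = - 2^-1 * (\tr (sigma x) + \tr (otimes (u x) (beta x)))} ->
  {ae mu, forall x, D x ->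
     ph x = - 2^-1 * (\tr (Pih k T sigmah x) + \tr (otimes (uh x) (beta x)))} ->
  (normLp 2%:E D (p \- ph)%R ^+ 2 <=
   (6 * cell_const 2 2 (Num.truncn s) eta B * (mesh_size T `^ s) ^+ 2)%:E * sobolev_norm s D g ^+ 2 +
   (4%:E * normLpM 2%:E D (sigma \- sigmah)%R ^+ 2 +
    (b ^+ 2 / 2)%:E * normLpM 2%:E D (u \- uh)%R ^+ 2))%E.
Proof.
move=> oD eta0 mT rT hB sP wp Lsh Lu Luh Lp Lph betab pE phE.
have mD := open_measurable2 oD; have [Tp TD _ _] := mT.
have oE j : open (pdom (cell T j)) by have [[_ oE _ _] _ _ _ _] := Tp j.
have mE j := open_measurable2 (oE j).
have DD := @subset_refl _ D.
have Ls : inLpM 2%:E D sigma by have [<- /(_ 0%N 0%N isT)[]] := wp.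
have mcomp (f : pt -> R) : inLp 2%:E D f -> measurable_fun (D : set mpt) f.
  by move=> /inLp2P[mf _]; exact: (measurable_restrict_sub DD mD mf).
have mpp : measurable_fun (D : set mpt) (fun x => (p x - ph x) ^+ 2).
  by apply: measurable_funX; apply: measurable_funB; exact: mcomp.
have ssD := inLpM_sqr_intM oD oD DD Ls; have sshD := inLpM_sqr_intM oD oD DD Lsh.
have suD := inLpM_sqr_intM oD oD DD Lu; have suhD := inLpM_sqr_intM oD oD DD Luh.
have mds := measurable_sqr_intM (sqr_intMB mD ssD sshD).
have mdu := measurable_sqr_intM (sqr_intMB mD suD suhD).
have b20 : 0 <= b ^+ 2 / 2 by rewrite divr_ge0// sqr_ge0.
have K0 := cell_const_gt0 2 2 (Num.truncn s) eta B.
set Hs := mesh_size T `^ s.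
rewrite normLp2_sqr !normLpM2_sqr.
rewrite (mesh_integral oD mT (f := fun x => (((p \- ph) x) ^+ 2)%:E)); last 2 first.
- exact/measurable_EFinP.
- by move=> x _; rewrite lee_fin sqr_ge0.
rewrite (mesh_integral oD mT (f := fun x => (frob ((sigma \- sigmah) x) ^+ 2)%:E)); last 2 first.
- exact/measurable_EFinP.
- by move=> x _; rewrite lee_fin sqr_ge0.
rewrite (mesh_integral oD mT (f := fun x => (frob ((u \- uh) x) ^+ 2)%:E)); last 2 first.
- exact/measurable_EFinP.
- by move=> x _; rewrite lee_fin sqr_ge0.
have KH0 : 0 <= 6 * cell_const 2 2 (Num.truncn s) eta B * Hs ^+ 2.
  by apply: mulr_ge0; [apply: mulr_ge0 => //; exact: ltW|exact: sqr_ge0].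
apply: (@le_trans _ _ ((6 * cell_const 2 2 (Num.truncn s) eta B * Hs ^+ 2)%:E *
    (\sum_(j < ncell T) cell_energy s (pdom (cell T j)) g) +
   (4%:E * (\sum_(j < ncell T) \int[mu]_(x in pdom (cell T j)) (frob ((sigma \- sigmah) x) ^+ 2)%:E) +
    (b ^+ 2 / 2)%:E * (\sum_(j < ncell T) \int[mu]_(x in pdom (cell T j)) (frob ((u \- uh) x) ^+ 2)%:E)))%E);
  last first.
  apply: leeD => //; apply: lee_wpmul2l; first by rewrite lee_fin.
  exact: (mesh_energy oD mT wp).
have I0 m n (v : pt -> 'M[R]_(m, n)) j : (0 <= \int[mu]_(x in pdom (cell T j)) (frob (v x) ^+ 2)%:E)%E.
  by apply: integral_ge0 => x _; rewrite lee_fin sqr_ge0.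
rewrite !ge0_sume_distrr; [|by move=> ? _; exact: I0|by move=> ? _; exact: I0|by move=> ? _; exact: cell_energy_ge0].
rewrite -!big_split/=; apply: lee_sum => j _.
have [c gE] := regular_cell_geometry eta0 (Tp j) rT.
have tc := tensor_cell oD (TD j) eta0 gE hB sP wp Lsh.
have bE := cg_bounded gE.
have sshE := inLpM_sqr_intM oD (oE j) (TD j) Lsh.
have ssE := inLpM_sqr_intM oD (oE j) (TD j) Ls.
have [pP _] := PiE_spec k (oE j) bE sshE; have sP' := poly_ltM_sqr_int (oE j) bE pP.
have mP := measurable_sqr_intM (sqr_intMB (mE j) ssE sP').
have mduE : measurable_fun (pdom (cell T j) : set mpt) (fun x => frob (u x - uh x) ^+ 2).
  exact: measurable_funS (TD j) mdu.
have mduE' : measurable_fun (pdom (cell T j) : set mpt) (fun x => b ^+ 2 / 2 * frob (u x - uh x) ^+ 2).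
  by apply: measurable_funM => //; exact: measurable_cst.
apply: (@le_trans _ _ (\int[mu]_(x in pdom (cell T j))
    (frob (sigma x - PiE k (cell T j) sigmah x) ^+ 2 + b ^+ 2 / 2 * frob (u x - uh x) ^+ 2)%:E)%E).
  apply: ae_ge0_le_integral => //.
  - by move=> x _; rewrite lee_fin sqr_ge0.
  - by apply/measurable_EFinP; exact: measurable_funS (TD j) mpp.
  - by move=> x _; rewrite lee_fin addr_ge0 ?sqr_ge0// mulr_ge0// sqr_ge0.
  - by apply/measurable_EFinP; exact: measurable_funD.
  have neg := negligibleU (negligibleU betab pE) phE.
  apply: negligibleS neg => x /= nx.
  apply: contrapT => /not_orP[/not_orP[n1 n2] n3]; apply: nx => Ex.
  have Dx := TD j x Ex.
  have e1 := contrapT n1 Dx; have e2 := contrapT n2 Dx; have e3 := contrapT n3 Dx.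
  by rewrite lee_fin /= e2 e3 (PihE k sigmah mT Ex); exact: pressure_pointwise.
rewrite ge0_integralD_EFin//; last 2 first.
- by move=> x _; exact: sqr_ge0.
- by move=> x _; rewrite mulr_ge0// sqr_ge0.
rewrite ge0_integralZ_EFin//; last by move=> x _; exact: sqr_ge0.
rewrite addeA; apply: leeD => //; apply: (le_trans tc); apply: leeD => //.
apply: lee_wpmul2r; first exact: cell_energy_ge0.
rewrite lee_fin -mulrA ler_pM2l// ler_pM2l//.
have sge0 : 0 <= s by have /andP[s1 _] := sP; exact: le_trans ler01 s1.
apply: lerXn2r; rewrite ?nnegrE ?powR_ge0//.
apply: ge0_ler_powR => //; rewrite ?nnegrE.
- exact: ltW (cg_h0 gE).
- exact: le_trans (ltW (cg_h0 gE)) (le_mesh_size j).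
- exact: le_mesh_size.
Qed.

(** Passes from a bound in terms of each choice of weak derivatives to one in terms of [normH],
    without using that the infimum is attained. *)
Lemma ereal_inf_sqr_le (S : set (\bar R)) (x y : \bar R) (a M : R) : (forall N, S N -> 0 <= N)%E ->
  (ereal_inf S <= M%:E)%E -> 0 <= M -> 0 <= a ->
  (forall N, S N -> x <= a%:E * N ^+ 2 + y)%E -> (x <= (a * M ^+ 2)%:E + y)%E.
Proof.
move=> S0 SM M0 a0 H; apply/lee_addgt0Pr => e e0.
(* As del <= 1, replacing M by M + del costs a (2 M del + del^2) <= a (2 M + 1) del <= e; the added
   1 keeps the denominator positive. *)
pose del := Num.min 1 (e / (a * (2 * M + 1) + 1)).
have den0 : 0 < a * (2 * M + 1) + 1 by rewrite ltr_wpDl// mulr_ge0// addr_ge0// mulr_ge0.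
have del0 : 0 < del by rewrite lt_min ltr01 divr_gt0.
have [|N SN NM] := @ereal_inf_lt _ S (M + del)%:E.
  by apply: le_lt_trans SM _; rewrite lte_fin ltrDl.
apply: (le_trans (H N SN)); rewrite addeAC; apply: leeD => //.
apply: (@le_trans _ _ (a * (M + del) ^+ 2)%:E).
  rewrite EFinM; apply: lee_wpmul2l; first by rewrite lee_fin.
  by rewrite EFin_expe; apply: lee_sqre2; [exact: S0|exact: ltW].
rewrite -EFinD lee_fin.
have d1 : del <= 1 by rewrite ge_min lexx.
have d2 : del * (a * (2 * M + 1) + 1) <= e by rewrite -ler_pdivlMr// ge_min lexx orbT.
have : a * (del ^+ 2) <= a * del by apply: ler_wpM2l => //; rewrite expr2 ler_piMl// ltW.
nra.
Qed.

End Pressure.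

(** * The constant and the conclusion *)

Section Final.
Variable R : realType.
Local Notation pt := (R * R)%type.
Local Notation mpt := (measurableTypeR R * measurableTypeR R)%type.
Local Notation mu := (leb2 R).

Lemma inHHdiv_inLpM (D : set pt) (tau : pt -> 'M[R]_2) : inHHdiv D tau -> inLpM 2%:E D tau.
Proof.
move=> Ht i j; have [/(_ 0 j) L _] := Ht i; move: L.
by rewrite (_ : (fun x => trow tau i x 0 j) = fun x => tau x i j)//; apply/funext => x; rewrite mxE.
Qed.

Lemma normH_ge0 m n (D : set pt) s (u : pt -> 'M[R]_(m, n)) : (0 <= normH D s u)%E.
Proof. by apply/ereal_infP => _ [g _ ->]; exact: poweR_ge0. Qed.

(** The function itself is the derivative of order (0, 0), whose norm is among the terms of the
    maximum. *)
Lemma normWinf_bounded m n (D : set pt) s (u : pt -> 'M[R]_(m, n)) : (normWinf D s u < +oo)%E ->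
  (normLpM +oo%E D u < +oo)%E.
Proof.
move=> /ereal_inf_lt[_ [g [<- _] ->]]; rewrite gt_max => /andP[+ _]; apply: le_lt_trans.
apply: le_trans (le_bigmax _ _ (ord0 : 'I_(Num.truncn s).+1)).
exact: (le_bigmax _ (fun b : 'I_((Num.truncn s).+1 - 0) => normLpM +oo%E D (g 0%N b)) ord0).
Qed.

Lemma ae_le_normLpM m n (D : set pt) (u : pt -> 'M[R]_(m, n)) (b : R) :
  normLpM +oo%E D u = b%:E -> {ae mu, forall x, D x -> frob (u x) <= b}.
Proof.
rewrite /normLpM /normLp unlock; case: ifPn => [_ e|]; last first.
  (* The norm is an essential supremum only if the whole plane has positive measure; in the
     remaining branch of its definition every set is null. *)
  rewrite -leNgt => mu0 _; exists setT; split => //.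
  by apply/eqP; rewrite eq_le mu0 measure_ge0.
have := @ess_sup_ge _ _ _ mu (abse \o (EFin \o (fun x => frob (u x)) \_ D)); rewrite e.
case=> N [mN N0 sN]; exists N; split => // x nx; apply: sN => /= le; apply: nx => Dx.
move: le; rewrite patchE mem_set//= lee_fin; apply: le_trans; exact: ler_norm.
Qed.

Lemma triple_norm_ge (D : set pt) (tau : pt -> 'M[R]_2) (v : pt -> 'cV[R]_2) (x : \bar R) :
  (triple_norm D tau v <= x)%E ->
  (normLpM 2%:E D tau ^+ 2 <= x ^+ 2)%E /\ (normLpM 2%:E D v ^+ 2 <= x ^+ 2)%E.
Proof.
move=> tx; have t0 : (0 <= triple_norm D tau v)%E by exact: poweR_ge0.
have := lee_sqre2 t0 tx; rewrite /triple_norm sqre_sqrte; last first.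
  by rewrite !adde_ge0// expe_ge0// normLpM_ge0.
have n0 m n (w : pt -> 'M[R]_(m, n)) : (0 <= normLpM 2%:E D w ^+ 2)%E.
  by rewrite expe_ge0// normLpM_ge0.
move=> h; split; apply: le_trans h.
  by rewrite -addeA leeDl// adde_ge0.
by rewrite leeDr// adde_ge0.
Qed.

(** From m >= sqrt 2 / 2 comes V^2 <= 2 m^2 V^2, so that the three terms are at most 12 K, 8 C0^2
    and C0^2 / 2 times m^2 V^2. The square of 3 C0 + 4 K + 4 contains 9 C0^2 and the cross term 32
    K, hence dominates 12 K + 9 C0^2. *)
Lemma pressure_const_le (K C0 b m CO V F: R) : 0 < K -> 0 < C0 -> 0 <= b -> 0 <= V -> 0 < CO ->
  0 <= F -> CO * F <= V ->
  Num.sqrt 2 / 2 <= m -> b <= m ->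
  6 * K * (CO * F) ^+ 2 + (4 * (C0 * V) ^+ 2 + b ^+ 2 / 2 * (C0 * V) ^+ 2) <=
   (m * ((3 * C0 + 4 * K + 4) * V)) ^+ 2.
Proof.
move=> K0 C00 b0 V0 CO0 F0 FV m1 m2.
have m0 : 0 <= m by exact: le_trans b0 m2.
have m12 : 2^-1 <= m ^+ 2.
  have -> : 2^-1 = (Num.sqrt 2 / 2) ^+ 2 :> R.
    by rewrite expr_div_n sqr_sqrtr//; field.
  by rewrite lerXn2r// ?nnegrE// divr_ge0// sqrtr_ge0.
have m22 : b ^+ 2 <= m ^+ 2 by rewrite lerXn2r.
have FV2 : (CO * F) ^+ 2 <= V ^+ 2 by rewrite lerXn2r ?nnegrE// mulr_ge0// ltW.
have V20 := sqr_ge0 V; have C20 := sqr_ge0 C0.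
move: ((CO * F) ^+ 2) FV2 => G GV; rewrite !exprMn.
apply: (@le_trans _ _ ((12 * K + 9 * C0 ^+ 2) * (m ^+ 2 * V ^+ 2))).
  have h1 : V ^+ 2 <= 2 * (m ^+ 2 * V ^+ 2) by nra.
  have h2 : b ^+ 2 * V ^+ 2 <= m ^+ 2 * V ^+ 2 by exact: ler_wpM2r.
  move: (m ^+ 2 * V ^+ 2) h1 h2 => W h1 h2.
  have h3 : K * G <= K * (2 * W) by apply: ler_wpM2l; [exact: ltW|exact: le_trans h1].
  have h4 := ler_wpM2l C20 h1; have h5 := ler_wpM2l C20 h2.
  have h6 : 0 <= C0 ^+ 2 * W by apply: mulr_ge0 => //; lra.
  lra.
rewrite [leRHS]mulrCA; apply: ler_wpM2r; first by apply: mulr_ge0; exact: sqr_ge0.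
nra.
Qed.

End Final.

(** C is fixed before the data, from C0 and a constant depending on s and eta only. The conclusion
    repeats the a priori estimate with C, so that both estimates hold with the same generic
    constant. *)
Theorem corollary4p3 (R : realType) (Omega : set (R * R)) (k : nat)
    (s chat eta C0 : R)
    (OmegaP : polygonal_domain Omega) (OmegaL : lipschitz_domain Omega)
    (sP : 1 <= s <= k.+1%:R) (chat0 : 0 < chat) (eta0 : 0 < eta)
    (C00 : 0 < C0) :
  exists C : R, 0 < C /\
  forall (nu kappa C_Omega c0 c1 : R) (beta f : R * R -> 'cV[R]_2)
    (I : Type) (T : I -> mesh R)
    (S : forall i : I, 'I_(ncell (T i)) ->
           (R * R -> 'M[R]_2) -> (R * R -> 'M[R]_2) -> R)
    (sigma : R * R -> 'M[R]_2) (u : R * R -> 'cV[R]_2) (p : R * R -> R)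
    (sigmah : I -> R * R -> 'M[R]_2) (uh : I -> R * R -> 'cV[R]_2)
    (ph : I -> R * R -> R),
  0 < nu -> 0 < kappa -> 0 < C_Omega -> 0 < c0 -> 0 < c1 ->
  (normWinf Omega 1 beta < +oo)%E ->
  inLpM 2%:E Omega f ->
  (forall i, is_mesh Omega (T i) /\ mesh_regular chat eta (T i)) ->
  (forall i (j : 'I_(ncell (T i))),
     stabilization k nu c0 c1 (cell (T i) j) (S i j)) ->
  continuous_solution Omega nu kappa beta f sigma u ->
  (forall i, discrete_solution k Omega nu kappa beta f (@S i)
               (sigmah i) (uh i)) ->
  (normH Omega s sigma + normH Omega (1 + s) (bdiv Omega sigma) +
   normH Omega (1 + s) u <= C_Omega%:E * normLpM 2%:E Omega f)%E ->
  inL20 Omega p ->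
  {ae leb2 R, forall x, Omega x ->
     p x = - 2^-1 * (\tr (sigma x) + \tr (otimes (u x) (beta x)))} ->
  (forall i, inL20 Omega (ph i) /\
     {ae leb2 R, forall x, Omega x ->
        ph i x = - 2^-1 * (\tr (Pih k (T i) (sigmah i) x) +
                           \tr (otimes (uh i x) (beta x)))}) ->
  let apriori (C' : R) :=
    forall i, (triple_norm Omega (sigma \- sigmah i)%R (u \- uh i)%R <=
      Chat C' C_Omega nu kappa c1 s Omega beta *
        (mesh_size (T i) `^ s)%:E * normLpM 2%:E Omega f)%E in
  apriori C0 ->
  apriori C /\
  forall i, (normLp 2%:E Omega (p \- ph i)%R <=
    bold_C C C_Omega nu kappa c1 s Omega beta *
      (mesh_size (T i) `^ s)%:E * normLpM 2%:E Omega f)%E.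
Proof.
have [B B0 hB] := moll_bounded R.
pose K := cell_const 2 2 (Num.truncn s) eta B; have K0 : 0 < K := cell_const_gt0 2 2 (Num.truncn s) eta B.
pose C := 3 * C0 + 4 * K + 4; have C0' : 0 < C by rewrite /C; lra.
have [_ oD _ bD _] := OmegaP.
exists C; split => // nu kappa CO c0 c1 beta f I T S sigma u p sigmah uh ph.
move=> nu0 kap0 CO0 c00 c10 Wb Lf Tm St [Hs Lu _ _] ds reg [Lp _] pE phE apriori apC0.
set Y := maxe (Num.max (C_nu nu c1) (Num.max 1 kappa))%:E
        (((2 + Num.sqrt 2) / (2 * nu))%:E * normWinf Omega s beta)%E.
(* The entry 1 in the maximum is what lets the approximation error, bounded in terms of C_Omega
   alone, be absorbed in C-hat. *)
have Y1 : (1%:E <= Y)%E by rewrite /Y le_max lee_fin !le_max lexx orbT.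
have Y0 : (0 <= Y)%E by apply: le_trans Y1; rewrite lee_fin.
have F0 := normLpM_ge0 2%:E Omega f.
have Ffin : normLpM 2%:E Omega f \is a fin_num.
  rewrite ge0_fin_numE// ltNge leye_eq; apply/negP => /eqP Foo.
  have sf := inLpM_sqr_intM oD oD (@subset_refl _ Omega) Lf.
  have [_ iff] := ddot_integral (open_measurable2 oD) sf sf.
  have : (normLpM 2%:E Omega f ^+ 2 < +oo)%E.
    rewrite normLpM2_sqr; under eq_integral do rewrite frob_sqr.
    by rewrite -EFin_Rint ?ltry//; exact: open_measurable2.
  by rewrite Foo.
set F := fine (normLpM 2%:E Omega f); have FE : normLpM 2%:E Omega f = F%:E by rewrite fineK.
have F0' : 0 <= F by rewrite -lee_fin -FE.
pose H i : R := mesh_size (T i) `^ s.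
have H0 i : 0 <= H i by exact: powR_ge0.
(* Both right-hand sides are multiples of V, linear in the generic constant; this reduces the claim
   to an inequality between real numbers. *)
pose V i : \bar R := (CO%:E * Y * (H i * F)%:E)%E.
have V0 i : (0 <= V i)%E by apply: mule_ge0; [apply: mule_ge0 => //; rewrite lee_fin ltW|rewrite lee_fin mulr_ge0].
have ChatE C' i : 0 <= C' -> (Chat C' CO nu kappa c1 s Omega beta * (H i)%:E * normLpM 2%:E Omega f =
    C'%:E * V i)%E.
  by move=> C'0; rewrite /Chat -/Y FE /V EFinM -!muleA -EFinM.
split=> [i|i].
  apply: le_trans (apC0 i) _; rewrite (ChatE C0 i (ltW C00)) (ChatE C i (ltW C0')).
  by apply: lee_wpmul2r => //; rewrite lee_fin /C; lra.
have [mT rT] := Tm i; have [[Hh _] [Luh _] _ _] := ds i.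
have Ls := inHHdiv_inLpM Hs.1; have Lsh := inHHdiv_inLpM Hh.1.
have [[Lph _] phEi] := phE i.
have bfin := normWinf_bounded Wb; have bge := normLpM_ge0 +oo%E Omega beta.
set b := fine (normLpM +oo%E Omega beta).
have bE : normLpM +oo%E Omega beta = b%:E by rewrite fineK// ge0_fin_numE.
have b0 : 0 <= b by rewrite -lee_fin -bE.
have betab := ae_le_normLpM bE.
have [T1 T2] := triple_norm_ge (apC0 i).
rewrite (ChatE C0 i (ltW C00)) in T1 T2.
have normHs : (normH Omega s sigma <= (CO * F)%:E)%E.
  apply: le_trans; last by rewrite EFinM -FE; exact: reg.
  by rewrite -addeA leeDl// adde_ge0// normH_ge0.
have a0 : 0 <= 6 * K * H i ^+ 2.
  by apply: mulr_ge0; [apply: mulr_ge0 => //; exact: ltW|exact: sqr_ge0].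
have main : (normLp 2%:E Omega (p \- ph i)%R ^+ 2 <=
   (6 * K * H i ^+ 2 * (CO * F) ^+ 2)%:E +
   (4%:E * (C0%:E * V i) ^+ 2 + (b ^+ 2 / 2)%:E * (C0%:E * V i) ^+ 2))%E.
  apply: (ereal_inf_sqr_le _ normHs) => //.
  - by move=> _ [g _ ->]; exact: poweR_ge0.
  - by rewrite mulr_ge0// ltW.
  move=> _ [g wp ->].
  apply: (le_trans (pressure_estimate oD eta0 mT rT hB sP wp Lsh Lu Luh Lp Lph betab pE phEi)).
  apply: leeD => //; apply: leeD; apply: lee_wpmul2l => //; rewrite lee_fin.
  by rewrite divr_ge0// sqr_ge0.
have boldE : (bold_C C CO nu kappa c1 s Omega beta * (H i)%:E * normLpM 2%:E Omega f =
   (Num.max (Num.sqrt 2 / 2) b)%:E * (C%:E * V i))%E.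
  rewrite /bold_C bE -EFin_max -(ChatE C i (ltW C0')).
  by rewrite !muleA.
rewrite boldE; set m := Num.max _ b.
have m1 : Num.sqrt 2 / 2 <= m by rewrite /m le_max lexx.
have m2 : b <= m by rewrite /m le_max lexx orbT.
have mpos : 0 < m by apply: lt_le_trans m1; rewrite divr_gt0// sqrtr_gt0.
(* V can be infinite when beta is not in W^{s,oo}; the bound is then +oo, because its other factors
   are positive. *)
have [Voo|Vfin] := eqVneq (V i) +oo%E.
  by rewrite Voo gt0_muley ?lte_fin// gt0_muley ?lte_fin// leey.
have {}Vfin : V i \is a fin_num by rewrite ge0_fin_numE// lt_neqAle Vfin leey.
apply: lee_sqre; first exact: normLp_ge0.
  by apply: mule_ge0; [rewrite lee_fin ltW|apply: mule_ge0 => //; rewrite lee_fin ltW].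
apply: (le_trans main).
have HFV : (((CO * (H i * F))%:E) <= V i)%E.
  rewrite /V EFinM; apply: lee_wpmul2r; first by rewrite lee_fin mulr_ge0.
  by rewrite -[leLHS]mule1; apply: lee_wpmul2l => //; rewrite lee_fin ltW.
rewrite -(fineK Vfin) in HFV V0 *; move: (fine (V i)) HFV => v.
rewrite -?EFinM -?EFin_expe -?EFinM -?EFinD !lee_fin => HFV.
have v0 : 0 <= v by apply: le_trans HFV; rewrite !mulr_ge0// ltW.
have HF0 : 0 <= H i * F by rewrite mulr_ge0.
have := pressure_const_le K0 C00 b0 v0 CO0 HF0 HFV m1 m2.
apply: le_trans; rewrite lerD2r !exprMn le_eqVlt; apply/orP; left; apply/eqP.
by ring.
Qed.
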